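(* Let $(\mu^\varepsilon,\bar\jmath^\varepsilon)_{\varepsilon>0}\subset\overline{\mathsf{CE}}_{\hat V}$, $\mu^\varepsilon=(\gamma^\varepsilon,\rho^\varepsilon)$ with $\rho^\varepsilon=\zeta^\varepsilon\pi^\varepsilon$, satisfy $\sup_{\varepsilon>0}\sup_{t\in[0,T]}\mathcal E_\varepsilon(\mu^\varepsilon(t))<\infty$ and $\sup_{\varepsilon>0}\widehat{\mathcal D}_\varepsilon(\mu^\varepsilon,\bar\jmath^\varepsilon)<\infty$. Then there exists $(\gamma,\bar\jmath)\in\widehat{\mathsf{CE}}$ satisfying $\bar\jmath^e_v(t)=-\bar\jmath^e_w(t)$ for all $e=vw\in E$ and a.e. $t\in[0,T]$ such that, along a subsequence $\varepsilon\to0$, (i) $\mu^\varepsilon(t)\rightharpoonup(\gamma(t),0)$ narrowly in $\mathcal P(M)$ for all $t\in[0,T]$; (ii) $\bar\jmath^\varepsilon(t)dt\rightharpoonup^*\bar\jmath(t)dt$ weakly-$*$ in the finite signed measures on $[0,T]\times\hat E$; and, along this subsequence, $$\liminf_{\varepsilon\to0}\mathcal E_\varepsilon(\mu^\varepsilon(t))\ge\mathcal E_0(\gamma(t))\ \text{ for all }t\in[0,T],\qquad\liminf_{\varepsilon\to0}\widehat{\mathcal D}_\varepsilon(\mu^\varepsilon,\bar\jmath^\varepsilon)\ge\widehat{\mathcal D}_0(\gamma,\bar\jmath).$$ In particular, if in addition $\mathcal E_\varepsilon(\mu^\varepsilon(0))\to\mathcal E_0(\gamma(0))$ as $\varepsilon\to0$,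 then $\liminf_{\varepsilon\to0}\widehat{\mathcal L}_\varepsilon(\mu^\varepsilon,\bar\jmath^\varepsilon)\ge\widehat{\mathcal L}_0(\gamma,\bar\jmath)$.
   Context: Graph. $(V,E)$ is a finite connected graph: $V$ is a finite node set, $E\subset V\times V$, $vv\notin E$, and $vw\in E$ implies $wv\notin E$. For $e=vw\in E$, $v$ is the tail, $w$ the head, $V(e)=\{v,w\}$; $E(v)$ is the set of edges containing $v$. Extended graph: $\hat V=V\cup E$, $\hat E=\{ev: e\in E,v\in V(e)\}$. Edge lengths $\ell^e>0$ are given, $L=\bigsqcup_{e\in E}[0,\ell^e]$, $M=(V,E,L)$. A function (measure) on $L$ is a family $(\varphi^e)_{e\in E}$ of functions (measures) on the intervals $[0,\ell^e]$. For $e=vw$ put $\varphi^e|_v=\varphi^e(0)$, $\varphi^e|_w=\varphi^e(\ell^e)$. $\mathcal P(M)$ is the set of $\mu=(\gamma,\rho)$ with $\gamma=(\gamma_v)_{v\in V}$ a nonnegative measure on $V$, $\rho$ a nonnegative measure on $L$ and $\sum_v\gamma_v+\sum_e\rho^e([0,\ell^e])=1$; $\mathcal P(V)$ is the set of probability measures on $V$. A measure and its Lebesgue density are denoted by the same symbol. Data. $(\omega,\pi)\in\mathcal P(M)$ with $\omega_v>0$ and $\pi^e(dx)=e^{-P^e(x)}dx$, $P^e$ Lipschitz; jump rates $r(e,v),r(v,e)>0$ ($e\in E$, $v\in V(e)$) satisfying the detailed balance condition $\kappa^e_v:=r(e,v)\sqrt{\pi^e|_v/\omega_v}=r(v,e)\sqrt{\omega_v/\pi^e|_v}$;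 $T>0$. Continuity equations. $\overline{\mathsf{CE}}_{\hat V}$ is the set of pairs $(\mu,\bar\jmath)$ with $\mu=(\gamma,\rho):[0,T]\to\mathcal P(M)$, $\bar\jmath(t)\in\mathbb R^{\hat E}$ measurable in $t$, such that $t\mapsto\big((\gamma_v(t))_{v},(\rho^e(t)([0,\ell^e]))_e\big)$ is absolutely continuous and for all $\phi:V\to\mathbb R$, $\bar\varphi:E\to\mathbb R$ and a.e. $t$ $$\frac{d}{dt}\Big[\sum_v\phi_v\gamma_v(t)+\sum_e\bar\varphi^e\rho^e(t)([0,\ell^e])\Big]=\sum_v\sum_{e\in E(v)}(\phi_v-\bar\varphi^e)\bar\jmath^e_v(t).$$ $\widehat{\mathsf{CE}}$ is the set of pairs $(\gamma,\bar\jmath)$ with $\gamma:[0,T]\to\mathcal P(V)$ absolutely continuous, $\bar\jmath(t)\in\mathbb R^{\hat E}$ measurable in $t$, and $\frac{d}{dt}\sum_v\phi_v\gamma_v(t)=\sum_v\sum_{e\in E(v)}\phi_v\bar\jmath^e_v(t)$ for all $\phi:V\to\mathbb R$ and a.e. $t$. Functionals. $\eta(r)=r\log r-r+1$; $\mathcal H(\mu|\nu)=\int\eta(\frac{d\mu}{d\nu})d\nu$ if $\mu\ll\nu$, $+\infty$ otherwise. $\mathsf C(r)=2r\log\frac{r+\sqrt{r^2+4}}2-2\sqrt{r^2+4}+4$, $\mathsf C(r|s)=s\,\mathsf C(r/s)$ for $s>0$, $\mathsf C(0|0)=0$, $\mathsf C(r|0)=+\infty$ for $r\ne0$. For $\varepsilon\ge0$: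 $Z^\varepsilon=\sum_v\omega_v+\varepsilon\sum_e\pi^e([0,\ell^e])$, $\pi^\varepsilon=\frac{\varepsilon}{Z^\varepsilon}\pi$, $\omega^\varepsilon=\frac1{Z^\varepsilon}\omega$. For $\varepsilon>0$: $\mathcal E_\varepsilon(\mu)=\sum_e\mathcal H(\rho^e|\pi^{\varepsilon,e})+\sum_v\mathcal H(\gamma_v|\omega^\varepsilon_v)$; $\mathcal E_0(\gamma)=\sum_v\mathcal H(\gamma_v|\omega^0_v)$. With $\sigma^{\varepsilon,e}_v(a,b)=\kappa^e_v\sqrt{ab}/\sqrt\varepsilon$, $$\widehat{\mathcal D}_\varepsilon(\mu,\bar\jmath)=\sum_v\sum_{e\in E(v)}\int_0^T\Big[\mathsf C\big(\bar\jmath^e_v\big|\sigma^{\varepsilon,e}_v(\gamma_v,\zeta^e\pi^{\varepsilon,e}|_v)\big)+2\sigma^{\varepsilon,e}_v(\omega^\varepsilon_v,\pi^{\varepsilon,e}|_v)\Big|\sqrt{\zeta^e}-\sqrt{\tfrac{\gamma_v}{\omega^\varepsilon_v}}\Big|^2\Big]dt$$ if $(\mu,\bar\jmath)\in\overline{\mathsf{CE}}_{\hat V}$ and $\rho^e=\zeta^e\pi^{\varepsilon,e}$ for some $\zeta:[0,T]\to\mathbb R^E$, and $\widehat{\mathcal D}_\varepsilon=+\infty$ otherwise; $\widehat{\mathcal L}_\varepsilon(\mu,\bar\jmath)=\mathcal E_\varepsilon(\mu(T))-\mathcal E_\varepsilon(\mu(0))+\widehat{\mathcal D}_\varepsilon(\mu,\bar\jmath)$.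 With $\mathsf{Harm}(a,b)=2/(\frac1a+\frac1b)$ and, for $e=vw\in E$, $$\overline\kappa_{vw}=\frac{\mathsf{Harm}\big(\pi^e|_v\,r(e,v),\ \pi^e|_w\,r(e,w)\big)}{2\sqrt{\omega_v\omega_w}},$$ $$\widehat{\mathcal D}_0(\gamma,\bar\jmath)=\sum_{e=vw\in E}\int_0^T\Big[\mathsf C\big(\bar\jmath^e_v\big|\overline\kappa_{vw}\sqrt{\omega^0_v\omega^0_w}\big)+2\,\overline\kappa_{vw}\sqrt{\omega^0_v\omega^0_w}\,\Big|\sqrt{\tfrac{\gamma_v}{\omega^0_v}}-\sqrt{\tfrac{\gamma_w}{\omega^0_w}}\Big|^2\Big]dt$$ if $(\gamma,\bar\jmath)\in\widehat{\mathsf{CE}}$ and $\bar\jmath^e_v=-\bar\jmath^e_w$ a.e. in $[0,T]$ for all $e=vw\in E$, and $\widehat{\mathcal D}_0=+\infty$ otherwise; $\widehat{\mathcal L}_0(\gamma,\bar\jmath)=\mathcal E_0(\gamma(T))-\mathcal E_0(\gamma(0))+\widehat{\mathcal D}_0(\gamma,\bar\jmath)$.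
   Formalization: In D̂_0 the second argument of C is taken as κ̄_vw√(γ_vγ_w) instead of κ̄_vw√(ω⁰_vω⁰_w); with the latter the liminf inequality for D̂ fails (e.g. three-node path, γ>ω⁰ at both ends of an edge with small flux). *)

(* Defs.v *)
From HB Require Import structures.
From mathcomp Require Import all_boot all_order all_algebra.
From mathcomp Require Import all_classical all_reals all_analysis.
Set Implicit Arguments.
Unset Strict Implicit.
Unset Printing Implicit Defensive.
Import Order.TTheory GRing.Theory Num.Theory.
Import numFieldNormedType.Exports.
Local Open Scope classical_set_scope.
Local Open Scope ring_scope.

Record metric_graph (R : realType) := MetricGraph {
  vertex : finType ;
  edge_set : {set vertex * vertex} ;
  edge_irrefl : forall v, (v, v) \notin edge_set ;
  edge_asym : forall v w, (v, w) \in edge_set -> (w, v) \notin edge_set ;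
  graph_connected : forall v w : vertex,
    connect [rel a b | ((a, b) \in edge_set) || ((b, a) \in edge_set)] v w ;
  len : {e | e \in edge_set} -> R ;
  len_gt0 : forall e, 0 < len e }.

Notation edge M := {e | e \in edge_set M}.

Section Graph.
Context {R : realType} {M : metric_graph R}.
Implicit Types (e : edge M) (v : vertex M).

Definition etail e : vertex M := (val e).1.
Definition ehead e : vertex M := (val e).2.

(* v \in V(e), equivalently e \in E(v).  Families indexed by the edges ev of
   the extended graph are functions of e and v, of which only the values at
   incident pairs are ever used. *)
Definition incident e v : bool := (v == etail e) || (v == ehead e).

Definition segment e : set R := `[0, len e]%classic.

(* phi^e|_v, for v \in V(e) *)
Definition endval (phi : edge M -> R -> R) e v : R :=
  if v == etail e then phi e 0 else phi e (len e).

End Graph.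

(* A measure on [0, len e] is a Borel measure on R vanishing outside it *)
Record probM (R : realType) (M : metric_graph R) := ProbM {
  gam : vertex M -> R ;
  rho : edge M -> {finite_measure set (measurableTypeR R) -> \bar R} ;
  gam_ge0 : forall v, 0 <= gam v ;
  rho_segment : forall e, rho e (~` segment e) = 0%E ;
  probM_mass :
    ((\sum_v gam v)%:E + \sum_(e : edge M) rho e (segment e) = 1)%E }.

Record probV (R : realType) (M : metric_graph R) := ProbV {
  weight :> vertex M -> R ;
  weight_ge0 : forall v, 0 <= weight v ;
  weight_mass : \sum_v weight v = 1 }.

Section Embedding.
Context {R : realType} {M : metric_graph R} (g : probV M).
Let rho0 (e : edge M) : {finite_measure set (measurableTypeR R) -> \bar R} :=
  mzero.
Let rho0_segment e : rho0 e (~` segment e) = 0%E.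
Proof. by []. Qed.
Let mass1 : ((\sum_v g v)%:E + \sum_(e : edge M) rho0 e (segment e) = 1)%E.
Proof. by rewrite weight_mass big1 // adde0. Qed.

(* the element (g, 0) of P(M) *)
Definition probV_probM : probM M := ProbM (@weight_ge0 _ _ g) rho0_segment mass1.
End Embedding.

Section Mass.
Context {R : realType} {M : metric_graph R}.
Definition rho_mass (m : probM M) (e : edge M) : R := fine (rho m e (segment e)).
End Mass.

Section Data.
Context (R : realType) (M : metric_graph R).

Record graph_data := GraphData {
  refm : probM M ;                      (* (omega, pi) *)
  pot : edge M -> R -> R ;              (* P^e *)
  rate_ev : edge M -> vertex M -> R ;   (* r(e, v) *)
  rate_ve : vertex M -> edge M -> R ;   (* r(v, e) *)
  omega_gt0 : forall v, 0 < gam refm v ;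
  pot_lipschitz : forall e, [lipschitz pot e x | x in segment e] ;
  pi_density : forall e (A : set (measurableTypeR R)), measurable A ->
    rho refm e A =
    (\int[lebesgue_measure]_(x in A `&` segment e) (expR (- pot e x))%:E)%E ;
  rate_ev_gt0 : forall e v, incident e v -> 0 < rate_ev e v ;
  rate_ve_gt0 : forall e v, incident e v -> 0 < rate_ve v e ;
  detailed_balance : forall e v, incident e v ->
    let piv := endval (fun e x => expR (- pot e x)) e v in
    rate_ev e v * Num.sqrt (piv / gam refm v) =
    rate_ve v e * Num.sqrt (gam refm v / piv) }.

End Data.

Section Reference.
Context {R : realType} {M : metric_graph R} (D : graph_data M).
Implicit Types (e : edge M) (v : vertex M).

Definition omega v : R := gam (refm D) v.
(* pi^e|_v, where pi^e stands for its Lebesgue density *)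
Definition pi_end e v : R := endval (fun e x => expR (- pot D e x)) e v.
Definition kappa e v : R := rate_ev D e v * Num.sqrt (pi_end e v / omega v).

Definition Zeps (eps : R) : R :=
  \sum_v omega v + eps * \sum_(e : edge M) rho_mass (refm D) e.

Lemma Zeps_ge0 eps : 0 <= eps -> 0 <= Zeps eps.
Proof.
move=> eps_ge0; apply: addr_ge0; first by apply: sumr_ge0 => v _; exact: gam_ge0.
by apply: mulr_ge0 => //; apply: sumr_ge0 => e _; exact: fine_ge0.
Qed.

Definition omega_eps (eps : R) v : R := omega v / Zeps eps.

Definition pi_scale (eps : {posnum R}) : {nonneg R} :=
  NngNum (divr_ge0 (ge0 eps) (Zeps_ge0 (ge0 eps))).

Definition pi_eps (eps : {posnum R}) e :
    {finite_measure set (measurableTypeR R) -> \bar R} :=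
  mscale (pi_scale eps) (rho (refm D) e).

Definition pi_eps_end (eps : {posnum R}) e v : R :=
  eps%:num / Zeps eps%:num * pi_end e v.

End Reference.

Section Functions.
Context {R : realType}.
Local Open Scope charge_scope.
Local Open Scope ring_scope.

(* ln 0 = 0 in the library, so that eta 0 = 1 *)
Definition eta (r : R) : R := r * ln r - r + 1.

Definition entropy (mu nu : {finite_measure set (measurableTypeR R) -> \bar R})
    : \bar R :=
  if `[< mu `<< nu >] then
    (\int[nu]_x (eta (fine ('d (charge_of_finite_measure mu) '/d nu x)))%:E)%E
  else +oo%E.

(* the same for the masses a, b of two measures on a single point *)
Definition entropy_pt (a b : R) : \bar R :=
  if (b == 0) && (a != 0) then +oo%E else (b * eta (a / b))%:E.

Definition Cfun (r : R) : R :=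
  2 * r * ln ((r + Num.sqrt (r ^+ 2 + 4)) / 2) - 2 * Num.sqrt (r ^+ 2 + 4) + 4.

Definition Cpersp (r s : R) : \bar R :=
  if 0 < s then (s * Cfun (r / s))%:E else if r == 0 then 0%E else +oo%E.

Definition Harm (a b : R) : R := 2 / (a^-1 + b^-1).

Definition abs_cont (a b : R) (f : R -> R) : Prop :=
  forall eps, 0 < eps -> exists2 delta, 0 < delta &
    forall (n : nat) (u v : 'I_n -> R),
      (forall i, [/\ a <= u i, u i <= v i & v i <= b]) ->
      trivIset setT (fun i => `]u i, v i[%classic) ->
      \sum_i (v i - u i) < delta ->
      \sum_i `|f (v i) - f (u i)| < eps.

End Functions.

Definition flux (R : realType) (M : metric_graph R) :=
  R -> edge M -> vertex M -> R.

(* Curves on [0, T] are functions on R, of which only the values on [0, T]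
   are used. *)

Section Continuity.
Context {R : realType} {M : metric_graph R} (T : R).
Notation leb := (@lebesgue_measure R).

Definition flux_measurable (j : flux M) : Prop :=
  forall e v, incident e v -> measurable_fun `[0, T] (fun t => j t e v).

Definition CE_bar (mu : R -> probM M) (j : flux M) : Prop :=
  [/\ flux_measurable j,
      forall v, abs_cont 0 T (fun t => gam (mu t) v),
      forall e, abs_cont 0 T (fun t => rho_mass (mu t) e) &
      forall (phi : vertex M -> R) (psi : edge M -> R),
        {ae leb, forall t, t \in `]0, T[ ->
          is_derive t 1
            (fun s => \sum_v phi v * gam (mu s) v
                      + \sum_(e : edge M) psi e * rho_mass (mu s) e)
            (\sum_v \sum_(e : edge M | incident e v)
               (phi v - psi e) * j t e v)} ].

Definition CE_hat (g : R -> probV M) (j : flux M) : Prop :=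
  [/\ flux_measurable j,
      forall v, abs_cont 0 T (fun t => g t v) &
      forall phi : vertex M -> R,
        {ae leb, forall t, t \in `]0, T[ ->
          is_derive t 1 (fun s => \sum_v phi v * g s v)
            (\sum_v \sum_(e : edge M | incident e v) phi v * j t e v)} ].

Definition flux_antisym (j : flux M) : Prop :=
  forall e, {ae leb, forall t, t \in `[0, T] ->
    j t e (etail e) = - j t e (ehead e)}.

End Continuity.

Section Functionals.
Context {R : realType} {M : metric_graph R} (D : graph_data M) (T : R).
Notation leb := (@lebesgue_measure R).

Definition energy_eps (eps : {posnum R}) (m : probM M) : \bar R :=
  (\sum_(e : edge M) entropy (rho m e) (pi_eps D eps e)
   + \sum_v entropy_pt (gam m v) (omega_eps D eps%:num v))%E.

Definition energy_0 (g : probV M) : \bar R :=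
  (\sum_v entropy_pt (g v) (omega_eps D 0 v))%E.

Definition sigma_eps (eps : {posnum R}) (e : edge M) v (a b : R) : R :=
  kappa D e v * Num.sqrt (a * b) / Num.sqrt eps%:num.

(* rho^e(t) = zeta^e(t) pi^{eps,e} on [0, T] *)
Definition has_density (eps : {posnum R}) (mu : R -> probM M)
    (zeta : R -> edge M -> R) : Prop :=
  forall t, t \in `[0, T] -> forall e (A : set (measurableTypeR R)),
    measurable A -> rho (mu t) e A = ((zeta t e)%:E * pi_eps D eps e A)%E.

Definition dissipation_int (eps : {posnum R}) (mu : R -> probM M)
    (j : flux M) (zeta : R -> edge M -> R) : \bar R :=
  (\sum_v \sum_(e : edge M | incident e v)
     \int[leb]_(t in `[0%R, T])
       (Cpersp (j t e v)
          (sigma_eps eps e v (gam (mu t) v) (zeta t e * pi_eps_end D eps e v))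
        + (2 * sigma_eps eps e v (omega_eps D eps%:num v) (pi_eps_end D eps e v)
           * `|Num.sqrt (zeta t e)
               - Num.sqrt (gam (mu t) v / omega_eps D eps%:num v)| ^+ 2)%:E))%E.

(* Since pi^{eps,e} is nonzero, zeta is determined on [0, T], and the value
   does not depend on the one chosen. *)
Definition dissipation_eps (eps : {posnum R}) (mu : R -> probM M) (j : flux M)
    : \bar R :=
  match pselect (CE_bar T mu j /\ exists zeta, has_density eps mu zeta) with
  | left h => dissipation_int eps mu j (sval (cid (proj2 h)))
  | right _ => +oo%E
  end.

Definition L_eps (eps : {posnum R}) (mu : R -> probM M) (j : flux M) : \bar R :=
  (energy_eps eps (mu T) - energy_eps eps (mu 0%R) + dissipation_eps eps mu j)%E.

Definition kappa_bar (e : edge M) : R :=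
  Harm (pi_end D e (etail e) * rate_ev D e (etail e))
       (pi_end D e (ehead e) * rate_ev D e (ehead e))
  / (2 * Num.sqrt (omega D (etail e) * omega D (ehead e))).

(* sigma-bar_{vw}(a, b), e = vw *)
Definition sigma_bar (e : edge M) (a b : R) : R := kappa_bar e * Num.sqrt (a * b).

(* The second argument of C is sigma-bar(gamma_v, gamma_w), as for
   dissipation_eps: it results from minimizing the two terms of
   dissipation_eps on the edge e over zeta^e and it is the one for which
   L_0 is nonnegative.  With sigma-bar(omega^0_v, omega^0_w) in its place the
   liminf inequality fails, e.g. on a path of three nodes when
   gamma > omega^0 on the two ends of an edge with a small flux. *)
Definition dissipation_0 (g : R -> probV M) (j : flux M) : \bar R :=
  if `[< CE_hat T g j /\ flux_antisym T j >] then
    (\sum_(e : edge M)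
      let v := etail e in let w := ehead e in
      let om := omega_eps D 0 in
      \int[leb]_(t in `[0%R, T])
        (Cpersp (j t e v) (sigma_bar e (g t v) (g t w))
         + (2 * sigma_bar e (om v) (om w)
            * `|Num.sqrt (g t v / om v) - Num.sqrt (g t w / om w)| ^+ 2)%:E))%E
  else +oo%E.

Definition L_0 (g : R -> probV M) (j : flux M) : \bar R :=
  (energy_0 (g T) - energy_0 (g 0%R) + dissipation_0 g j)%E.

End Functionals.

Section Convergences.
Context {R : realType} {M : metric_graph R}.
Notation leb := (@lebesgue_measure R).

(* P(M) is the set of probability measures on the disjoint union of V and of
   the segments, which is compact: the test functions are all continuous
   functions on it. *)
Definition narrow_cvg (mu : nat -> probM M) (m : probM M) : Prop :=
  forall (phi : vertex M -> R) (f : edge M -> R -> R),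
    (forall e, {within segment e, continuous (f e)}) ->
    (\sum_v phi v * gam (mu n) v
     + \sum_(e : edge M) (\int[rho (mu n) e]_(x in segment e) f e x)%R)
      @[n --> \oo] -->
    \sum_v phi v * gam m v
    + \sum_(e : edge M) (\int[rho m e]_(x in segment e) f e x)%R.

Definition flux_integrable (T : R) (j : flux M) : Prop :=
  forall (e : edge M) v, incident e v ->
    leb.-integrable `[0, T] (fun t => (j t e v)%:E).

(* j(t) dt as an element of the dual of the continuous functions on
   [0, T] x Ehat *)
Definition flux_pairing (T : R) (f : edge M -> vertex M -> R -> R) (j : flux M)
    : R :=
  \sum_v \sum_(e : edge M | incident e v)
    (\int[leb]_(t in `[0, T]) (f e v t * j t e v))%R.

Definition flux_weakstar_cvg (T : R) (js : nat -> flux M) (j : flux M) : Prop :=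
  [/\ forall n, flux_integrable T (js n), flux_integrable T j &
      forall f : edge M -> vertex M -> R -> R,
        (forall e v, incident e v -> {within `[0, T], continuous (f e v)}) ->
        flux_pairing T f (js n) @[n --> \oo] --> flux_pairing T f j].

End Convergences.

(* Main.v *)
Require Import Defs.
From HB Require Import structures.
From mathcomp Require Import all_boot all_order all_algebra.
From mathcomp Require Import ring lra.
From mathcomp Require Import all_classical all_reals all_analysis.
From mathcomp Require Import measurable_realfun.
Set Implicit Arguments.
Unset Strict Implicit.
Unset Printing Implicit Defensive.
Import Order.TTheory GRing.Theory Num.Theory.
Import numFieldNormedType.Exports.
Local Open Scope classical_set_scope.
Local Open Scope ring_scope.

(** On an edge [e] and an end [v] of it put [alpha e v = r(e,v) * pi^e|_v], let [g] be the
    square root of [gamma_v / omega_v] and [z] the square root of the mass on the edge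
    divided by [eps] times its [pi]-mass. In these variables the integrand of the
    dissipation becomes [C(j | alpha * g * z) + 2 * alpha * (z - g) ^ 2], without [eps]
    ([integrandE]): the parameter only says that the mass on the edge is [eps * z ^ 2] up
    to a constant, i.e. that the edges become reservoirs of vanishing capacity.

    Compactness. The function [C(j|s)] is bounded below by affine functions of [j] and [s]
    of arbitrarily large slope in [j]; the quadratic term of the integrand compensates
    for a large [s]. Hence the fluxes are equi-integrable in time, uniformly in [eps]
    ([halfcost_superlinear], [equiintegrable_flux]). The continuity equation makes the masses
    equicontinuous, so that they converge at all times along a diagonal subsequence
    together with the primitives of the fluxes ([convergent_subsequence]). A weak limit of
    the fluxes is the density of the charge obtained as limit of the integrals over
    measurable sets ([equiintegrable_ultra_density]). The time average of the mass on an edge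
    is [O(eps)] and the mass is equicontinuous, hence it tends to zero at each time
    ([rho_mass_cvg0]); by the continuity equation on the edge the two fluxes at its ends
    cancel in the limit ([limit_flux]). Convergence of primitives of functions bounded in
    [L^1] is weak-star convergence ([weakstar_cvg0]).

    Lower bounds. The entropy of finitely many masses is a supremum of functions affine in
    the masses and the weights ([sum_entropy_pt_liminf]). For the dissipation no limit of [z]
    is available. The sum of the integrands at the two ends of an edge is bounded below
    by the dual formula with slopes [p] and [q], and there the minimum over [z] can be taken
    explicitly ([tilt_le]). The result is linear in the two fluxes and continuous in the
    node densities, so that it passes to the limit. For opposite fluxes the supremum over
    [p] and [q] is exactly the integrand of the limit functional, in which the two ends of
    the edge act as resistances in series, whence the harmonic mean ([tilt_opt],
    [limit_integrandE]). The supremum over rational slopes is taken under the integral by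
    monotone convergence of finite maxima ([edge_liminf]).

    The inequality for the total functional follows because the initial energies converge
    to a finite limit ([liminf_diff]). *)

(** * The cost of a flux and its dual *)

Ltac nonneg := repeat first [ assumption | exact: sqr_ge0 | by []
  | apply: addr_ge0 | apply: mulr_ge0 | (apply: ltW; assumption) ].

Section Cost.
Context {R : realType}.
Implicit Types (j i s g k z p q a b : R).

(** Twice the hyperbolic cosine. *)
Definition cosh2 p : R := expR p + expR (- p).

Lemma cosh2_gt0 p : 0 < cosh2 p.
Proof. by rewrite addr_gt0 ?expR_gt0. Qed.

Lemma cosh2_ge2 p : 2 <= cosh2 p.
Proof.
have := expR_ge1Dx p; have := expR_ge1Dx (- p); rewrite /cosh2; lra.
Qed.

(** The function [s * Cfun (j / s)] is the Legendre transform in [j] of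
    [2 * s * (cosh2 p - 2)], after the rescaling of the dual variable by 2; the
    maximizer [p] solves [j = s * (exp p - exp (- p))]. *)
Lemma Cfun_dual j s : 0 < s -> exists2 p,
  j = s * (expR p - expR (- p)) & s * Cfun (j / s) = 2 * j * p - 2 * s * (cosh2 p - 2).
Proof.
move=> s0; set r := j / s; set q := Num.sqrt (r ^+ 2 + 4).
have q0 : 0 < q by rewrite sqrtr_gt0 ltr_wpDl ?sqr_ge0.
have q2 : q ^+ 2 = r ^+ 2 + 4 by rewrite sqr_sqrtr ?addr_ge0 ?sqr_ge0.
have y0 : 0 < (r + q) / 2.
  rewrite divr_gt0// -ltrBlDl sub0r.
  have [r0|r0] := ltP 0 r; first by rewrite (lt_trans _ q0)// oppr_lt0.
  by rewrite -(@ltr_pXn2r _ 2)// ?nnegrE ?oppr_ge0 ?(ltW q0)// q2 sqrrN ltrDl.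
have yV : ((r + q) / 2)^-1 = (q - r) / 2.
  apply: (mulfI (lt0r_neq0 y0)); rewrite divff ?gt_eqF//.
  have -> : (r + q) / 2 * ((q - r) / 2) = (q ^+ 2 - r ^+ 2) / 4 by field.
  by rewrite q2; field.
have jE : j = s * r by rewrite /r mulrC divfK ?gt_eqF.
exists (ln ((r + q) / 2)).
  by rewrite expRN lnK ?posrE// yV jE; by field.
rewrite /cosh2 expRN lnK ?posrE// yV /Cfun -/q jE; by field.
Qed.

(** Young inequality, including the degenerate case [s = 0]. The bound is affine in
    [j] and in [s], which is what makes weak limits accessible. *)
Lemma Cpersp_ge j s p : 0 <= s ->
  ((2 * j * p - 2 * s * (cosh2 p - 2))%:E <= Cpersp j s)%E.
Proof.
rewrite le_eqVlt => /predU1P[<-|s0]; rewrite /Cpersp.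
  rewrite ltxx; case: eqP => [->|_]; last by rewrite leey.
  by rewrite !(mulr0, mul0r, subr0).
rewrite s0 lee_fin; have [q -> ->] := Cfun_dual j s0.
have h1 : expR q * (1 + (p - q)) <= expR p.
  rewrite -[in leRHS](subrKC q p) expRD ler_pM2l ?expR_gt0//.
  exact: expR_ge1Dx.
have h2 : expR (- q) * (1 + (q - p)) <= expR (- p).
  rewrite -[in leRHS](_ : - q + (q - p) = - p); last by ring.
  by rewrite expRD ler_pM2l ?expR_gt0 ?expR_ge1Dx.
rewrite /cosh2.
move: h1 h2; set A := expR q; set B := expR (- q).
set A' := expR p; set B' := expR (- p) => h1 h2.
have : s * (A * (1 + (p - q)) + B * (1 + (q - p))) <= s * (A' + B').
  by rewrite ler_pM2l// lerD.
lra.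
Qed.

Lemma Cpersp_ge0 j s : 0 <= s -> (0 <= Cpersp j s)%E.
Proof.
move=> s0; apply: le_trans (Cpersp_ge j 0 s0).
by rewrite /cosh2 oppr0 expR0 lee_fin mulr0 sub0r subrr mulr0 oppr0.
Qed.

(** The integrand of the dissipation at an edge and one of its ends, where [g] and
    [z] are the square roots of the densities at the node and on the edge. *)
Definition halfcost a j g z : \bar R :=
  (Cpersp j (a * g * z) + (2 * a * (z - g) ^+ 2)%:E)%E.

Lemma halfcost_ge0 a j g z : 0 <= a -> 0 <= g -> 0 <= z ->
  (0 <= halfcost a j g z)%E.
Proof.
move=> a0 g0 z0; rewrite adde_ge0 ?Cpersp_ge0 ?mulr_ge0//.
by rewrite lee_fin mulr_ge0 ?sqr_ge0// mulr_ge0.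
Qed.

(** The cost is superlinear in the flux with a constant that depends on [g] only through
    its bound: large values of [z], which make the flux cheap, are paid for by the
    quadratic term. *)
Lemma halfcost_superlinear a G (e : R) : 0 < a -> 0 <= G -> 0 < e ->
  exists2 C : R, 0 <= C & forall j g z, 0 <= g <= G -> 0 <= z ->
    (`|j|%:E <= e%:E * halfcost a j g z + C%:E)%E.
Proof.
move=> a0 G0 e0.
(* With this slope the Young inequality bounds [`|j|] by [e] times the cost. *)
pose p := (2 * e)^-1.
have p0 : 0 < p by rewrite invr_gt0 mulr_gt0.
pose E := cosh2 p - 2.
have E0 : 0 <= E by rewrite subr_ge0 cosh2_ge2.
exists (e * (2 * E * a * G ^+ 2 + a * (E * G) ^+ 2)).
  by nonneg.
move=> j g z /andP[g0 gG] z0.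
have s0 : 0 <= a * g * z by nonneg.
have C1 : ((2 * `|j| * p - 2 * (a * g * z) * E)%:E <= Cpersp j (a * g * z))%E.
  have [j0|j0] := ger0P j; first exact: Cpersp_ge.
  apply: le_trans (Cpersp_ge j (- p) s0).
  by rewrite /E /cosh2 opprK (addrC (expR (- p))) !mulrN mulNr lee_fin.
rewrite /halfcost; case: (Cpersp j _) C1 => [c| |] /=; last 2 first.
- by move=> _; rewrite /= gt0_muley ?lte_fin// leey.
- by rewrite leeNy_eq.
rewrite lee_fin => C1; rewrite [leRHS](_ : _ = (e * (c + 2 * a * (z - g) ^+ 2)
  + e * (2 * E * a * G ^+ 2 + a * (E * G) ^+ 2))%:E)// lee_fin.
have pe : e * p = 1 / 2 by rewrite /p; field; rewrite gt_eqF.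
have -> : `|j| = e * (2 * `|j| * p) by rewrite mulrCA pe; field.
rewrite -mulrDr ler_pM2l//.
suff : 2 * (a * g * z) * E <= 2 * a * (z - g) ^+ 2 + 2 * E * a * G ^+ 2 + a * (E * G) ^+ 2.
  by move: C1; set x := 2 * (_ * _) * E; set y := 2 * a * _ ^+ 2; lra.
have -> : 2 * (a * g * z) * E = a * (2 * E * (g * z)) by ring.
have -> : 2 * a * (z - g) ^+ 2 + 2 * E * a * G ^+ 2 + a * (E * G) ^+ 2 =
  a * (2 * (z - g) ^+ 2 + 2 * E * G ^+ 2 + (E * G) ^+ 2) by ring.
rewrite ler_pM2l//.
have gG2 : g ^+ 2 <= G ^+ 2 by rewrite lerXn2r ?nnegrE.
have Eg : E * g <= E * G by rewrite ler_wpM2l.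
have gz : 2 * E * (g * z) <= 2 * E * g ^+ 2 + (z - g) ^+ 2 + (E * g) ^+ 2.
  rewrite -subr_ge0 (_ : _ - _ = (z - g - E * g) ^+ 2) ?sqr_ge0//; ring.
have h1 : 2 * E * g ^+ 2 <= 2 * E * G ^+ 2 by rewrite ler_wpM2l ?mulr_ge0.
have h2 : (E * g) ^+ 2 <= (E * G) ^+ 2 by rewrite lerXn2r ?nnegrE ?mulr_ge0// ltW.
have h3 := sqr_ge0 (z - g).
lra.
Qed.

(** The minimum over [z] of the part of the dual lower bound of two half costs which
    is not linear in the fluxes, cf. [halfcost_ge]. *)
Definition conc a b p q g k : R :=
  2 * a * g ^+ 2 + 2 * b * k ^+ 2
  - (a * g * cosh2 p + b * k * cosh2 q) ^+ 2 / (2 * (a + b)).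

Definition tilt a b p q j i g k : R := 2 * j * p + 2 * i * q + conc a b p q g k.

Lemma halfcost_ge a j g z p : 0 <= a -> 0 <= g -> 0 <= z ->
  ((2 * j * p + 2 * a * z ^+ 2 + 2 * a * g ^+ 2 - 2 * a * g * z * cosh2 p)%:E
    <= halfcost a j g z)%E.
Proof.
move=> a0 g0 z0; rewrite /halfcost.
apply: le_trans (leeD2r _ (Cpersp_ge j p _)); last by rewrite !mulr_ge0.
by rewrite -EFinD lee_fin le_eqVlt; apply/orP; left; apply/eqP; ring.
Qed.

(** The density [z] on the edge enters the two dual bounds through a quadratic
    polynomial; completing the square removes it. *)
Lemma tilt_le a b p q j i g k z : 0 < a -> 0 < b -> 0 <= g -> 0 <= k -> 0 <= z ->
  ((tilt a b p q j i g k)%:E <= halfcost a j g z + halfcost b i k z)%E.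
Proof.
move=> a0 b0 g0 k0 z0.
apply: le_trans (leeD (halfcost_ge j p (ltW a0) g0 z0) (halfcost_ge i q (ltW b0) k0 z0)).
rewrite -EFinD lee_fin -subr_ge0 /tilt /conc.
set X := cosh2 p; set Y := cosh2 q.
rewrite (_ : _ - _ =
  2 * (a + b) * (z - (a * g * X + b * k * Y) / (2 * (a + b))) ^+ 2).
  by nonneg.
by field; rewrite gt_eqF// addr_gt0.
Qed.

(** The result of minimizing the sum of two half costs with opposite fluxes over the
    density on the edge: the two resistances in series produce the harmonic mean of
    [a] and [b]. *)
Definition edgecost a b j g k : \bar R :=
  (Cpersp j (a * b / (a + b) * (g * k)) + (2 * (a * b / (a + b)) * (g - k) ^+ 2)%:E)%E.

(** There is no duality gap: the dual bounds [tilt] of the two half costs exhaust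
    [edgecost] when the two fluxes are opposite. *)
Lemma tilt_opt a b j g k (c : R) : 0 < a -> 0 < b -> 0 <= g -> 0 <= k ->
  (c%:E < edgecost a b j g k)%E -> exists p q, c < tilt a b p q j (- j) g k.
Proof.
move=> a0 b0 g0 k0.
have ab0 : 0 < a + b by rewrite addr_gt0.
have abN : a + b != 0 by rewrite gt_eqF.
have h0 : 0 < a * b / (a + b) by rewrite divr_gt0 ?mulr_gt0.
have c00 : cosh2 0 = 2 :> R by rewrite /cosh2 oppr0 expR0.
rewrite /edgecost; case: (eqVneq (g * k) 0) => [gk0|gk0].
  rewrite gk0 mulr0 /Cpersp ltxx; case: eqP => [-> |/eqP j0 _].
    rewrite add0e lte_fin => cd; exists 0, 0; apply: lt_le_trans cd _.
    rewrite /tilt /conc c00 le_eqVlt; apply/orP; left; apply/eqP; field.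
    by rewrite abN.
  have : g = 0 \/ k = 0.
    by move/eqP: gk0; rewrite mulf_eq0 => /orP[] /eqP; [left|right].
  (* The cost is infinite; the slope at the empty end can be as large as desired
     because its exponential term is multiplied by zero. *)
  move=> [{}g0|{}k0].
    exists ((c + 1 - conc a b 0 0 g k) / (2 * j)), 0.
    have -> : tilt a b ((c + 1 - conc a b 0 0 g k) / (2 * j)) 0 j (- j) g k =
        (c + 1 - conc a b 0 0 g k) + conc a b 0 0 g k.
      rewrite {1}/tilt {2}/conc g0 !(mulr0, mul0r, expr0n, addr0, add0r).
      by rewrite /conc; field; rewrite ?abN ?j0.
    by rewrite subrK ltrDl.
  exists 0, ((c + 1 - conc a b 0 0 g k) / (- 2 * j)).
  have -> : tilt a b 0 ((c + 1 - conc a b 0 0 g k) / (- 2 * j)) j (- j) g k =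
      (c + 1 - conc a b 0 0 g k) + conc a b 0 0 g k.
    rewrite {1}/tilt {2}/conc k0 !(mulr0, mul0r, expr0n, addr0, add0r).
    by rewrite /conc; field; rewrite ?abN ?j0.
  by rewrite subrK ltrDl.
have {}g0 : 0 < g by rewrite lt_neqAle g0 andbT; apply: contraNneq gk0 => <-; rewrite mul0r.
have {}k0 : 0 < k by rewrite lt_neqAle k0 andbT; apply: contraNneq gk0 => <-; rewrite mulr0.
have s0 : 0 < a * b / (a + b) * (g * k) by rewrite mulr_gt0// mulr_gt0.
have [r _ rE] := Cfun_dual j s0.
rewrite /Cpersp s0 rE -EFinD lte_fin => cr.
(* For opposite fluxes only the difference [r] of the two slopes enters linearly.
   The remaining freedom is used to minimize the square in [conc], a multiple of
   [(W * (A * Y + B) + W^-1 * (A / Y + B)) ^+ 2] with [W = expR q]: the minimum is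
   at [W ^+ 2 = w]. *)
pose A := a * g; pose B := b * k; pose Y := expR r.
have A0 : 0 < A by rewrite mulr_gt0.
have B0 : 0 < B by rewrite mulr_gt0.
have Y0 : 0 < Y by exact: expR_gt0.
pose w := (A / Y + B) / (A * Y + B).
have w0 : 0 < w by rewrite divr_gt0 ?addr_gt0 ?mulr_gt0 ?invr_gt0.
pose q := ln w / 2.
exists (r + q), q; apply: lt_le_trans cr _.
have W0 : 0 < expR q by exact: expR_gt0.
have W2 : expR q ^+ 2 = w by rewrite -expRM_natl /q mulrC divfK// lnK.
rewrite /tilt /conc.
have -> : (a * g * cosh2 (r + q) + b * k * cosh2 q) ^+ 2 =
   4 * (A ^+ 2 + B ^+ 2 + A * B * cosh2 r).
  rewrite -/A -/B /cosh2 opprD !expRD !expRN -/Y; set W := expR q in W0 W2 *.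
  have -> : (A * (Y * W + Y^-1 * W^-1) + B * (W + W^-1)) ^+ 2 =
    W ^+ 2 * (A * Y + B) ^+ 2 + (W ^+ 2)^-1 * (A / Y + B) ^+ 2 + 2 * ((A * Y + B) * (A / Y + B)).
    by field; rewrite !gt_eqF.
  rewrite W2 /w; field.
  by rewrite !gt_eqF// ?addr_gt0 ?mulr_gt0.
rewrite le_eqVlt; apply/orP; left; apply/eqP; rewrite /A /B; field.
by rewrite abN.
Qed.

Lemma cosh2_continuous : continuous (cosh2 : R -> R).
Proof.
move=> x; apply: cvgD; first exact: continuous_expR.
by apply: continuous_comp; [exact: opp_continuous|exact: continuous_expR].
Qed.

Lemma lt_continuous_rat (f : R -> R) c p : continuous f -> c < f p ->
  exists r : rat, c < f (ratr r).
Proof.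
move=> cf cp.
have fo : open (f @^-1` [set y | c < y]).
  by apply: open_comp => [x _|]; [exact: cf|exact: open_gt].
have [|x [/= cx [r _ rx]]] := @dense_rat R _ _ fo; first by exists p.
by exists r; rewrite rx.
Qed.

(** Rational slopes suffice by continuity; countably many lower bounds can then be
    combined under the integral sign. *)
Lemma tilt_opt_rat a b j g k (c : R) : 0 < a -> 0 < b -> 0 <= g -> 0 <= k ->
  (c%:E < edgecost a b j g k)%E ->
  exists p q : rat, c < tilt a b (ratr p) (ratr q) j (- j) g k.
Proof.
move=> a0 b0 g0 k0 /(tilt_opt a0 b0 g0 k0)[p [q cpq]].
have [p' cp'] : exists p' : rat, c < tilt a b (ratr p') q j (- j) g k.
  apply: (@lt_continuous_rat (fun p => tilt a b p q j (- j) g k) _ p) => //.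
  move=> x; rewrite /tilt /conc.
  apply: cvgD; first by apply: cvgD; [apply: cvgM; [exact: cvg_cst|exact: cvg_id]|exact: cvg_cst].
  apply: cvgB; first exact: cvg_cst.
  apply: cvgM; last exact: cvg_cst.
  by apply: cvgM; (apply: cvgD; [apply: cvgM; [exact: cvg_cst|exact: cosh2_continuous]|exact: cvg_cst]).
have [q' cq'] : exists q' : rat, c < tilt a b (ratr p') (ratr q') j (- j) g k.
  apply: (@lt_continuous_rat (fun q => tilt a b (ratr p') q j (- j) g k) _ q) => //.
  move=> x; rewrite /tilt /conc.
  apply: cvgD; first by apply: cvgD; [exact: cvg_cst|apply: cvgM; [exact: cvg_cst|exact: cvg_id]].
  apply: cvgB; first exact: cvg_cst.
  apply: cvgM; last exact: cvg_cst.
  by apply: cvgM; (apply: cvgD; [exact: cvg_cst|apply: cvgM; [exact: cvg_cst|exact: cosh2_continuous]]).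
by exists p', q'.
Qed.

End Cost.

(** * Weak limits of equi-integrable families *)

Lemma ultra_bounded_cvg (I : Type) (U : set_system I) (R : realType) (u : I -> R) (B : R) :
  UltraFilter U -> (forall i, `|u i| <= B) -> exists l : R, u i @[i --> U] --> l.
Proof.
move=> UU uB.
have [|p [_ cp]] := @segment_compact R (- B) B (u @ U) _.
  apply: (@filterS _ U _ setT); last exact: filterT.
  by move=> i _ /=; rewrite in_itv/= -ler_norml.
exists p => V Vp; have [//|UV] := in_ultra_setVsetC (u @^-1` V) UU.
by have [y []] := cp (~` V) V UV Vp.
Qed.

Lemma cvg_le_bound (I : Type) (F : set_system I) (R : realType) (u : I -> R) (l B : R) :
  ProperFilter F -> u i @[i --> F] --> l -> (forall i, u i <= B) -> l <= B.
Proof.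
move=> FF ul uB; rewrite -(cvg_lim _ ul)//; apply: limr_le; first by apply/cvg_ex; exists l.
exact: nearW.
Qed.

Section EquiIntegrable.
Context d (T : measurableType d) (R : realType).
Variables (mu : {sigma_finite_measure set T -> \bar R}) (D : set T).
Hypotheses (mD : measurable D) (Dfin : (mu D < +oo)%E).

(** The usual definition with small sets is recovered from [e + C * mu A]; the affine
    form gives a bound of the norms at the same time. *)
Definition equiintegrable (I : Type) (f : I -> T -> R) : Prop :=
  (forall i, mu.-integrable D (EFin \o f i)) /\
  forall e, 0 < e -> exists2 C : R, 0 <= C &
    forall i A, measurable A -> A `<=` D ->
      \int[mu]_(x in A) `|f i x| <= e + C * fine (mu A).

Section UltraDensity.
Variables (I : Type) (U : set_system I) (UU : UltraFilter U) (f : I -> T -> R).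
Hypothesis fe : equiintegrable f.

Let intfA i A : measurable A -> mu.-integrable (A `&` D) (EFin \o f i).
Proof.
by move=> mA; apply: integrableS (fe.1 i) => //; exact: measurableI.
Qed.

Let val i A := \int[mu]_(x in A `&` D) f i x.

Let val_le (e : R) : 0 < e -> exists2 C : R, 0 <= C & forall i A, measurable A ->
  `|val i A| <= e + C * fine (mu (A `&` D)).
Proof.
move=> e0; have [C C0 fC] := fe.2 _ e0; exists C => // i A mA.
apply: le_trans (le_normr_Rintegral _ _) _; [exact: measurableI|exact: intfA|].
by apply: fC => //; exact: measurableI.
Qed.

Let val_cvg A : measurable A -> exists l : R, val i A @[i --> U] --> l.
Proof.
move=> mA; have [C C0 vC] := val_le ltr01.
by apply: (@ultra_bounded_cvg _ _ _ _ (1 + C * fine (mu (A `&` D)))) => i; exact: vC.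
Qed.

Let nuR A : R := lim (val i A @[i --> U]).

Let nuR_cvg A : measurable A -> val i A @[i --> U] --> nuR A.
Proof. by move=> /val_cvg [l vl]; rewrite /nuR (cvg_lim _ vl). Qed.

(** Equi-integrability survives in the limit and gives both absolute continuity and
    countable additivity of the limit. *)
Let nuR_le (e : R) : 0 < e -> exists2 C : R, 0 <= C & forall A, measurable A ->
  `|nuR A| <= e + C * fine (mu (A `&` D)).
Proof.
move=> e0; have [C C0 vC] := val_le e0; exists C => // A mA.
have : `|val i A| @[i --> U] --> `|nuR A| by apply: cvg_norm; exact: nuR_cvg.
by move=> /cvg_le_bound; apply => i; exact: vC.
Qed.

Let nuRU A B : measurable A -> measurable B -> A `&` B = set0 ->
  nuR (A `|` B) = nuR A + nuR B.
Proof.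
move=> mA mB AB; apply: (@cvg_unique _ _ (val i (A `|` B) @[i --> U])) => //.
  exact/nuR_cvg/measurableU.
rewrite (_ : (fun i => _) = (fun i => val i A + val i B)).
  by apply: cvgD; exact: nuR_cvg.
apply/funext => i; rewrite /val setIUl Rintegral_setU//; try exact: measurableI.
  by rewrite -setIUl; apply: intfA; exact: measurableU.
by apply/disj_set2P; rewrite setIACA AB set0I.
Qed.

Let nu A : \bar R := (nuR A)%:E.

Let nuR0 : nuR set0 = 0.
Proof.
have := nuRU measurable0 measurable0 (set0I _); rewrite setU0 => /eqP.
by rewrite -subr_eq0 opprD addNKr oppr_eq0 => /eqP.
Qed.

Let nu0 : nu set0 = 0%E. Proof. by rewrite /nu nuR0. Qed.

Let nufin A : measurable A -> nu A \is a fin_num. Proof. by []. Qed.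

Let nu_sigma : semi_sigma_additive nu.
Proof.
move=> F mF tF mUF.
pose S n := \big[setU/set0]_(i < n) F i.
have mS n : measurable (S n) by apply: bigsetU_measurable => i _; exact: mF.
have nuS n : nuR (S n) = \sum_(0 <= i < n) nuR (F i).
  elim: n => [|n IH]; first by rewrite /S big_ord0 big_nil nuR0.
  rewrite /S big_ord_recr/= nuRU//; first by rewrite big_nat_recr//= -IH.
    exact: mS.
  rewrite -/(S n) /S; apply/seteqP; split => // x [].
  rewrite -bigcup_mkord => -[k /= kn Fk] Fn.
  by have kE := tF k n Logic.I Logic.I (ex_intro _ x (conj Fk Fn)); rewrite /= kE ltnn in kn.
pose Tl n := \bigcup_i F i `\` S n.
have mTl n : measurable (Tl n) by exact: measurableD.
have nuT n : nuR (\bigcup_i F i) = nuR (S n) + nuR (Tl n).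
  rewrite -nuRU//; last by rewrite /Tl setDIK.
  congr nuR; rewrite /Tl setUDr ?setDv ?setD0; last first.
  apply/seteqP; split => [x|x [|//]]; first by right.
  by rewrite /S -bigcup_mkord => -[k _ Fk]; exists k.
have Tl0 : mu (Tl n `&` D) @[n --> \oo] --> 0%E.
  rewrite (_ : 0%E = mu (\bigcap_n (Tl n `&` D))).
    apply: (@nonincreasing_cvg_mu _ _ _ mu (fun n => Tl n `&` D)).
    - apply: le_lt_trans Dfin; apply: le_measure; rewrite ?inE//.
      exact: measurableI.
    - by move=> n; exact: measurableI.
    - by apply: bigcap_measurable => // n _; exact: measurableI.
    - move=> m n mn; apply/subsetPset; apply: setSI; apply: setDS.
      by rewrite /S; exact: subset_bigsetU.
  rewrite (_ : \bigcap_n _ = set0) ?measure0//; apply/seteqP; split => // x /= xT.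
  have [[[k _ Fkx] _] _] := xT 0%N Logic.I.
  have [[_ +] _] := xT k.+1 Logic.I; apply.
  by rewrite /S -bigcup_mkord; exists k => /=.
rewrite (_ : (fun n => _) = (fun n => (nuR (S n))%:E)); last first.
  by apply/funext => n; rewrite nuS sumEFin.
apply: cvg_EFin; first exact: nearW.
apply/cvgrPdist_le => e e0.
have e20 : 0 < e / 2 by rewrite divr_gt0.
have [C C0 nC] := nuR_le e20.
have {Tl0} : fine (mu (Tl n `&` D)) @[n --> \oo] --> (0 : R).
  exact: (@fine_cvg _ _ _ _ (fun n => mu (Tl n `&` D))).
move=> /cvgrPdist_lt /(_ (e / 2 / (C + 1))) H.
near=> n.
have -> : (fine \o (fun n => (nuR (S n))%:E)) n = nuR (S n) by [].
rewrite (nuT n) addrC addKr.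
apply: le_trans (nC _ (mTl n)) _.
suff : C * fine (mu (Tl n `&` D)) <= e / 2 by lra.
have m0 : 0 <= fine (mu (Tl n `&` D)) by exact: fine_ge0.
have : fine (mu (Tl n `&` D)) <= e / 2 / (C + 1).
  apply/ltW; rewrite -[ltLHS]ger0_norm// -normrN -sub0r; near: n; apply: H.
  by rewrite divr_gt0// ltr_wpDl.
rewrite ler_pdivlMr ?ltr_wpDl// => h; apply: le_trans h; rewrite mulrC ler_wpM2l// lerDl//.
Unshelve. all: by end_near. Qed.

HB.instance Definition _ := isCharge.Build _ _ _ nu nu0 nufin nu_sigma.

(** The Dunford-Pettis theorem in the form needed here. Along an ultrafilter the
    integrals over each measurable set converge because they are bounded; the limit
    is a finite charge dominated by [mu], and its density is the weak limit. *)
Lemma equiintegrable_ultra_density : exists g : T -> R,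
  mu.-integrable D (EFin \o g) /\
  forall A, measurable A -> A `<=` D ->
    \int[mu]_(x in A) f i x @[i --> U] --> \int[mu]_(x in A) g x.
Proof.
have numu : nu `<< mu.
  apply/null_content_dominatesP => A mA A0.
  apply/eqP; rewrite eqe -normr_le0; apply/ler_addgt0Pl => e e0.
  have [C C0 nC] := nuR_le e0; rewrite addr0; apply: le_trans (nC _ mA) _.
  rewrite (_ : mu (A `&` D) = 0%E) ?mulr0 ?addr0//.
  by apply: (subset_measure0 _ _ _ A0) => //; exact: measurableI.
pose h := Radon_Nikodym nu mu.
have hfin x : h x \is a fin_num by exact: Radon_Nikodym_fin_num.
have hE : EFin \o (fine \o h) = h by apply/funext => x /=; rewrite fineK.
have hi : mu.-integrable setT h by exact: Radon_Nikodym_integrable.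
exists (fine \o h); rewrite hE; split; first exact: integrableS hi.
move=> A mA AD.
have -> : \int[mu]_(x in A) (fine \o h) x = nuR A.
  rewrite /Rintegral; under eq_integral do rewrite /= fineK//.
  by rewrite -Radon_Nikodym_integral.
have := nuR_cvg mA; rewrite /val.
by rewrite (_ : A `&` D = A)//; exact/setIidPl.
Qed.

End UltraDensity.
End EquiIntegrable.

(** * Absolutely continuous functions *)

Section AbsolutelyContinuous.
Context {R : realType}.
Implicit Types (a b u v x y t c : R) (f g F : R -> R).
Notation leb := (@lebesgue_measure R).

(** Compactness of the interval, in the form that a property of subintervals which is
    local and additive holds globally. The supremum of the good right end points is
    good and cannot be smaller than [b]. *)
Lemma interval_induction a b (Q : R -> R -> Prop) : a <= b ->
  (forall x y z, a <= x -> x <= y -> y <= z -> z <= b ->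
     Q x y -> Q y z -> Q x z) ->
  (forall x, a <= x <= b -> exists2 d, 0 < d &
     forall u v, a <= u -> u <= x -> x <= v -> v <= b -> v - u < d -> Q u v) ->
  Q a b.
Proof.
move=> ab Qtrans Qloc.
pose S := [set t | a <= t <= b /\ Q a t].
have Sa : S a.
  split; first by rewrite lexx.
  have [|d d0 Qd] := Qloc a; first by rewrite lexx.
  by apply: Qd; rewrite ?lexx// subrr.
have ubS : ubound S b by move=> t [/andP[]].
have hS : has_sup S by split; [exists a|exists b].
set s := sup S.
have as_ : a <= s by apply: ub_le_sup => //; exists b.
have sb : s <= b by apply: ge_sup => //; exists a.
have [|d d0 Qd] := Qloc s; first by rewrite as_.
have [t [/andP[at_ tb] Qat] st] := sup_adherent d0 hS.
have ts : t <= s by apply: ub_le_sup => //; [exists b|split => //; rewrite at_].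
have Qas : Q a s.
  by apply: (Qtrans _ t) => //; apply: Qd => //; rewrite ltrBlDl -ltrBlDr.
have [sltb|] := ltP s b; last first.
  by move=> bs; have <- : s = b by apply/eqP; rewrite eq_le sb.
pose w := Num.min b (s + d / 2).
have sw : s < w by rewrite lt_min sltb ltrDl divr_gt0.
have wb : w <= b by rewrite ge_min lexx.
have wd : w - s < d.
  rewrite ltrBlDl (@le_lt_trans _ _ (s + d / 2))//.
    by rewrite ge_min lexx orbT.
  by rewrite ltrD2l ltr_pdivrMr// mulr_natr mulr2n ltrDl.
have : w <= s.
  apply: ub_le_sup => //; first by exists b.
  split; first by rewrite wb (le_trans as_ (ltW sw)).
  by apply: (Qtrans _ s) => //; [exact: ltW|apply: Qd => //; exact: ltW].
by rewrite leNgt sw.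
Qed.

Lemma abs_contB a b f g : abs_cont a b f -> abs_cont a b g ->
  abs_cont a b (fun t => f t - g t).
Proof.
move=> fac gac e e0.
have [|d d0 fd] := fac (e / 2); first by rewrite divr_gt0.
have [|d' d'0 gd] := gac (e / 2); first by rewrite divr_gt0.
exists (Num.min d d'); first by rewrite lt_min d0.
move=> n u v uv tuv; rewrite lt_min => /andP[ud ud'].
apply: (@le_lt_trans _ _ (\sum_(i < n) (`|f (v i) - f (u i)| + `|g (v i) - g (u i)|))).
  apply: ler_sum => i _.
  by rewrite (_ : _ - _ - _ = (f (v i) - f (u i)) - (g (v i) - g (u i))) ?ler_normB//; ring.
rewrite big_split/= [ltRHS]splitr.
by apply: ltrD; [exact: fd|exact: gd].
Qed.

Lemma abs_cont_eq a b f g : {in `[a, b], f =1 g} -> abs_cont a b f -> abs_cont a b g.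
Proof.
move=> fg fac e e0; have [d d0 fd] := fac e e0; exists d => // n u v uv tuv ud.
apply: le_lt_trans (fd n u v uv tuv ud); apply: ler_sum => i _.
by have [au uv' vb] := uv i; rewrite !fg// in_itv/= ?au ?vb ?(le_trans au) ?(le_trans uv').
Qed.

Lemma abs_cont_within a b f : abs_cont a b f -> {within `[a, b], continuous f}.
Proof.
move=> fac; apply/subspace_continuousP => x xab; apply/cvgrPdist_lt => e e0.
have [d d0 fd] := fac e e0.
have key u v : a <= u -> u <= v -> v <= b -> v - u < d -> `|f v - f u| < e.
  move=> au uv vb uvd.
  have := fd 1%N (fun=> u) (fun=> v); rewrite !big_ord1; apply => //.
  by move=> i j _ _ _; rewrite (ord1 i) (ord1 j).
rewrite /= in_itv/= in xab; have /andP[ax xb] := xab.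
rewrite near_withinE; near=> y.
rewrite /= in_itv/= => /andP[ay yb].
have xyd : `|x - y| < d by near: y; exact: cvgr_dist_lt.
have [xy|/ltW yx] := leP x y.
  by rewrite distrC; apply: key => //; rewrite ler0_norm ?subr_le0// opprB in xyd.
by apply: key => //; rewrite ger0_norm ?subr_ge0// in xyd.
Unshelve. all: by end_near. Qed.

Lemma sum_Rintegral_itv n (u v : 'I_n -> R) (h : R -> R) :
  leb.-integrable setT (EFin \o h) ->
  trivIset setT (fun i => `]u i, v i[%classic) ->
  \sum_i \int[leb]_(x in `]u i, v i[) `|h x| =
  \int[leb]_(x in \big[setU/set0]_i `]u i, v i[%classic) `|h x|.
Proof.
move=> ih tuv; rewrite /Rintegral integral_bigsetU_EFin//=.
- rewrite -sum_fine// => i _; apply: integrable_fin_num => //.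
  by apply: integrable_norm; exact: integrableS ih.
- exact: index_enum_uniq.
- by move=> i j _ _; exact: tuv.
- apply/measurable_EFinP; apply: measurable_funTS; apply: measurableT_comp => //.
  by apply/measurable_EFinP; exact: (measurable_int leb).
Qed.

Lemma sum_length_itv n (u v : 'I_n -> R) :
  (forall i, u i <= v i) ->
  trivIset setT (fun i => `]u i, v i[%classic) ->
  (\sum_i (v i - u i))%:E = leb (\big[setU/set0]_i `]u i, v i[%classic).
Proof.
move=> uv tuv; rewrite -[RHS]mul1e -integral_cst//; last exact: bigsetU_measurable.
rewrite (@integral_bigsetU_EFin _ _ _ leb _ _ (cst 1))//.
- rewrite -sumEFin; apply: eq_bigr => i _.
  have -> : (\int[leb]_(x in `]u i, v i[) (cst 1 x)%:E = leb `]u i, v i[)%E.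
    by rewrite -[RHS]mul1e -integral_cst.
  rewrite lebesgue_measure_itv/= lte_fin.
  have := uv i; rewrite le_eqVlt => /predU1P[->|->]; first by rewrite ltxx subrr.
  by rewrite EFinB.
- exact: index_enum_uniq.
- by move=> i j _ _; exact: tuv.
- by apply/measurable_EFinP; exact: measurable_cst.
Qed.

Section Primitive.
Variables (a b : R) (g : R -> R).
Hypothesis ig : leb.-integrable `[a, b] (EFin \o g).

Definition prim t := \int[leb]_(x in `[a, t]) g x.

Let ig0 : leb.-integrable setT (EFin \o (g \_ `[a, b])).
Proof. by rewrite -restrict_EFin; apply/(integrable_mkcond _ _).1. Qed.

Let primE t : t <= b -> prim t = \int[leb]_(x in `[a, t]) (g \_ `[a, b]) x.
Proof.
move=> tb; apply: eq_Rintegral => x; rewrite inE/= in_itv/= => /andP[ax xt].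
by rewrite patchE mem_set//= in_itv/= ax (le_trans xt).
Qed.

Lemma primB u v : a <= u -> u <= v -> v <= b ->
  prim v - prim u = \int[leb]_(x in `]u, v]) g x.
Proof.
move=> au uv vb; rewrite /prim Rintegral_itvB//.
by apply: integrableS ig => //; apply: subset_itvl; rewrite bnd_simp.
Qed.

Lemma prim0 : prim a = 0.
Proof. by rewrite /prim set_itv1 Rintegral_set1. Qed.

Lemma primB_le u v : a <= u -> u <= v -> v <= b ->
  `|prim v - prim u| <= \int[leb]_(x in `]u, v[) `|g x|.
Proof.
move=> au uv vb; rewrite primB//.
have iuv : leb.-integrable `]u, v] (EFin \o g).
  apply: integrableS ig => //; apply: subset_itv; rewrite bnd_simp//.
apply: le_trans (le_normr_Rintegral _ iuv) _ => //.
rewrite Rintegral_itv_bndo_bndc//; apply: integrable_norm.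
by apply: integrableS iuv => //; apply: subset_itvl; rewrite bnd_simp.
Qed.

Lemma abs_cont_prim : abs_cont a b prim.
Proof.
move=> e e0; have [d [d0 gd]] := integral_normr_continuous ig0 e0.
exists d => // n u v uv tuv uvd.
apply: (@le_lt_trans _ _ (\sum_i \int[leb]_(x in `]u i, v i[) `|(g \_ `[a, b]) x|)).
  apply: ler_sum => i _; have [au uvi vb] := uv i.
  apply: le_trans (primB_le au uvi vb) _; rewrite le_eqVlt; apply/orP; left.
  apply/eqP; apply: eq_Rintegral => x; rewrite inE/= in_itv/= => /andP[ux xv].
  by rewrite patchE mem_set//= in_itv/= (le_trans au (ltW ux)) (le_trans (ltW xv) vb).
rewrite sum_Rintegral_itv//; apply: gd; first exact: bigsetU_measurable.
by rewrite [ltLHS](_ : _ = (\sum_i (v i - u i))%:E) ?lte_fin// sum_length_itv// => i; have [] := uv i.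
Qed.

Lemma prim_ae_derive :
  {ae leb, forall t, t \in `]a, b[ -> is_derive t 1 prim (g t)}.
Proof.
have ig1 y : leb.-integrable [set` Interval (BLeft a) (BRight y)] (EFin \o (g \_ `[a, b])).
  exact: integrableS ig0.
have := FTC1 ig1 (integrable_locally_restrict (measurable_itv _) ig).
apply: filterS; first exact: (ae_filter_ringOfSetsType leb).
move=> t Ht; rewrite in_itv/= => /andP[at_ tb].
have [|dG GE] := Ht; first by rewrite lte_fin.
have nE : \forall y \near t, \int[leb]_(x in `[a, y]) (g \_ `[a, b]) x = prim y.
  near=> y; rewrite primE//; apply/ltW; near: y; exact: lt_nbhsl.
apply: (@near_eq_is_derive R R R _ _ _ _ _ nE).
split => //; rewrite -derive1E GE patchE mem_set//=.
by rewrite in_itv/= !ltW.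
Unshelve. all: by end_near. Qed.

End Primitive.

Lemma is_derive0_le F x c : is_derive x 1 F 0 -> 0 < c -> exists2 d, 0 < d &
  forall y, `|y - x| < d -> `|F y - F x| <= c * `|y - x|.
Proof.
move=> [dF DF] c0.
have : h^-1 *: ((F \o shift x) (h *: (1 : R)) - F x) @[h --> 0^'] --> 'D_1 F x.
  exact: dF.
rewrite DF =>  /cvgrPdist_le /(_ c c0) [d /= d0 Fd]; exists d => // y yx.
have [->|yNx] := eqVneq y x; first by rewrite !subrr normr0 mulr0.
have yx0 : y - x != 0 by rewrite subr_eq0.
have := Fd (y - x); rewrite /ball_/= sub0r normrN => /(_ yx yx0).
rewrite sub0r normrN/= [_ *: (1 : R)]mulr1 subrK normrM normfV.
by rewrite mulrC ler_pdivrMr ?normr_gt0.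
Qed.

(** The points where the derivative is not zero form a null set, which has an open
    neighbourhood [U] of small measure. The interval is cut into pieces contained in
    [U], on which [F] varies little by absolute continuity, and pieces around points
    of zero derivative, on which its increments are at most [c] times the length. *)
Lemma abs_cont_derive0 a b F : a <= b -> abs_cont a b F ->
  {ae leb, forall t, t \in `]a, b[ -> is_derive t 1 F 0} -> F b = F a.
Proof.
move=> ab Fac [N [mN N0 FN]].
apply/eqP; rewrite -subr_eq0 -normr_le0; apply/ler_addgt0Pl => e e0; rewrite addr0.
have [|dl dl0 Fdl] := Fac (e / 2); first by rewrite divr_gt0.
pose N' := N `|` [set a] `|` [set b].
have mN' : measurable (N' : set R) by do 2 apply: measurableU => //.
have leb1 (x : R) : leb [set x] = 0%E by rewrite lebesgue_measure_set1.
have U0 (A B : set R) : measurable A -> measurable B ->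
    leb A = 0%E -> leb B = 0%E -> leb (A `|` B) = 0%E.
  by move=> mA mB A0 B0; rewrite measureU0.
have N'0 : leb (N' : set R) = 0%E.
  by apply: (U0) => //; [apply: measurableU|apply: U0].
have [|U [oU N'U UN']] := @lebesgue_regularity_outer R N' dl mN' _ dl0.
  by change (leb (N' : set R) < +oo)%E; rewrite N'0.
have mU : measurable (U : set R) by exact: open_measurable.
have {}UN' : (leb U < dl%:E)%E.
  apply: le_lt_trans UN'.
  suff : (leb U <= leb (N' : set R) + leb (U `\` N'))%E by rewrite N'0 add0e.
  have mD : measurable (U `\` N' : set R) by exact: measurableD.
  have := measureU2 leb mN' mD.
  by rewrite setDUK.
pose c := e / 2 / (b - a + 1).
have ba1 : 0 < b - a + 1 by rewrite ltr_wpDl ?subr_ge0.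
have c0 : 0 < c by rewrite !divr_gt0.
(* [Q u v] keeps the list of the pieces contained in [U], so that absolute
   continuity is applied only once, to all of them together. *)
pose Q u v := exists n (p q : 'I_n -> R), [/\
  (forall i, [/\ u <= p i, p i <= q i & q i <= v]),
  trivIset setT (fun i => `]p i, q i[%classic),
  (forall i, `]p i, q i[ `<=` U) &
  `|F v - F u| <= \sum_i `|F (q i) - F (p i)| + c * (v - u)].
have : Q a b.
  apply: interval_induction => //.
    move=> x y z ax xy yz zb [m [p [q [pq tpq pqU Fpq]]]] [n [p' [q' [pq' tpq' pqU' Fpq']]]].
    exists (m + n)%N, (fun k : 'I_(m + n) => match fintype.split k with inl i => p i | inr i => p' i end),
      (fun k : 'I_(m + n) => match fintype.split k with inl i => q i | inr i => q' i end); split.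
    - move=> k; case: (fintype.split k) => i.
        by have [? ? ?] := pq i; split => //; apply: le_trans yz.
      by have [? ? ?] := pq' i; split => //; apply: le_trans xy _.
    - move=> k k' _ _.
      have [i ->|i ->] := split_ordP k; have [i' ->|i' ->] := split_ordP k';
        rewrite ?(unsplitK (inl _)) ?(unsplitK (inr _)).
      + by move=> /(tpq _ _ Logic.I Logic.I) ->.
      + move=> [t []] /=; rewrite !in_itv/= => /andP[_ tq] /andP[pt _].
        have [_ _ qy] := pq i; have [yp _ _] := pq' i'.
        by have := lt_le_trans (lt_trans pt tq) qy; rewrite ltNge yp.
      + move=> [t []] /=; rewrite !in_itv/= => /andP[pt _] /andP[_ tq].
        have [_ _ qy] := pq i'; have [yp _ _] := pq' i.
        by have := lt_le_trans (lt_trans pt tq) qy; rewrite ltNge yp.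
      + by move=> /(tpq' _ _ Logic.I Logic.I) ->.
    - by move=> k; case: (fintype.split k).
    - rewrite big_split_ord/=.
      under eq_bigr do rewrite (unsplitK (inl _)).
      under [X in _ <= _ + X + _]eq_bigr do rewrite (unsplitK (inr _)).
      rewrite (_ : F z - F x = (F y - F x) + (F z - F y)); last by ring.
      apply: le_trans (ler_normD _ _) _; apply: le_trans (lerD Fpq Fpq') _.
      by rewrite le_eqVlt; apply/orP; left; apply/eqP; ring.
  move=> x /andP[ax xb].
  have [xN|xN] := pselect (N' x).
    have /nbhs_ballP[d /= d0 dU] : nbhs x U by apply: open_nbhs_nbhs; split => //; exact: N'U.
    exists d => // u v au ux xv vb vud.
    exists 1%N, (fun=> u), (fun=> v); split.
    - by move=> i; split => //; exact: le_trans xv.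
    - by move=> i j _ _ _; rewrite (ord1 i) (ord1 j).
    - move=> _ t /=; rewrite in_itv/= => /andP[ut tv]; apply: dU.
      by rewrite /ball/= ltr_norml; apply/andP; split; lra.
    - by rewrite big_ord1 lerDl mulr_ge0 ?(ltW c0)// subr_ge0 (le_trans ux).
  have xab : x \in `]a, b[.
    rewrite in_itv/= !lt_neqAle ax xb !andbT; apply/andP; split.
      by apply: contra_notN xN => /eqP <-; left; right.
    by apply: contra_notN xN => /eqP ->; right.
  have dFx : is_derive x 1 F 0.
    apply: contrapT => Fx; apply: xN; left; left; apply: FN => /= H.
    by apply: Fx; exact: H.
  have [d d0 Fd] := is_derive0_le dFx c0.
  exists d => // u v au ux xv vb vud.
  exists 0%N, (fun=> 0), (fun=> 0); split; [by case|by move=> []|by case|].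
  rewrite big_ord0 add0r (_ : F v - F u = (F v - F x) - (F u - F x)); last by ring.
  apply: le_trans (ler_normB _ _) _.
  apply: le_trans (lerD (Fd v _) (Fd u _)) _.
  - by rewrite ger0_norm ?subr_ge0//; lra.
  - by rewrite ler0_norm ?subr_le0//; lra.
  - rewrite ger0_norm ?subr_ge0// ler0_norm ?subr_le0//.
    by rewrite le_eqVlt; apply/orP; left; apply/eqP; ring.
move=> [n [p [q [pq tpq pqU Fpq]]]]; apply: le_trans Fpq _.
have h1 : \sum_i `|F (q i) - F (p i)| < e / 2.
  apply: Fdl => //.
  rewrite -lte_fin sum_length_itv//; last by move=> i; have [] := pq i.
  apply: le_lt_trans UN'; apply: le_measure; rewrite ?inE.
  - exact: bigsetU_measurable.
  - exact: mU.
  - apply: (big_ind (fun A => A `<=` U)) => [t []|A B AU BU|i _].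
    + by rewrite subUset.
    + exact: pqU.
have h2 : c * (b - a) <= e / 2.
  rewrite /c -mulrA ger_pMr ?divr_gt0// ler_pdivrMl// mulr1 lerDl//.
by rewrite [leRHS]splitr lerD// ltW.
Qed.

(** The difference of [f] and the primitive of its derivative is absolutely continuous
    with derivative zero almost everywhere. *)
Lemma abs_cont_FTC a b f g : a <= b -> abs_cont a b f ->
  leb.-integrable `[a, b] (EFin \o g) ->
  {ae leb, forall t, t \in `]a, b[ -> is_derive t 1 f (g t)} ->
  forall t, a <= t <= b -> f t - f a = prim a g t.
Proof.
move=> ab fac ig fg t /andP[at_ tb].
pose F s := f s - prim a g s.
have Fac : abs_cont a b F by apply: abs_contB => //; exact: abs_cont_prim.
have F'0 : {ae leb, forall s, s \in `]a, b[ -> is_derive s 1 F 0}.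
  apply: filterS2 fg (prim_ae_derive ig) => [|s fs gs sab].
    exact: (ae_filter_ringOfSetsType leb).
  rewrite -(subrr (g s)); apply: is_deriveB; [exact: fs|exact: gs].
suff : F t = F a by rewrite /F prim0 subr0 => <-; ring.
apply: abs_cont_derive0 => //.
  move=> e e0; have [d d0 Fd] := Fac e e0; exists d => // n u v uv; apply: Fd => i.
  by have [? ? vt] := uv i; split => //; exact: le_trans tb.
apply: filterS F'0 => [|s Fs]; first exact: (ae_filter_ringOfSetsType leb).
rewrite in_itv/= => /andP[as_ st]; apply: Fs.
by rewrite in_itv/= as_ (lt_le_trans st).
Qed.

End AbsolutelyContinuous.

(** * Subsequences and weak-star convergence *)

(** All the sequences have limits along one ultrafilter; an index at which the first
    [m] of them are [1 / m.+1] close to their limits exists for each [m]. *)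
Lemma diagonal_subsequence (R : realType) (I : countType) (u : nat -> I -> R)
    (B : I -> R) : (forall n i, `|u n i| <= B i) ->
  exists phi : nat -> nat, (forall m, (m <= phi m)%N) /\
    forall i, cvgn (fun m => u (phi m) i).
Proof.
move=> uB.
have [U [UU sU]] := @ultraFilterLemma nat \oo _.
have /choice[l ul] : forall i, exists l : R, u n i @[n --> U] --> l.
  by move=> i; apply: (@ultra_bounded_cvg _ _ _ _ (B i)) => n; exact: uB.
have /choice[phi phiP] : forall m : nat, exists n, (m <= n)%N /\
    forall i, (pickle i < m)%N -> `|l i - u n i| < m.+1%:R^-1.
  move=> m.
  suff /filter_ex[n [mn nP]] : U [set n | (m <= n)%N /\
      forall k, (k < m)%N -> forall i, pickle i = k -> `|l i - u n i| < m.+1%:R^-1].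
    by exists n; split => // i im; exact: (nP _ im i).
  apply: (@filterI _ U); first by apply: sU; exact: nbhs_infty_ge.
  have : forall k, U [set n | forall i, pickle i = k -> `|l i - u n i| < m.+1%:R^-1].
    move=> k; have [[i E]|NE] := pselect (exists i : I, pickle i = k); last first.
      by apply: filterE => n i ik; exfalso; apply: NE; exists i.
    have /cvgrPdist_lt /(_ (m.+1%:R^-1)) := ul i.
    rewrite invr_gt0 ltr0n => /(_ isT).
    apply: filterS => n nP i' ik.
    by have -> : i' = i by apply: (pcan_inj (@pickleK I)); rewrite ik E.
  move=> kP; have : forall q, U [set n | forall k, (k < q)%N ->
      forall i, pickle i = k -> `|l i - u n i| < m.+1%:R^-1].
    elim=> [|q IH]; first by apply: filterE => n k; rewrite ltn0.
    apply: filterS2 IH (kP q) => n nq qq k; rewrite ltnS leq_eqVlt => /predU1P[->|kq].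
      exact: qq.
    exact: nq.
  exact.
exists phi; split => [m|i]; first by have [] := phiP m.
apply/cvg_ex; exists (l i); apply/cvgrPdist_lt => e e0; near=> m.
have [_ /(_ i) H] := phiP m; apply: lt_trans (H _) _.
  by near: m; exact: nbhs_infty_gt.
by near: m; exact: near_infty_natSinv_lt (PosNum e0).
Unshelve. all: by end_near. Qed.

Section RealIntegrable.
Context d (T : measurableType d) (R : realType) (mu : {measure set T -> \bar R}).
Variables (D : set T) (mD : measurable D).
Implicit Types f h : T -> R.

Lemma integrable_bounded_mul f h (B : R) :
  measurable_fun D f -> (forall t, D t -> `|f t| <= B) ->
  mu.-integrable D (EFin \o h) ->
  mu.-integrable D (EFin \o (fun t => f t * h t)).
Proof.
move=> mf fB ih.
have bf : [bounded f x | x in D].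
  exists B; split; first exact: num_real.
  by move=> x Bx t Dt; apply: le_trans (fB t Dt) (ltW Bx).
by have := integrableMr mD mf bf ih; apply: eq_integrable.
Qed.

Lemma integrableD_EFin f h :
  mu.-integrable D (EFin \o f) -> mu.-integrable D (EFin \o h) ->
  mu.-integrable D (EFin \o (fun t => f t + h t)).
Proof. by move=> jf jh; have := integrableD mD jf jh; apply: eq_integrable. Qed.

Lemma integrableB_EFin f h :
  mu.-integrable D (EFin \o f) -> mu.-integrable D (EFin \o h) ->
  mu.-integrable D (EFin \o (fun t => f t - h t)).
Proof. by move=> jf jh; have := integrableB mD jf jh; apply: eq_integrable. Qed.

Lemma integrableZl_EFin (k : R) h :
  mu.-integrable D (EFin \o h) ->
  mu.-integrable D (EFin \o (fun t => k * h t)).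
Proof. by move=> jh; have := integrableZl mD k jh; apply: eq_integrable. Qed.

End RealIntegrable.

Section Sequences.
Context {R : realType}.
Notation leb := (@lebesgue_measure R).

Lemma equicontinuous_cvg (f : nat -> R -> R) :
  (forall e, 0 < e -> exists2 d : R, 0 < d &
     forall n u v, `|u - v| < d -> `|f n u - f n v| < e) ->
  (forall q : rat, cvgn (fun n => f n (ratr q))) ->
  forall t, cvgn (fun n => f n t).
Proof.
move=> feq fq t; apply: cauchy_cvg; apply: cauchy_exP => e e0.
have [|d d0 fd] := feq (e / 2); first by rewrite divr_gt0.
have oI : open (`]t - d, t + d[%classic : set R) by exact: interval_open.
have [|y [/= td [q _ qy]]] := @dense_rat R _ _ oI.
  by exists t; rewrite /= in_itv/= ltrBlDr ltrDl d0.
subst y.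
rewrite in_itv/= in td; have {}td : `|ratr q - t| < d.
  by rewrite ltr_norml; case/andP: td => ? ?; apply/andP; split; lra.
exists (limn (fun n => f n (ratr q))).
have /cvgrPdist_lt /(_ (e / 2)) := fq q; rewrite divr_gt0// => /(_ isT).
apply: filterS => n nq /=; rewrite /ball/=.
rewrite (splitr e) -(subrK (f n (ratr q)) (limn _)) -addrA.
by apply: le_lt_trans (ler_normD _ _) _; apply: ltrD => //; exact: fd.
Qed.

Lemma bounded_convergence (D A : set R) (c : nat -> R -> R) (cl : R -> R) (B : R) :
  measurable D -> (leb D < +oo)%E ->
  (forall n, measurable_fun D (c n)) -> (forall n t, D t -> `|c n t| <= B) ->
  (forall t, D t -> c n t @[n --> \oo] --> cl t) ->
  measurable A -> A `<=` D ->
  leb.-integrable A (EFin \o cl) /\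
  \int[leb]_(t in A) c n t @[n --> \oo] --> \int[leb]_(t in A) cl t.
Proof.
move=> mD Dfin mc cB ccl mA AD.
have Afin : (leb A < +oo)%E.
  by apply: le_lt_trans Dfin; apply: le_measure => //; rewrite inE.
have [|||||il _ cv] := @dominated_convergence _ _ R leb A mA
    (fun n => EFin \o c n) (EFin \o cl) (cst B%:E).
- by move=> n; apply/measurable_EFinP; exact: measurable_funS (mc n).
- have mcl : measurable_fun A cl.
    apply: (measurable_fun_cvg (h := c)) => //.
      by move=> n; exact: measurable_funS (mc n).
    by move=> t /AD; exact: ccl.
  exact/measurable_EFinP.
- by apply: aeW => t At; apply: cvg_EFin; [exact: nearW|exact/ccl/AD].
- apply/integrableP; split; first exact: measurable_cst.
  by under eq_integral do rewrite /= ; rewrite integral_cst// lte_mul_pinfty// lee_fin.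
- by apply: aeW => t n At; rewrite /= lee_fin; exact/cB/AD.
split => //; rewrite /Rintegral; apply: fine_cvg; rewrite fineK//.
exact: integrable_fin_num.
Qed.

Lemma within_continuous_bounded (a b : R) (f : R -> R) : a <= b ->
  {within `[a, b], continuous f} ->
  exists2 B : R, 0 <= B & forall t, `[a, b]%classic t -> `|f t| <= B.
Proof.
move=> ab cf; have [c _ fc] := EVT_max ab cf; have [d _ fd] := EVT_min ab cf.
exists (`|f c| + `|f d|) => [|t tab]; first by rewrite addr_ge0.
have {fc}tc := fc t tab; have {fd}td := fd t tab.
have := ler_norm (f c); have := ler_norm (- f d); rewrite normrN.
have := normr_ge0 (f c); have := normr_ge0 (f d).
by move=> ? ? ? ?; rewrite ler_norml; apply/andP; split; lra.
Qed.

(** Convergence of the primitives and a bound in [L^1] imply weak-star convergence. On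
    a short interval around [x] the integral of [f * h n] differs from [f x] times an
    increment of the primitive, which tends to zero, by at most the oscillation of
    [f] times the [L^1] norm; these local estimates add up. *)
Lemma weakstar_cvg0 (a b K : R) (h : nat -> R -> R) (f : R -> R) : a <= b ->
  (forall n, leb.-integrable `[a, b] (EFin \o h n)) ->
  (forall n, \int[leb]_(t in `[a, b]) `|h n t| <= K) ->
  (forall t, a <= t <= b -> prim a (h n) t @[n --> \oo] --> (0 : R)) ->
  {within `[a, b], continuous f} ->
  \int[leb]_(t in `[a, b]) (f t * h n t) @[n --> \oo] --> (0 : R).
Proof.
move=> ab ih hK h0 cf.
have K0 : 0 <= K by apply: le_trans (hK 0%N); exact: Rintegral_ge0.
have ihn n : leb.-integrable `[a, b] (EFin \o (fun t => `|h n t|)).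
  exact: integrable_norm.
have mf : measurable_fun (`[a, b] : set R) f by exact: subspace_continuous_measurable_fun.
have [Bf Bf0 fB] := within_continuous_bounded ab cf.
have ifh n : leb.-integrable `[a, b] (EFin \o (fun t => f t * h n t)).
  by apply: (@integrable_bounded_mul _ _ R leb _ _ f (h n) Bf).
pose P n t := prim a (fun t => f t * h n t) t.
pose A n t := prim a (fun t => `|h n t|) t.
apply/cvgrPdist_lt => e e0.
pose c := e / 2 / (K + 1).
have c0 : 0 < c by rewrite !divr_gt0// ltr_wpDl.
pose Q u v := forall th, 0 < th -> \forall n \near \oo,
  `|P n v - P n u| <= c * (A n v - A n u) + th.
have Qab : Q a b.
  apply: interval_induction => //.
    move=> x y z ax xy yz zb Qxy Qyz th th0.
    have th20 : 0 < th / 2 by rewrite divr_gt0.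
    apply: filterS2 (Qxy _ th20) (Qyz _ th20) => n Hxy Hyz.
    rewrite (_ : P n z - P n x = (P n y - P n x) + (P n z - P n y)); last by ring.
    apply: le_trans (ler_normD _ _) _; apply: le_trans (lerD Hxy Hyz) _.
    by rewrite le_eqVlt; apply/orP; left; apply/eqP; field.
  move=> x axb.
  have xI : `[a, b]%classic x by rewrite /= in_itv.
  have /subspace_continuousP/(_ x xI)/cvgrPdist_lt/(_ c c0) := cf.
  rewrite near_withinE => /nbhs_ballP[d /= d0 fd].
  exists d => // u v au ux xv vb vud th th0.
  have uv : u <= v by exact: le_trans xv.
  have uvab : `]u, v] `<=` `[a, b].
    by apply: subset_itv; rewrite bnd_simp.
  have H0 : `|f x| * `|prim a (h n) v - prim a (h n) u| @[n --> \oo] --> (0 : R).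
    rewrite [X in _ --> X](_ : _ = `|f x| * `|0 - 0 : R|); last by rewrite subrr normr0 mulr0.
    apply: cvgM; first exact: cvg_cst.
    by apply: cvg_norm; apply: cvgB; apply: h0; apply/andP; split => //; apply: (le_trans _ uv) || apply: (le_trans uv).
  move/cvgrPdist_lt : H0 => /(_ th th0); apply: filterS => n.
  rewrite sub0r normrN normrM !normr_id => Hn.
  have ih' : leb.-integrable `]u, v] (EFin \o h n) by exact: integrableS (ih n).
  have ihn' : leb.-integrable `]u, v] (EFin \o (fun t => `|h n t|)) by exact: integrableS (ihn n).
  have ifh' : leb.-integrable `]u, v] (EFin \o (fun t => f t * h n t)) by exact: integrableS (ifh n).
  have ixh : leb.-integrable `]u, v] (EFin \o (fun t => f x * h n t)).
    exact: integrableZl_EFin.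
  have idh : leb.-integrable `]u, v] (EFin \o (fun t => f t * h n t - f x * h n t)).
    exact: integrableB_EFin.
  rewrite /P /A (primB (ifh n))// (primB (ihn n))//.
  have -> : \int[leb]_(t in `]u, v]) (f t * h n t) =
     f x * (prim a (h n) v - prim a (h n) u) +
     \int[leb]_(t in `]u, v]) (f t * h n t - f x * h n t).
    by rewrite (primB (ih n))// RintegralB// RintegralZl//; ring.
  apply: le_trans (ler_normD _ _) _; rewrite addrC; apply: lerD; last first.
    by rewrite normrM ltW.
  apply: le_trans (le_normr_Rintegral _ idh) _ => //.
  rewrite -RintegralZl//; apply: le_Rintegral => //.
  - exact: integrable_norm.
  - exact: integrableZl_EFin.
  - move=> t tuv; rewrite -mulrBl normrM ler_wpM2r// distrC ltW//.
    apply: fd; last exact: uvab.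
    move: tuv; rewrite /= in_itv/= /ball/= => /andP[ut tv].
    by rewrite ltr_norml; apply/andP; split; lra.
have e40 : 0 < e / 4 by rewrite divr_gt0.
apply: filterS (Qab _ e40) => n.
rewrite /P /A !prim0 !subr0 sub0r normrN => /le_lt_trans; apply.
have : c * prim a (fun t => `|h n t|) b <= e / 2.
  apply: (@le_trans _ _ (c * K)); first by rewrite ler_wpM2l ?(ltW c0)//; exact: hK.
  by rewrite /c -mulrA ger_pMr ?divr_gt0// ler_pdivrMl ?ltr_wpDl// mulr1 lerDl.
lra.
Qed.

End Sequences.

(** * Lower semicontinuity of the dissipation of an edge *)

Section Measurability.
Context {R : realType}.

Lemma measurable_sqrt : measurable_fun setT (@Num.sqrt R).
Proof. by apply: continuous_measurable_fun; exact: sqrt_continuous. Qed.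

Lemma measurable_Cfun : measurable_fun setT (@Cfun R).
Proof.
have mq : measurable_fun setT (fun r : R => Num.sqrt (r ^+ 2 + 4)).
  apply: measurableT_comp; first exact: measurable_sqrt.
  by apply: measurable_funD => //; exact: measurable_funX.
apply: measurable_funD => //; apply: measurable_funB; last exact: measurable_funM.
apply: measurable_funM; first exact: measurable_funM.
apply: measurableT_comp; first exact: measurable_ln.
by apply: measurable_funM => //; exact: measurable_funD.
Qed.

Lemma measurable_Cpersp d (T : measurableType d) (D : set T) (j s : T -> R) :
  measurable D -> measurable_fun D j -> measurable_fun D s ->
  measurable_fun D (fun t => Cpersp (j t) (s t)).
Proof.
move=> mD mj ms.
have m1 : measurable_fun setT (fst : R * R -> R) by exact: measurable_fst.
have m2 : measurable_fun setT (snd : R * R -> R) by exact: measurable_snd.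
have mC : measurable_fun setT (fun x : R * R => Cpersp x.1 x.2).
  rewrite (_ : (fun x => _) = fun x : R * R => if 0 < x.2 then
      (x.2 * Cfun (x.1 * x.2 `^ (-1)))%:E else if x.1 == 0 then 0%E else +oo%E).
    apply: measurable_fun_ifT.
    - exact: measurable_fun_ltr.
    - apply/measurable_EFinP; apply: measurable_funM => //.
      apply: measurableT_comp; first exact: measurable_Cfun.
      apply: measurable_funM => //.
      by apply: (measurableT_comp (measurable_powR (-1))).
    - by apply: measurable_fun_ifT => //; exact: measurable_fun_eqr.
  apply/funext => x; rewrite /Cpersp; case: ifPn => // x0.
  by rewrite powR_inv1// ltW.
have mJ : measurable_fun setT (fun t => ((j \_ D) t, (s \_ D) t)).
  by apply: measurable_fun_pair; exact/(measurable_restrictT _ mD).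
apply: (eq_measurable_fun (fun t => Cpersp ((j \_ D) t) ((s \_ D) t))).
  by move=> t tD; rewrite !patchE tD.
by apply: measurable_funTS; exact: (measurableT_comp mC mJ).
Qed.

Lemma measurable_halfcost d (T : measurableType d) (D : set T) (a : R) (j g z : T -> R) :
  measurable D -> measurable_fun D j -> measurable_fun D g -> measurable_fun D z ->
  measurable_fun D (fun t => halfcost a (j t) (g t) (z t)).
Proof.
move=> mD mj mg mz; apply: emeasurable_funD.
  apply: measurable_Cpersp => //; apply: measurable_funM => //.
  exact: measurable_funM.
apply/measurable_EFinP; apply: measurable_funM => //.
by apply: measurable_funX; exact: measurable_funB.
Qed.

Lemma measurable_edgecost d (T : measurableType d) (D : set T) (a b : R) (j g k : T -> R) :
  measurable D -> measurable_fun D j -> measurable_fun D g -> measurable_fun D k ->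
  measurable_fun D (fun t => edgecost a b (j t) (g t) (k t)).
Proof.
move=> mD mj mg mk; apply: emeasurable_funD.
  by apply: measurable_Cpersp => //; apply: measurable_funM => //; exact: measurable_funM.
apply/measurable_EFinP; apply: measurable_funM => //.
by apply: measurable_funX; exact: measurable_funB.
Qed.

Lemma measurable_conc d (T : measurableType d) (D : set T) (a b p q : R) (g k : T -> R) :
  measurable_fun D g -> measurable_fun D k ->
  measurable_fun D (fun t => conc a b p q (g t) (k t)).
Proof.
move=> mg mk; apply: measurable_funB.
  by apply: measurable_funD; apply: measurable_funM => //; exact: measurable_funX.
apply: measurable_funM => //; apply: measurable_funX.
by apply: measurable_funD; do 2 apply: measurable_funM => //.
Qed.

End Measurability.

Section Ereal.
Context {R : realType}.

(** It suffices to test with real numbers, whether [x] is finite or not. *)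
Lemma lee_real_lt (x y : \bar R) :
  (forall c : R, (c%:E < x)%E -> (c%:E <= y)%E) -> (x <= y)%E.
Proof.
move: x y => [x| |] [y| |] h; rewrite ?leey ?leNye//.
- rewrite lee_fin leNgt; apply/negP => yx.
  have := h ((x + y) / 2); rewrite lte_fin lee_fin.
  have : (x + y) / 2 < x by lra.
  by move=> /[swap] /[apply]; lra.
- by have := h (x - 1); rewrite lte_fin ltrBlDr ltrDl ltr01 => /(_ isT).
- by have := h (y + 1); rewrite ltry lee_fin => /(_ isT); rewrite leNgt ltrDl ltr01.
- by have := h 0; rewrite ltry => /(_ isT).
Qed.

End Ereal.

Section EdgeLsc.
Context {R : realType}.
Notation leb := (@lebesgue_measure R).
Variables (D : set R) (mD : measurable D) (Dfin : (leb D < +oo)%E).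
Variables (a b G : R) (a0 : 0 < a) (b0 : 0 < b).
Variables (U : set_system nat) (UU : UltraFilter U) (sU : \oo `<=` U).
Variables (jv jw gv gw z : nat -> R -> R) (jl g k : R -> R).
Hypotheses (ijv : forall n, leb.-integrable D (EFin \o jv n))
  (ijw : forall n, leb.-integrable D (EFin \o jw n))
  (ijl : leb.-integrable D (EFin \o jl)).
Hypotheses
  (jvl : forall A, measurable A -> A `<=` D ->
     \int[leb]_(t in A) jv n t @[n --> U] --> \int[leb]_(t in A) jl t)
  (jwl : forall A, measurable A -> A `<=` D ->
     \int[leb]_(t in A) jw n t @[n --> U] --> \int[leb]_(t in A) (- jl t)).
Hypotheses (mgv : forall n, measurable_fun D (gv n))
  (mgw : forall n, measurable_fun D (gw n)) (mz : forall n, measurable_fun D (z n)).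
Hypotheses (gvG : forall n t, D t -> 0 <= gv n t <= G)
  (gwG : forall n t, D t -> 0 <= gw n t <= G) (z0 : forall n t, D t -> 0 <= z n t).
Hypotheses (gvg : forall t, D t -> gv n t @[n --> \oo] --> g t)
  (gwk : forall t, D t -> gw n t @[n --> \oo] --> k t).

Let cost n t := (halfcost a (jv n t) (gv n t) (z n t) + halfcost b (jw n t) (gw n t) (z n t))%E.
Hypothesis cost_fin : forall n, (\int[leb]_(t in D) cost n t < +oo)%E.

Let cost_ge0 n t : D t -> (0 <= cost n t)%E.
Proof.
move=> Dt; have /andP[? _] := gvG n Dt; have /andP[? _] := gwG n Dt.
by apply: adde_ge0; apply: halfcost_ge0 => //; [exact: ltW|exact: z0|exact: ltW|exact: z0].
Qed.

Let mjv n : measurable_fun D (jv n).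
Proof. by apply/measurable_EFinP; exact: measurable_int (ijv n). Qed.
Let mjw n : measurable_fun D (jw n).
Proof. by apply/measurable_EFinP; exact: measurable_int (ijw n). Qed.
Let mjl : measurable_fun D jl.
Proof. by apply/measurable_EFinP; exact: measurable_int ijl. Qed.

Let mcost n : measurable_fun D (cost n).
Proof. by apply: emeasurable_funD; exact: measurable_halfcost. Qed.

Let icost n : leb.-integrable D (cost n).
Proof.
apply/integrableP; split; first exact: mcost.
have -> : (\int[leb]_(x in D) `|cost n x| = \int[leb]_(x in D) cost n x)%E.
  by apply: eq_integral => t /[!inE] Dt; rewrite gee0_abs// cost_ge0.
exact: cost_fin.
Qed.

Let conc_bound p q : exists B : R, forall x y, 0 <= x <= G -> 0 <= y <= G ->
  `|conc a b p q x y| <= B.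
Proof.
exists (2 * a * G ^+ 2 + 2 * b * G ^+ 2 +
  (a * G * cosh2 p + b * G * cosh2 q) ^+ 2 / (2 * (a + b))).
move=> x y /andP[x0 xG] /andP[y0 yG]; rewrite /conc.
have G0 : 0 <= G by exact: le_trans xG.
have x2 : x ^+ 2 <= G ^+ 2 by rewrite lerXn2r ?nnegrE.
have y2 : y ^+ 2 <= G ^+ 2 by rewrite lerXn2r ?nnegrE.
have p0 := ltW (cosh2_gt0 p); have q0 := ltW (cosh2_gt0 q).
apply: le_trans (ler_normB _ _) _; apply: lerD.
  rewrite ger0_norm; last by nonneg.
  by apply: lerD; rewrite ler_wpM2l// mulr_ge0// ltW.
rewrite ger0_norm; last by rewrite mulr_ge0 ?sqr_ge0// invr_ge0; nonneg.
rewrite ler_wpM2r//; first by rewrite invr_ge0; nonneg.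
rewrite lerXn2r ?nnegrE; [|by nonneg|by nonneg|].
  by [].
by apply: lerD; rewrite ler_wpM2r// ler_wpM2l// ltW.
Qed.

Let mg : measurable_fun D g.
Proof. by apply: (measurable_fun_cvg (h := gv)). Qed.
Let mk : measurable_fun D k.
Proof. by apply: (measurable_fun_cvg (h := gw)). Qed.

Let conc_cvg p q t : D t ->
  conc a b p q (gv n t) (gw n t) @[n --> \oo] --> conc a b p q (g t) (k t).
Proof.
move=> Dt; have X2 (u : nat -> R) (l : R) : u n @[n --> \oo] --> l ->
    u n ^+ 2 @[n --> \oo] --> l ^+ 2 by move=> ul; exact: (cvgM ul ul).
apply: cvgB.
  apply: cvgD; apply: cvgM; [exact: cvg_cst|by apply: X2; exact: gvg|
    exact: cvg_cst|by apply: X2; exact: gwk].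
apply: cvgM; last exact: cvg_cst.
apply: X2; apply: cvgD; apply: cvgM; [|exact: cvg_cst| |exact: cvg_cst].
- by apply: cvgM; [exact: cvg_cst|exact: gvg].
- by apply: cvgM; [exact: cvg_cst|exact: gwk].
Qed.

Let ell p q t := tilt a b p q (jl t) (- jl t) (g t) (k t).

(** An asymptotic lower bound of the cost is required on every measurable set, because
    this makes it stable under maxima: a set is cut into the parts where the first,
    respectively the second, function is the larger one. *)
Let asymp_le (f : R -> R) := leb.-integrable D (EFin \o f) /\
  forall A, measurable A -> A `<=` D -> forall e, 0 < e ->
    U [set n | ((\int[leb]_(t in A) f t - e)%:E <= \int[leb]_(t in A) cost n t)%E].

(** The bound [tilt] is linear in the fluxes, which converge weakly, and continuous in
    the node densities, which converge pointwise and are bounded. *)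
Let asymp_tilt p q : asymp_le (ell p q).
Proof.
have [B cB] := conc_bound p q.
pose cn n t := conc a b p q (gv n t) (gw n t).
pose cl t := conc a b p q (g t) (k t).
have mcn n : measurable_fun D (cn n) by exact: measurable_conc.
have cnB n t : D t -> `|cn n t| <= B by move=> Dt; apply: cB; [exact: gvG|exact: gwG].
have ccv A (mA : measurable A) (AD : A `<=` D) :=
  bounded_convergence mD Dfin mcn cnB (@conc_cvg p q) mA AD.
have lin A (mA : measurable A) (u v c : R -> R) : leb.-integrable A (EFin \o u) ->
    leb.-integrable A (EFin \o v) -> leb.-integrable A (EFin \o c) ->
    leb.-integrable A (EFin \o (fun t => 2 * u t * p + 2 * v t * q + c t)) /\
    \int[leb]_(t in A) (2 * u t * p + 2 * v t * q + c t) =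
    2 * p * \int[leb]_(t in A) u t + 2 * q * \int[leb]_(t in A) v t + \int[leb]_(t in A) c t.
  move=> iu iv ic.
  have -> : (fun t => 2 * u t * p + 2 * v t * q + c t) =
      (fun t => 2 * p * u t + 2 * q * v t + c t) by apply/funext => t; ring.
  have iu' : leb.-integrable A (EFin \o (fun t => 2 * p * u t)) by exact: integrableZl_EFin.
  have iv' : leb.-integrable A (EFin \o (fun t => 2 * q * v t)) by exact: integrableZl_EFin.
  have iuv : leb.-integrable A (EFin \o (fun t => 2 * p * u t + 2 * q * v t)).
    exact: integrableD_EFin.
  split; first exact: integrableD_EFin.
  by rewrite RintegralD// RintegralD// !RintegralZl.
have icn n A (mA : measurable A) (AD : A `<=` D) : leb.-integrable A (EFin \o cn n).
  apply: measurable_bounded_integrable => //.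
  - by apply: le_lt_trans Dfin; apply: le_measure => //; rewrite inE.
  - exact: measurable_funS (mcn n).
  - exists B; split; first exact: num_real.
    by move=> x Bx t At; apply: le_trans (cnB n t (AD t At)) (ltW Bx).
have iS A (mA : measurable A) (AD : A `<=` D) (u : R -> R) :
    leb.-integrable D (EFin \o u) -> leb.-integrable A (EFin \o u).
  by move=> iu; exact: integrableS iu.
have ijlN : leb.-integrable D (EFin \o (fun t => - jl t)).
  by have := integrableN ijl; apply: eq_integrable.
split.
  by have [] := lin D mD _ _ cl ijl ijlN (ccv D mD (@subset_refl _ D)).1.
move=> A mA AD e e0.
have [_ lE] := lin A mA _ _ cl (iS _ mA AD _ ijl) (iS _ mA AD _ ijlN) (ccv A mA AD).1.
have : \int[leb]_(t in A) tilt a b p q (jv n t) (jw n t) (gv n t) (gw n t) @[n --> U]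
    --> \int[leb]_(t in A) ell p q t.
  rewrite [X in _ --> X]lE.
  rewrite (_ : (fun n => _) = (fun n => 2 * p * \int[leb]_(t in A) jv n t +
      2 * q * \int[leb]_(t in A) jw n t + \int[leb]_(t in A) cn n t)); last first.
    apply/funext => n.
    by have [_ <-] := lin A mA _ _ (cn n) (iS _ mA AD _ (ijv n)) (iS _ mA AD _ (ijw n)) (icn n A mA AD).
  apply: cvgD; last by apply: cvg_trans (ccv A mA AD).2; exact: cvg_app.
  apply: cvgD; apply: cvgM; [exact: cvg_cst|exact: jvl|exact: cvg_cst|exact: jwl].
move=> /cvgrPdist_lt /(_ e e0); apply: filterS => n.
move=> /(le_lt_trans (ler_norm _)) lt_e.
have [itn _] := lin A mA _ _ (cn n) (iS _ mA AD _ (ijv n)) (iS _ mA AD _ (ijw n)) (icn n A mA AD).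
apply: (@le_trans _ _ (\int[leb]_(t in A) tilt a b p q (jv n t) (jw n t) (gv n t) (gw n t))%:E).
  by rewrite lee_fin lerBlDr -lerBlDl ltW.
rewrite /Rintegral fineK; last exact: integrable_fin_num.
apply: le_integral => //; first exact: integrableS (icost n).
move=> t /[!inE] /AD Dt; have /andP[? _] := gvG n Dt; have /andP[? _] := gwG n Dt.
by apply: tilt_le => //; exact: z0.
Qed.

Let asymp_max f h : asymp_le f -> asymp_le h -> asymp_le (fun t => Num.max (f t) (h t)).
Proof.
move=> [jf fU] [jh hU].
have mf : measurable_fun D f by apply/measurable_EFinP; exact: measurable_int jf.
have mh : measurable_fun D h by apply/measurable_EFinP; exact: measurable_int jh.
have imax : leb.-integrable D (EFin \o (fun t => Num.max (f t) (h t))).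
  apply: (@le_integrable _ _ _ leb D mD _ (EFin \o (fun t => `|f t| + `|h t|))).
  - by apply/measurable_EFinP; exact: measurable_maxr.
  - move=> t _ /=; rewrite lee_fin [leRHS]ger0_norm ?addr_ge0//.
    by rewrite /Num.max; case: ifP => _; rewrite ?lerDl ?lerDr.
  - by apply: integrableD_EFin => //; exact: integrable_norm.
split => // A mA AD e e0.
have mlt : measurable (D `&` [set t | f t < h t]).
  have := measurable_fun_ltr mf mh mD (Y := [set true]) I.
  by rewrite preimage_true.
pose A1 := A `&` (D `&` [set t | f t < h t]).
pose A2 := A `\` (D `&` [set t | f t < h t]).
have mA1 : measurable (A1 : set R) by exact: measurableI.
have mA2 : measurable (A2 : set R) by exact: measurableD.
have A1D : A1 `<=` D by move=> t [/AD].
have A2D : A2 `<=` D by move=> t [/AD].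
have A12 : A = A1 `|` A2 by rewrite /A1 /A2 setUIDK.
have dA : [disjoint A1 & A2] by apply/disj_set2P; rewrite /A1 /A2 setDE setIACA setICr setI0.
have e20 : 0 < e / 2 by rewrite divr_gt0.
apply: filterS2 (hU A1 mA1 A1D _ e20) (fU A2 mA2 A2D _ e20) => n /= h1 h2.
have imA : leb.-integrable (A1 `|` A2) (EFin \o (fun t => Num.max (f t) (h t))).
  by rewrite -A12; exact: integrableS imax.
rewrite A12 Rintegral_setU// ge0_integral_setU//; last 2 first.
- by rewrite -A12; exact: measurable_funS (mcost n).
- by move=> t; rewrite -A12 => /AD; exact: cost_ge0.
have -> : \int[leb]_(t in A1) Num.max (f t) (h t) = \int[leb]_(t in A1) h t.
  by apply: eq_Rintegral => t /[!inE] -[_ [_ /= fh]]; rewrite max_r// ltW.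
have -> : \int[leb]_(t in A2) Num.max (f t) (h t) = \int[leb]_(t in A2) f t.
  apply: eq_Rintegral => t /[!inE] -[At ft]; rewrite max_l// leNgt.
  by apply/negP => fh; apply: ft; split => //; exact: AD.
apply: le_trans (leeD h1 h2).
by rewrite -EFinD lee_fin le_eqVlt; apply/orP; left; apply/eqP; field.
Qed.

Let P (i : nat) : rat * rat := odflt (0, 0) (unpickle i).

(** The maximum of the first [N] rational dual bounds; it starts with the slopes zero,
    for which the bound is nonnegative. *)
Let Mx := fix Mx (N : nat) (t : R) : R := if N is N'.+1 then
  Num.max (Mx N' t) (ell (ratr (P N').1) (ratr (P N').2) t) else ell 0 0 t.

Let MxS N t :
  Mx N.+1 t = Num.max (Mx N t) (ell (ratr (P N).1) (ratr (P N).2) t).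
Proof. by []. Qed.

Let asymp_Mx N : asymp_le (Mx N).
Proof. by elim: N => [|N IH]; [exact: asymp_tilt|apply: asymp_max => //; exact: asymp_tilt]. Qed.

Let ab_ge0 : 0 <= a * b / (a + b).
Proof. by apply: divr_ge0; nonneg. Qed.

Let Mx_ge0 N t : 0 <= Mx N t.
Proof.
elim: N => [|N IH]; last by rewrite /= le_max IH.
rewrite /= /ell /tilt /conc /cosh2 oppr0 expR0.
rewrite [leRHS](_ : _ = 2 * (a * b / (a + b)) * (g t - k t) ^+ 2).
  by rewrite mulr_ge0 ?sqr_ge0// mulr_ge0.
by field; rewrite gt_eqF// addr_gt0.
Qed.

Let Mx_nd t : {homo Mx^~ t : n m / (n <= m)%N >-> n <= m}.
Proof. apply: homo_leq => [x|y x w|N]; [exact: lexx|exact: le_trans|].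
by rewrite MxS le_max lexx. Qed.

(** Lower semicontinuity of the dissipation of one edge: the limiting integrand is the
    supremum of countably many dual bounds, the finite maxima of which are asymptotic
    lower bounds, and monotone convergence gives the supremum. *)
Lemma edge_liminf (c : R) :
  (c%:E < \int[leb]_(t in D) edgecost a b (jl t) (g t) (k t))%E ->
  U [set n | (c%:E <= \int[leb]_(t in D) cost n t)%E].
Proof.
move=> cI.
have mMx N : measurable_fun D (EFin \o Mx N) by exact: measurable_int (asymp_Mx N).1.
have ndE t : {homo (fun N => (Mx N t)%:E) : n m / (n <= m)%N >-> (n <= m)%E}.
  by move=> n m nm; rewrite lee_fin; exact: Mx_nd.
have cvE t : cvgn (fun N => (Mx N t)%:E).
  exact: ereal_nondecreasing_is_cvgn (ndE t).
have key : (\int[leb]_(t in D) edgecost a b (jl t) (g t) (k t) <=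
    \int[leb]_(t in D) limn (fun N => (Mx N t)%:E))%E.
  have g0 t : D t -> 0 <= g t.
    move=> Dt; rewrite -(cvg_lim _ (gvg Dt))//; apply: limr_ge; first by apply/cvg_ex; exists (g t); exact: gvg.
    by apply: nearW => n; have /andP[] := gvG n Dt.
  have k0 t : D t -> 0 <= k t.
    move=> Dt; rewrite -(cvg_lim _ (gwk Dt))//; apply: limr_ge; first by apply/cvg_ex; exists (k t); exact: gwk.
    by apply: nearW => n; have /andP[] := gwG n Dt.
  apply: ge0_le_integral => //.
  - move=> t Dt; apply: adde_ge0.
      by apply: Cpersp_ge0; rewrite mulr_ge0// mulr_ge0 ?g0 ?k0.
    by rewrite lee_fin mulr_ge0 ?sqr_ge0// mulr_ge0.
  - exact: measurable_edgecost.
  - by apply: (emeasurable_fun_cvg (fun N => EFin \o Mx N)) => // t _; exact: cvE.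
  - move=> t Dt; apply: lee_real_lt => r rE.
    have [p [q rt]] := tilt_opt_rat a0 b0 (g0 t Dt) (k0 t Dt) rE.
    have [i PE] : exists i, P i = (p, q) by exists (pickle (p, q)); rewrite /P pickleK.
    apply: lime_ge => //; exists i.+1 => [//|N iN].
    rewrite lee_fin; apply: le_trans (Mx_nd t iN).
    by rewrite MxS PE le_max (ltW rt) orbT.
have cvM := @cvg_monotone_convergence _ _ R leb D mD (fun N => EFin \o Mx N) mMx
  (fun N t _ => Mx_ge0 N t) (fun t _ => ndE t).
have [N cN] : exists N, (c%:E < \int[leb]_(t in D) (Mx N t)%:E)%E.
  apply: contrapT => /forallNP h.
  have : (\int[leb]_(t in D) limn (fun N => (Mx N t)%:E) <= c%:E)%E.
    rewrite -(cvg_lim _ cvM)//; apply: lime_le; first by apply/cvg_ex; eexists; exact: cvM.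
    by apply: nearW => N /=; rewrite leNgt; apply/negP; exact: h.
  by move=> /(le_trans key) /(lt_le_trans cI); rewrite ltxx.
have [iN NU] := asymp_Mx N.
have IN : (\int[leb]_(t in D) (Mx N t)%:E = (\int[leb]_(t in D) Mx N t)%:E)%E.
  by rewrite /Rintegral fineK//; exact: integrable_fin_num.
rewrite IN lte_fin -subr_gt0 in cN.
apply: filterS (NU D mD (@subset_refl _ D) _ cN) => n /=.
by rewrite opprB addrC subrK.
Qed.

End EdgeLsc.

(** * Equi-integrability of fluxes of bounded cost *)

Section EquiintegrableFamilies.
Context {R : realType}.
Notation leb := (@lebesgue_measure R).

Lemma leb_itv_lty (a b : R) : (leb `[a, b] < +oo)%E.
Proof. by rewrite lebesgue_measure_itv/=; case: ifP => // _; rewrite -EFinB ltry. Qed.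

Lemma EFin_Rintegral d (T : measurableType d) (mu : {measure set T -> \bar R})
    (D : set T) (f : T -> R) : measurable D -> mu.-integrable D (EFin \o f) ->
  (\int[mu]_(x in D) f x)%:E = (\int[mu]_(x in D) (f x)%:E)%E.
Proof. by move=> mD jf; rewrite /Rintegral fineK//; exact: integrable_fin_num. Qed.

Section Domain.
Variables (D : set R) (mD : measurable D) (Dfin : (leb D < +oo)%E).

(** A family of fluxes of bounded cost is equi-integrable, by the superlinearity of the
    cost; the bound of the densities [g] makes the constants uniform. *)
Lemma equiintegrable_halfcost (I : Type) (a G K : R) (j g z : I -> R -> R) :
  0 < a ->
  (forall i, measurable_fun D (j i)) -> (forall i, measurable_fun D (g i)) ->
  (forall i, measurable_fun D (z i)) ->
  (forall i t, D t -> 0 <= g i t <= G) -> (forall i t, D t -> 0 <= z i t) ->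
  (forall i, (\int[leb]_(t in D) halfcost a (j i t) (g i t) (z i t) <= K%:E)%E) ->
  equiintegrable leb D j.
Proof.
move=> a0 mj mg mz gG z0 hK.
pose h i t := halfcost a (j i t) (g i t) (z i t).
have h0 i t : D t -> (0 <= h i t)%E.
  move=> Dt; apply: halfcost_ge0; [exact: ltW|by have /andP[] := gG i t Dt|exact: z0].
have mh i : measurable_fun D (h i) by exact: measurable_halfcost.
have key e : 0 < e -> exists2 C : R, 0 <= C & forall i A, measurable A -> A `<=` D ->
    (\int[leb]_(t in A) `|(j i t)%:E| <= (e + C * fine (leb A))%:E)%E.
  move=> e0; have K1 : 0 < `|K| + 1 by rewrite ltr_wpDl.
  have e'0 : 0 < e / (`|K| + 1) by rewrite divr_gt0.
  have [C C0 Cj] := @halfcost_superlinear R a `|G| _ a0 (normr_ge0 G) e'0.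
  exists C => // i A mA AD.
  have Afin : leb A \is a fin_num.
    rewrite ge0_fin_numE//; apply: le_lt_trans Dfin; apply: le_measure => //; rewrite inE//.
  have mhA : measurable_fun A (h i) by exact: measurable_funS (mh i).
  apply: (@le_trans _ _ (\int[leb]_(t in A) ((e / (`|K| + 1))%:E * h i t + C%:E))%E).
    apply: ge0_le_integral => //.
    - apply: measurableT_comp => //; apply/measurable_EFinP; exact: measurable_funS (mj i).
    - by apply: emeasurable_funD => //; exact: emeasurable_funM.
    - move=> t /AD Dt; apply: Cj; last exact: z0.
      by have /andP[-> gG'] := gG i t Dt; rewrite (le_trans gG')// ler_norm.
  rewrite ge0_integralD//; last 2 first.
  - by move=> t /AD Dt; apply: mule_ge0; [rewrite lee_fin ltW|exact: h0].
  - by apply: emeasurable_funM => //; exact: measurable_cst.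
  rewrite ge0_integralZl//; last 2 first.
  - by move=> t /AD; exact: h0.
  - by rewrite lee_fin ltW.
  rewrite integral_cst// (_ : (e + C * fine (leb A))%:E = (e%:E + C%:E * leb A)%E); last first.
    by rewrite EFinD EFinM fineK.
  apply: leeD2r.
  apply: (@le_trans _ _ ((e / (`|K| + 1))%:E * `|K|%:E)%E).
    apply: lee_wpmul2l; first by rewrite lee_fin ltW.
    apply: (@le_trans _ _ (\int[leb]_(t in D) h i t)%E).
      by apply: ge0_subset_integral => //; do ?[exact: mh | by move=> t Dt; exact: h0].
    by apply: le_trans (hK i) _; rewrite lee_fin ler_norm.
  rewrite -EFinM lee_fin -mulrA ger_pMr// ler_pdivrMl// mulr1 lerDl//.
have ij i : leb.-integrable D (EFin \o j i).
  have mEj : measurable_fun D (EFin \o j i) by apply/measurable_EFinP; exact: mj.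
  apply/integrableP; split; first exact: mEj.
  have [C C0 jC] := key 1 ltr01.
  exact: le_lt_trans (jC i D mD (@subset_refl _ D)) (ltry _).
split=> // e e0; have [C C0 jC] := key e e0; exists C => // i A mA AD.
have iA : leb.-integrable A (EFin \o (fun t => `|j i t|)).
  by apply: integrable_norm; exact: integrableS (ij i).
rewrite -lee_fin /Rintegral fineK; last exact: integrable_fin_num.
exact: jC.
Qed.

Lemma equiintegrableD (I : Type) (f h : I -> R -> R) :
  equiintegrable leb D f -> equiintegrable leb D h ->
  equiintegrable leb D (fun i t => f i t + h i t).
Proof.
move=> [jf fC] [jh hC]; split=> [i|e e0]; first exact: integrableD_EFin.
have e20 : 0 < e / 2 by rewrite divr_gt0.
have [C C0 fe] := fC _ e20; have [C' C'0 he] := hC _ e20.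
exists (C + C'); first exact: addr_ge0.
move=> i A mA AD.
have jfA : leb.-integrable A (EFin \o f i) by exact: integrableS (jf i).
have jhA : leb.-integrable A (EFin \o h i) by exact: integrableS (jh i).
apply: (@le_trans _ _ (\int[leb]_(t in A) (`|f i t| + `|h i t|))).
  apply: le_Rintegral => //.
  - by apply: integrable_norm; exact: integrableD_EFin.
  - by apply: integrableD_EFin => //; exact: integrable_norm.
  - by move=> t _; exact: ler_normD.
rewrite RintegralD//; [|exact: integrable_norm|exact: integrable_norm].
have := fe i A mA AD; have := he i A mA AD; lra.
Qed.

Lemma equiintegrable0 (I : Type) : equiintegrable leb D (fun (_ : I) (_ : R) => 0 : R).
Proof.
split=> [i|e e0]; first exact: integrable0.
exists 0 => // i A mA AD; rewrite mul0r addr0.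
under eq_Rintegral do rewrite normr0.
by rewrite Rintegral_cst// mul0r ltW.
Qed.

Lemma equiintegrable_sum (I : Type) (J : finType) (P : pred J) (f : J -> I -> R -> R) :
  (forall k, P k -> equiintegrable leb D (f k)) ->
  equiintegrable leb D (fun i t => \sum_(k | P k) f k i t).
Proof.
move=> fe.
have -> : (fun i t => \sum_(k | P k) f k i t) = \sum_(k | P k) f k.
  by apply/funext => i; apply/funext => t; rewrite !fct_sumE.
apply: (big_ind (fun F => equiintegrable leb D F)) => //.
- exact: equiintegrable0.
- by move=> x y; exact: equiintegrableD.
Qed.

End Domain.

Lemma equiintegrable_prim (T : R) (I : Type) (f : I -> R -> R) : 0 <= T ->
  equiintegrable leb `[0, T]%classic f -> forall e, 0 < e -> exists2 d : R, 0 < d &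
    forall i u v, 0 <= u <= T -> 0 <= v <= T -> `|u - v| < d ->
      `|prim 0 (f i) u - prim 0 (f i) v| < e.
Proof.
move=> T0 [jf fC] e e0.
have [C C0 fe] := fC (e / 2) (divr_gt0 e0 (ltr0n _ 2)).
have C1 : 0 < C + 1 by rewrite ltr_wpDl.
exists (e / 2 / (C + 1)); first by rewrite !divr_gt0.
suff key i u v : 0 <= u -> u <= v -> v <= T -> v - u < e / 2 / (C + 1) ->
    `|prim 0 (f i) v - prim 0 (f i) u| < e.
  move=> i u v /andP[u0 uT] /andP[v0 vT] uv.
  have [uv'|/ltW vu] := leP u v.
    by rewrite distrC; apply: key => //; rewrite distrC ger0_norm ?subr_ge0// in uv.
  by apply: key => //; rewrite ger0_norm ?subr_ge0// in uv.
move=> u0 uv vT uvd.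
have sub : `]u, v] `<=` `[0, T] by apply: subset_itv; rewrite bnd_simp.
rewrite (primB (jf i))//.
have juv : leb.-integrable `]u, v] (EFin \o f i) by exact: integrableS (jf i).
apply: le_lt_trans (le_normr_Rintegral _ juv) _ => //.
apply: le_lt_trans (fe i _ _ sub) _ => //.
have -> : fine (leb `]u, v]) = v - u.
  rewrite lebesgue_measure_itv/= lte_fin; move: uv; rewrite le_eqVlt.
  by move=> /predU1P[->|->//]; rewrite ltxx subrr.
rewrite [ltRHS]splitr ltrD2l; rewrite ltr_pdivlMr// mulrC in uvd.
by apply: le_lt_trans uvd; rewrite ler_wpM2r ?subr_ge0// lerDl.
Qed.

(** A value bounded away from zero persists, by equicontinuity, on a time interval of
    fixed length and contributes to the integral. *)
Lemma equicontinuous_integral_cvg0 (T : R) (r : nat -> R -> R) : 0 < T ->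
  (forall n, leb.-integrable `[0, T] (EFin \o r n)) ->
  (forall n t, 0 <= t <= T -> 0 <= r n t) ->
  (forall e, 0 < e -> exists2 d : R, 0 < d &
    forall n u v, 0 <= u <= T -> 0 <= v <= T -> `|u - v| < d -> `|r n u - r n v| < e) ->
  \int[leb]_(t in `[0, T]) r n t @[n --> \oo] --> (0 : R) ->
  forall t, 0 <= t <= T -> r n t @[n --> \oo] --> (0 : R).
Proof.
move=> T0 ir r0 req rI t t0T; apply/cvgrPdist_lt => e e0.
have [d d0 rd] := req (e / 2) (divr_gt0 e0 (ltr0n _ 2)).
pose l := Num.min (d / 2) (T / 2).
have l0 : 0 < l by rewrite lt_min !divr_gt0.
have ld : l < d by rewrite gt_min ltr_pdivrMr// mulr_natr mulr2n ltrDl d0.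
have lT : l <= T / 2 by rewrite ge_min lexx orbT.
have [s [s0 sT st]] : exists s, [/\ 0 <= s, s + l <= T &
    forall x, s <= x <= s + l -> `|t - x| < d].
  have [tT|tT] := leP t (T / 2).
    exists t; split; [by case/andP: t0T|lra|move=> x /andP[? ?]].
    by rewrite ler0_norm ?subr_le0//; lra.
  exists (t - l); split; [lra|case/andP: t0T => ? ?; lra|move=> x /andP[? ?]].
  by rewrite ger0_norm ?subr_ge0//; lra.
have el : 0 < l * (e / 2) by rewrite mulr_gt0// divr_gt0.
move/cvgrPdist_lt : rI => /(_ _ el); apply: filterS => n.
rewrite !sub0r !normrN => /(le_lt_trans (ler_norm _)) rn.
rewrite ger0_norm ?r0//.
have sub : `[s, s + l] `<=` `[0, T] by apply: subset_itv; rewrite bnd_simp.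
have isl : leb.-integrable `[s, s + l] (EFin \o r n) by exact: integrableS (ir n).
have : \int[leb]_(x in `[s, s + l]) (r n t - e / 2) <= \int[leb]_(x in `[s, s + l]) r n x.
  apply: le_Rintegral => //.
    apply: measurable_bounded_integrable => //.
    - exact: leb_itv_lty.
    - exists `|r n t - e / 2|; split; first exact: num_real.
      by move=> x Bx y _ /=; exact: ltW.
  move=> x; rewrite /= in_itv/= => sx.
  have := rd n t x t0T; have xT : 0 <= x <= T by case/andP: sx => ? ?; apply/andP; split; lra.
  by move=> /(_ xT (st x sx)) /(le_lt_trans (ler_norm _)); lra.
rewrite Rintegral_cst// (_ : fine (leb _) = l); last first.
  by rewrite lebesgue_measure_itv/= lte_fin ltrDl l0/= addrC addKr.
move=> h1.
have h2 : \int[leb]_(x in `[s, s + l]) r n x <= \int[leb]_(x in `[0, T]) r n x.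
  rewrite -lee_fin (EFin_Rintegral _ isl)// (EFin_Rintegral _ (ir n))//.
  apply: ge0_subset_integral => //.
    by have := ir n => /measurable_int.
  by move=> x; rewrite /= in_itv/= => x0T; rewrite lee_fin r0.
have : (r n t - e / 2) * l < l * (e / 2) by exact: le_lt_trans (le_trans h1 h2) rn.
by rewrite mulrC ltr_pM2l// ltrBlDr -splitr.
Qed.

End EquiintegrableFamilies.

(** * Lower limits and the entropy of point masses *)

Section LiminfEntropy.
Context {R : realType}.

Lemma cvg_sumr (I : Type) (F : set_system I) (FF : Filter F) (J : Type) (s : seq J)
    (P : pred J) (f : I -> J -> R) (l : J -> R) :
  (forall k, P k -> f i k @[i --> F] --> l k) ->
  \sum_(k <- s | P k) f i k @[i --> F] --> \sum_(k <- s | P k) l k.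
Proof.
move=> fl; elim: s => [|k s IH].
  by rewrite big_nil; under eq_fun do rewrite big_nil; exact: cvg_cst.
rewrite big_cons; under eq_fun do rewrite big_cons.
by case: ifPn => // Pk; apply: cvgD => //; exact: fl.
Qed.

Lemma le_limn_einf (x : \bar R) (u : nat -> \bar R) :
  (forall c : R, (c%:E < x)%E -> \forall n \near \oo, (c%:E <= u n)%E) ->
  (x <= limn_einf u)%E.
Proof.
move=> H; apply: lee_real_lt => c cx; have [N _ Nu] := H c cx.
rewrite limn_einf_lim; apply: lime_ge; first exact: is_cvg_einfs.
exists N => // n /= Nn; apply: le_ereal_inf_tmp => _ [k /= nk <-].
by apply: Nu => /=; exact: leq_trans nk.
Qed.

Lemma limn_einf_gt (c : R) (u : nat -> \bar R) :
  (c%:E < limn_einf u)%E -> \forall n \near \oo, (c%:E <= u n)%E.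
Proof.
rewrite limn_einf_lim => cu.
have [N cN] : exists N, (c%:E < einfs u N)%E.
  apply: contrapT => /forallNP h; move: cu; apply/negP; rewrite -leNgt.
  apply: lime_le; first exact: is_cvg_einfs.
  by apply: nearW => n; rewrite leNgt; apply/negP; exact: h.
exists N => // n /= Nn; apply: (le_trans (ltW cN)).
by apply: ereal_inf_lbound; exists n.
Qed.

(** A sum of nonnegative extended reals is bounded as soon as the sums of real numbers
    below the terms are; a term equal to [+oo] is excluded by giving it an arbitrarily
    large real number. *)
Lemma sum_real_lt (I : finType) (x : I -> \bar R) (d : R) :
  (forall i, 0 <= x i)%E ->
  (forall c : I -> R, (forall i, (c i)%:E < x i)%E -> \sum_i c i <= d) ->
  (\sum_i x i <= d%:E)%E.
Proof.
move=> x0 H.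
have x1 i : ((-1)%:E < x i)%E by apply: lt_le_trans (x0 i); rewrite lte_fin ltrN10.
have xfin i : x i \is a fin_num.
  rewrite ge0_fin_numE// ltNge leye_eq; apply/negP => /eqP xi.
  have := H (fun k => if k == i then `|d| + 1 + \sum_(k : I) 1 else -1).
  have h k : ((if k == i then `|d| + 1 + \sum_(k : I) 1 else -1)%:E < x k)%E.
    by case: eqP => [->|_]; [rewrite xi ltry|exact: x1].
  move=> /(_ h).
  rewrite (bigD1 i)//= eqxx.
  have : - \sum_(k : I) (1 : R) <= \sum_(k | k != i) (if k == i then `|d| + 1 + \sum_(k : I) 1 else -1).
    rewrite [leRHS](eq_bigr (fun=> -1 : R)); last by move=> k /negPf ki; rewrite ki.
    rewrite sumrN lerN2 [leRHS](bigD1 i)//= lerDr//.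
  have := ler_norm d; lra.
rewrite -(eq_bigr _ (fun i _ => fineK (xfin i))) sumEFin lee_fin.
apply/ler_addgt0Pr => e e0.
pose n := \sum_(i : I) (1 : R).
have n0 : 0 <= n by exact: sumr_ge0.
have := H (fun i => fine (x i) - e / (n + 1)).
have h i : ((fine (x i) - e / (n + 1))%:E < x i)%E.
  by rewrite -[ltRHS]fineK// lte_fin ltrBlDr ltrDl divr_gt0// ltr_wpDl.
move=> /(_ h); rewrite sumrB.
have : \sum_(i : I) (e / (n + 1)) <= e.
  rewrite (eq_bigr (fun=> 1 * (e / (n + 1)))); last by move=> i _; rewrite mul1r.
  by rewrite -mulr_suml -/n mulrA ler_pdivrMr ?ltr_wpDl// mulrC ler_wpM2l ?(ltW e0)// lerDl.
lra.
Qed.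

Lemma eta_ge (r p : R) : 0 <= r -> r * p - expR p + 1 <= Defs.eta r.
Proof.
rewrite le_eqVlt => /predU1P[<-|r0]; rewrite /Defs.eta.
  by rewrite !mul0r subr0 !sub0r add0r addrC gerDl oppr_le0 ltW ?expR_gt0.
rewrite lerD2r -subr_ge0.
have : r * (1 + (p - ln r)) <= expR p.
  by rewrite -[in leRHS](subrKC (ln r) p) expRD lnK ?posrE// ler_pM2l// expR_ge1Dx.
lra.
Qed.

Lemma eta_ge0 (r : R) : 0 <= Defs.eta r.
Proof.
have [r0|r0] := leP 0 r.
  by have := eta_ge 0 r0; rewrite mulr0 expR0 sub0r addNr.
by rewrite /Defs.eta ln0 ?(ltW r0)// mulr0 sub0r addr_ge0// oppr_ge0 ltW.
Qed.

(** The affine functions of [eta_ge] exhaust [eta], also at [r = 0] where the optimal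
    slope is infinite. *)
Lemma eta_dual (r c : R) : 0 <= r -> c < Defs.eta r -> exists p, c < r * p - expR p + 1.
Proof.
rewrite le_eqVlt => /predU1P[<-|r0]; rewrite /Defs.eta; last first.
  by exists (ln r); rewrite lnK ?posrE.
rewrite mul0r subrr add0r => c1; exists (ln ((1 - c) / 2)).
by rewrite mul0r lnK ?posrE; lra.
Qed.

Lemma entropy_ptE (a b : R) : 0 < b -> entropy_pt a b = (b * Defs.eta (a / b))%:E.
Proof. by move=> b0; rewrite /entropy_pt gt_eqF. Qed.

Lemma entropy_ge0 (m n : {finite_measure set (measurableTypeR R) -> \bar R}) :
  (0 <= entropy m n)%E.
Proof.
rewrite /entropy; case: ifP => // _; apply: integral_ge0 => x _.
by rewrite lee_fin eta_ge0.
Qed.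

(** Lower semicontinuity of the entropy of finitely many point masses, with
    varying reference weights: the dual formula makes it a supremum of functions that are
    affine in the masses and in the weights. *)
Lemma sum_entropy_pt_liminf (I : finType) (a b : nat -> I -> R) (al bl : I -> R) (c : R) :
  (forall n i, 0 <= a n i) -> (forall n i, 0 < b n i) -> (forall i, 0 < bl i) ->
  (forall i, a n i @[n --> \oo] --> al i) -> (forall i, b n i @[n --> \oo] --> bl i) ->
  (c%:E < \sum_i entropy_pt (al i) (bl i))%E ->
  \forall n \near \oo, (c%:E <= \sum_i entropy_pt (a n i) (b n i))%E.
Proof.
move=> a0 b0 bl0 aal bbl.
have al0 i : 0 <= al i.
  rewrite -(cvg_lim _ (aal i))//; apply: limr_ge; first by apply/cvg_ex; exists (al i).
  by apply: nearW => n; exact: a0.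
under eq_bigr do rewrite entropy_ptE//.
rewrite sumEFin lte_fin => cE.
have [p cp] : exists p : I -> R, c < \sum_i (al i * p i - bl i * (expR (p i) - 1)).
  pose n := \sum_(i : I) (1 : R).
  have n0 : 0 <= n by exact: sumr_ge0.
  pose e := (\sum_i bl i * Defs.eta (al i / bl i) - c) / (n + 1).
  have e0 : 0 < e by rewrite divr_gt0 ?subr_gt0// ltr_wpDl.
  have /choice[p pP] : forall i, exists p,
      bl i * Defs.eta (al i / bl i) - e < al i * p - bl i * (expR p - 1).
    move=> i; have [||p pP] := @eta_dual (al i / bl i) (Defs.eta (al i / bl i) - e / bl i).
    - by rewrite divr_ge0// ltW.
    - by rewrite ltrBlDr ltrDl divr_gt0.
    - exists p; move: pP; rewrite -(ltr_pM2l (bl0 i)).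
      rewrite (_ : bl i * (al i / bl i * p - expR p + 1) = al i * p - bl i * (expR p - 1)).
        by rewrite (_ : bl i * (Defs.eta (al i / bl i) - e / bl i) = bl i * Defs.eta (al i / bl i) - e)//;
          field; rewrite gt_eqF.
      by field; rewrite gt_eqF.
  exists p; apply: (@lt_le_trans _ _ (\sum_i (bl i * Defs.eta (al i / bl i) - e))); last first.
    by apply: ler_sum => i _; exact: ltW.
  rewrite sumrB [X in _ - X](eq_bigr (fun=> 1 * e)); last by move=> i _; rewrite mul1r.
  rewrite -mulr_suml -/n ltrBrDl -ltrBrDr.
  have -> : \sum_i bl i * Defs.eta (al i / bl i) - c = (n + 1) * e.
    by rewrite /e mulrCA divff ?mulr1// gt_eqF// ltr_wpDl.
  by rewrite mulrDl mul1r ltrDl.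
have cv : \sum_i (a n i * p i - b n i * (expR (p i) - 1)) @[n --> \oo] -->
    \sum_i (al i * p i - bl i * (expR (p i) - 1)).
  apply: cvg_sumr => i _; apply: cvgB; apply: cvgM; [exact: aal|exact: cvg_cst|exact: bbl|exact: cvg_cst].
rewrite -subr_gt0 in cp.
move/cvgrPdist_lt : cv => /(_ _ cp); apply: filterS => n /(le_lt_trans (ler_norm _)) h.
under eq_bigr do rewrite entropy_ptE//.
rewrite sumEFin lee_fin; apply: (@le_trans _ _ (\sum_i (a n i * p i - b n i * (expR (p i) - 1)))).
  lra.
apply: ler_sum => i _.
have := eta_ge (p i) (divr_ge0 (a0 n i) (ltW (b0 n i))).
move=> /(ler_wpM2l (ltW (b0 n i))); apply: le_trans.
by rewrite le_eqVlt; apply/orP; left; apply/eqP; field; rewrite gt_eqF.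
Qed.

End LiminfEntropy.

(** * The dissipation in rescaled variables *)

Section GraphFacts.
Context {R : realType} {M : metric_graph R} (D : graph_data M) (T : R).
Implicit Types (e : edge M) (v : vertex M) (m : probM M).
Notation leb := (@lebesgue_measure R).

Lemma etail_neq_ehead e : etail e != ehead e.
Proof.
case: e => -[a b] /= ab; rewrite /etail /ehead /=; apply/eqP => abE.
by move: ab; rewrite abE (negbTE (edge_irrefl b)).
Qed.

Lemma incident_etail e : incident e (etail e).
Proof. by rewrite /incident eqxx. Qed.

Lemma incident_ehead e : incident e (ehead e).
Proof. by rewrite /incident eqxx orbT. Qed.

Lemma big_incident (A : Type) (x0 : A) (op : Monoid.com_law x0) e (F : vertex M -> A) :
  \big[op/x0]_(v | incident e v) F v = op (F (etail e)) (F (ehead e)).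
Proof.
rewrite (bigD1 (etail e)) ?incident_etail//=; congr (op _ _).
rewrite (big_pred1 (ehead e))// => v; rewrite /incident.
case: eqVneq => [->|vt]; rewrite ?andbT ?andbF//=.
  by rewrite (negbTE (etail_neq_ehead e)).
Qed.

Lemma big_vertex_edge (A : Type) (x0 : A) (op : Monoid.com_law x0)
    (F : edge M -> vertex M -> A) :
  \big[op/x0]_v \big[op/x0]_(e | incident e v) F e v =
  \big[op/x0]_e op (F e (etail e)) (F e (ehead e)).
Proof.
rewrite (exchange_big_dep xpredT)//=.
by apply: eq_bigr => e _; rewrite -big_incident.
Qed.

Lemma pi_end_gt0 e v : 0 < pi_end D e v.
Proof. by rewrite /pi_end /endval; case: ifP => _; exact: expR_gt0. Qed.

Lemma omegaP_gt0 v : 0 < omega D v. Proof. exact: omega_gt0. Qed.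

Lemma measurable_segment e : measurable (segment e : set (measurableTypeR R)).
Proof. exact: measurable_itv. Qed.

Lemma rho_mass_ge0 m e : 0 <= rho_mass m e.
Proof. by rewrite /rho_mass fine_ge0. Qed.

Lemma rho_massE m e : (rho_mass m e)%:E = rho m e (segment e).
Proof. by rewrite /rho_mass fineK// fin_num_measure//; exact: measurable_segment. Qed.

Lemma sum_masses m : \sum_v gam m v + \sum_e rho_mass m e = 1.
Proof.
apply/EFin_inj; rewrite EFinD -(probM_mass m); congr (_ + _)%E.
by rewrite -sumEFin; apply: eq_bigr => e _; rewrite rho_massE.
Qed.

Lemma gam_le1 m v : gam m v <= 1.
Proof.
rewrite -(sum_masses m) (bigD1 v)//= -addrA lerDl addr_ge0//.
  by apply: sumr_ge0 => ? _; exact: gam_ge0.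
by apply: sumr_ge0 => ? _; exact: rho_mass_ge0.
Qed.

(** The Lipschitz potential is bounded above on the segment, so that the density of
    [pi] is bounded below by a positive constant. *)
Lemma Pi_gt0 e : 0 < rho_mass (refm D) e.
Proof.
rewrite -lte_fin rho_massE pi_density ?setIid; last exact: measurable_segment.
have [k [_ kL]] := pot_lipschitz D e.
have {}kL x y : segment e x -> segment e y ->
    `|pot D e x - pot D e y| <= (`|k| + 1) * `|x - y|.
  move=> ex ey; apply: (kL (`|k| + 1) _ (x, y)) => //.
  by rewrite (le_lt_trans (ler_norm k))// ltrDl.
have L0 : 0 <= len e by rewrite ltW// len_gt0.
have e0 : segment e 0 by rewrite /segment/= in_itv/= lexx.
have mpot : measurable_fun (segment e) (fun x => expR (- pot D e x)).
  apply: measurableT_comp; first exact: measurable_expR.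
  apply: measurableT_comp => //.
  apply: subspace_continuous_measurable_fun; first exact: measurable_itv.
  apply/subspace_continuousP => x ex; apply/cvgrPdist_lt => d d0.
  have dk : 0 < d / (`|k| + 1) by rewrite divr_gt0// ltr_wpDl.
  rewrite near_withinE; apply/nbhs_ballP; exists (d / (`|k| + 1)) => // y xy ey.
  apply: le_lt_trans (kL _ _ ex ey) _; rewrite mulrC -ltr_pdivlMr ?ltr_wpDl//.
pose B := `|pot D e 0| + (`|k| + 1) * len e.
have potB x : segment e x -> pot D e x <= B.
  move=> ex; have := kL _ _ ex e0; rewrite subr0 => /(le_trans (ler_norm _)) h.
  move: (ex); rewrite /segment/= in_itv/= => /andP[x0 xL].
  have : (`|k| + 1) * `|x| <= (`|k| + 1) * len e.
    by rewrite ler_wpM2l ?addr_ge0// ger0_norm.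
  have := ler_norm (pot D e 0); rewrite /B; lra.
apply: (@lt_le_trans _ _ (\int[leb]_(x in segment e) (expR (- B))%:E)%E).
  rewrite integral_cst; last exact: measurable_itv.
  have lenE : leb (segment e) = (len e)%:E.
    by rewrite /segment lebesgue_measure_itv/= lte_fin len_gt0 sube0.
  rewrite [X in (_ * X)%E](_ : _ = (len e)%:E); last exact: lenE.
  rewrite -EFinM lte_fin.
  by rewrite mulr_gt0 ?expR_gt0 ?len_gt0.
apply: ge0_le_integral.
- exact: measurable_itv.
- by move=> x _; rewrite lee_fin ltW// expR_gt0.
- exact: measurable_cst.
- by apply/measurable_EFinP; exact: mpot.
- by move=> x ex; rewrite lee_fin ler_expR lerN2; exact: potB.
Qed.

Lemma Zeps_gt0 (v : vertex M) (eps : R) : 0 <= eps -> 0 < Zeps D eps.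
Proof.
move=> eps0; rewrite /Zeps ltr_wpDr//.
  by rewrite mulr_ge0// sumr_ge0// => e _; exact: rho_mass_ge0.
rewrite (bigD1 v)//= ltr_wpDr ?omegaP_gt0//.
by rewrite sumr_ge0// => w _; rewrite ltW// omegaP_gt0.
Qed.

(** The normalizing constant [Zeps] cancels from the integrand of the dissipation when it
    is expressed with the next three quantities; the densities are therefore taken with
    respect to [omega] and [eps * pi]. *)
Definition alpha e v : R := rate_ev D e v * pi_end D e v.
Definition gdens m v : R := Num.sqrt (gam m v / omega D v).
Definition zdens (eps : R) m e : R := Num.sqrt (rho_mass m e / (eps * rho_mass (refm D) e)).

Lemma alpha_gt0 e v : incident e v -> 0 < alpha e v.
Proof. by move=> ev; rewrite mulr_gt0 ?pi_end_gt0//; exact: rate_ev_gt0. Qed.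

Lemma gdens_bound : exists G : R, forall m v, 0 <= gdens m v <= G.
Proof.
exists (\sum_v Num.sqrt (omega D v)^-1) => m v; rewrite sqrtr_ge0/=.
rewrite (bigD1 v)//= ler_wpDr//; first by apply: sumr_ge0 => w _; exact: sqrtr_ge0.
by rewrite ler_wsqrtr// ler_piMl ?gam_le1// invr_ge0 ltW// omegaP_gt0.
Qed.

Lemma zeta_mass (eps : {posnum R}) (mu : R -> probM M) (zeta : R -> edge M -> R) t e :
  has_density D T eps mu zeta -> t \in `[0, T] ->
  rho_mass (mu t) e = zeta t e * (eps%:num / Zeps D eps%:num * rho_mass (refm D) e).
Proof.
move=> hz tT; apply: EFin_inj; rewrite rho_massE (hz t tT e); last exact: measurable_segment.
by rewrite 2!EFinM rho_massE.
Qed.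

(** In these variables the parameter [eps] enters the dissipation only through
    [zdens]. *)
Lemma integrandE (eps : {posnum R}) (mu : R -> probM M) (j : flux M)
    (zeta : R -> edge M -> R) t e v :
  has_density D T eps mu zeta -> t \in `[0, T] ->
  (Cpersp (j t e v)
      (sigma_eps D eps e v (gam (mu t) v) (zeta t e * pi_eps_end D eps e v))
    + (2 * sigma_eps D eps e v (omega_eps D eps%:num v) (pi_eps_end D eps e v)
       * `|Num.sqrt (zeta t e)
           - Num.sqrt (gam (mu t) v / omega_eps D eps%:num v)| ^+ 2)%:E)%E =
  halfcost (alpha e v) (j t e v) (gdens (mu t) v) (zdens eps%:num (mu t) e).
Proof.
move=> hz tT; have Z0 : 0 < Zeps D eps%:num by apply: (Zeps_gt0 v); exact: ge0.
have om0 := omegaP_gt0 v; have pi0 := pi_end_gt0 e v; have eps0 : 0 < eps%:num by [].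
have Pi0 := Pi_gt0 e.
have zE := zeta_mass e hz tT.
have ze0 : 0 <= zeta t e.
  have := rho_mass_ge0 (mu t) e; by rewrite zE pmulr_lge0// mulr_gt0// divr_gt0.
have g0 := gam_ge0 (mu t) v.
have zdE : zdens eps%:num (mu t) e = Num.sqrt (zeta t e) / Num.sqrt (Zeps D eps%:num).
  rewrite /zdens zE (_ : _ / _ = zeta t e / Zeps D eps%:num).
    by rewrite sqrtrM// sqrtrV// ltW.
  by field; rewrite !gt_eqF.
have gdE : gdens (mu t) v = Num.sqrt (gam (mu t) v) / Num.sqrt (omega D v).
  by rewrite /gdens sqrtrM// sqrtrV// ltW.
have piE : pi_end D e v = Num.sqrt (pi_end D e v) ^+ 2 by rewrite sqr_sqrtr// ltW.
have ZE : Zeps D eps%:num = Num.sqrt (Zeps D eps%:num) ^+ 2 by rewrite sqr_sqrtr// ltW.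
have sZ : 0 < Num.sqrt (Zeps D eps%:num) by rewrite sqrtr_gt0.
have so : 0 < Num.sqrt (omega D v) by rewrite sqrtr_gt0.
have se : 0 < Num.sqrt eps%:num by rewrite sqrtr_gt0.
rewrite /halfcost; congr (Cpersp _ _ + _%:E)%E.
  rewrite /sigma_eps /kappa /pi_eps_end zdE gdE /alpha.
  rewrite (sqrtrM _ (ltW pi0)) sqrtrV ?(ltW om0)//.
  rewrite (sqrtrM _ g0) (sqrtrM _ ze0) (sqrtrM _ (divr_ge0 (ltW eps0) (ltW Z0))).
  rewrite (sqrtrM _ (ltW eps0)) sqrtrV ?(ltW Z0)//.
  rewrite [in RHS]piE; field.
  by rewrite !gt_eqF.
rewrite real_normK ?num_real//.
rewrite /sigma_eps /kappa /pi_eps_end /omega_eps zdE gdE /alpha.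
rewrite (sqrtrM _ (ltW pi0)) sqrtrV ?(ltW om0)//.
rewrite (sqrtrM _ (divr_ge0 (ltW om0) (ltW Z0))) (sqrtrM _ (divr_ge0 (ltW eps0) (ltW Z0))).
rewrite (sqrtrM _ (ltW eps0)) (sqrtrM _ (ltW om0)) sqrtrV ?(ltW Z0)//.
rewrite (sqrtrM _ g0) (@sqrtrV _ (omega D v / Zeps D eps%:num)) ?divr_ge0 ?(ltW om0) ?(ltW Z0)//.
rewrite (sqrtrM _ (ltW om0)) sqrtrV ?(ltW Z0)//.
rewrite [pi_end D e v in RHS]piE; field.
by rewrite !gt_eqF.
Qed.

(** The density of [rho] is determined by the mass of the edge, hence the value does not
    depend on the density that the definition chooses. *)
Lemma dissipation_epsE (eps : {posnum R}) (mu : R -> probM M) (j : flux M) :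
  CE_bar T mu j -> (exists zeta, has_density D T eps mu zeta) ->
  dissipation_eps D T eps mu j =
  (\sum_v \sum_(e : edge M | incident e v) \int[leb]_(t in `[0%R, T])
     halfcost (alpha e v) (j t e v) (gdens (mu t) v) (zdens eps%:num (mu t) e))%E.
Proof.
move=> ce hz; rewrite /dissipation_eps; case: pselect => [[ce' hz']|]; last by case.
case: cid => zeta /= zd; rewrite /dissipation_int.
apply: eq_bigr => v _; apply: eq_bigr => e ev; apply: eq_integral => t.
by rewrite inE/= => tT; apply: integrandE => //; exact: zd.
Qed.

(** The continuity equation tested with the indicator function of a node. *)
Lemma CE_bar_gam (mu : R -> probM M) (j : flux M) v : CE_bar T mu j ->
  {ae leb, forall t, t \in `]0, T[ ->
    is_derive t 1 (fun s => gam (mu s) v) (\sum_(e : edge M | incident e v) j t e v)}.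
Proof.
case=> _ _ _ /(_ (fun w => (w == v)%:R) (fun=> 0)).
apply: filterS => [|t Ht tT]; first exact: (ae_filter_ringOfSetsType leb).
have := Ht tT.
rewrite (_ : (fun s => _) = (fun s => gam (mu s) v)); last first.
  apply/funext => s; rewrite [X in _ + X]big1 ?addr0; last by move=> e _; rewrite mul0r.
  rewrite (bigD1 v)//= eqxx mul1r big1 ?addr0// => w /negbTE ->; exact: mul0r.
rewrite (_ : \sum_v0 _ = \sum_(e : edge M | incident e v) j t e v)//.
rewrite (bigD1 v)//= [X in _ + X]big1 ?addr0; last first.
  by move=> w /negbTE wv; apply: big1 => e _; rewrite wv subr0 mul0r.
by apply: eq_bigr => e _; rewrite eqxx subr0 mul1r.
Qed.

(** The continuity equation tested with the indicator function of an edge. *)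
Lemma CE_bar_rho (mu : R -> probM M) (j : flux M) e : CE_bar T mu j ->
  {ae leb, forall t, t \in `]0, T[ ->
    is_derive t 1 (fun s => rho_mass (mu s) e) (- (j t e (etail e) + j t e (ehead e)))}.
Proof.
case=> _ _ _ /(_ (fun=> 0) (fun f => (f == e)%:R)).
apply: filterS => [|t Ht tT]; first exact: (ae_filter_ringOfSetsType leb).
have := Ht tT.
rewrite (_ : (fun s => _) = (fun s => rho_mass (mu s) e)); last first.
  apply/funext => s; rewrite big1 ?add0r; last by move=> v _; rewrite mul0r.
  rewrite (bigD1 e)//= eqxx mul1r big1 ?addr0// => w /negbTE ->; exact: mul0r.
rewrite (_ : \sum_v0 _ = - (j t e (etail e) + j t e (ehead e)))//.
rewrite (big_vertex_edge _ (fun f v => (0 - (f == e)%:R) * j t f v)) (bigD1 e)//= eqxx.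
rewrite [X in _ + X]big1 ?addr0; last by move=> f /negbTE ->; rewrite subr0 !mul0r addr0.
by rewrite sub0r !mulN1r opprD.
Qed.

End GraphFacts.

(** * A priori bounds along families of bounded dissipation *)

Section Clamp.
Context {R : realType} (T : R).
Hypothesis T0 : 0 <= T.

(** Extends curves from the time interval to the line by constants, which preserves
    equicontinuity and allows every rational number as a time. *)
Definition clamp (t : R) : R := Num.max 0 (Num.min t T).

Lemma clamp_itv t : 0 <= clamp t <= T.
Proof. by rewrite /clamp le_max lexx/= ge_max T0 ge_min lexx orbT. Qed.

Lemma clamp_id t : 0 <= t <= T -> clamp t = t.
Proof. by move=> /andP[t0 tT]; rewrite /clamp min_l// max_r. Qed.

Lemma clamp_lipschitz u v : `|clamp u - clamp v| <= `|u - v|.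
Proof.
wlog uv : u v / u <= v.
  move=> H; have [uv|/ltW vu] := leP u v; first exact: H.
  by rewrite distrC (distrC u); exact: H.
rewrite (distrC u) (distrC (clamp u)) (ger0_norm (_ : 0 <= v - u)) ?subr_ge0//.
rewrite /clamp /Num.max /Num.min; have T0' := T0.
case: (ltP v T) => vT; case: (ltP u T) => uT; case: (ltP 0 u) => u0;
  case: (ltP 0 v) => v0; case: (ltP 0 T) => TT0; rewrite ler_norml;
  by apply/andP; split; lra.
Qed.

End Clamp.

Section Families.
Context {R : realType} {M : metric_graph R} (D : graph_data M) (T : R).
Hypothesis T0 : 0 < T.
Notation leb := (@lebesgue_measure R).
Variables (I : Type) (eps : I -> {posnum R}) (mu : I -> R -> probM M) (j : I -> flux M) (K : R).
Hypotheses (hCE : forall i, CE_bar T (mu i) (j i))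
  (hz : forall i, exists zeta, has_density D T (eps i) (mu i) zeta)
  (hK : forall i, (dissipation_eps D T (eps i) (mu i) (j i) <= K%:E)%E).
Implicit Types (e : edge M) (v : vertex M).

Let T0' : 0 <= T := ltW T0.
Let mT : measurable (`[0, T]%classic : set R) := measurable_itv _.

Lemma measurable_flux i e v : incident e v -> measurable_fun `[0, T] (fun t => j i t e v).
Proof. by case: (hCE i) => mj _ _ _; exact: mj. Qed.

Lemma abs_cont_gam i v : abs_cont 0 T (fun t => gam (mu i t) v).
Proof. by case: (hCE i). Qed.

Lemma abs_cont_rho i e : abs_cont 0 T (fun t => rho_mass (mu i t) e).
Proof. by case: (hCE i). Qed.

Lemma measurable_abs_cont (f : R -> R) : abs_cont 0 T f -> measurable_fun `[0, T] f.
Proof. by move=> /abs_cont_within cf; exact: subspace_continuous_measurable_fun. Qed.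

Lemma measurable_rho i e : measurable_fun `[0, T] (fun t => rho_mass (mu i t) e).
Proof.
apply: (measurable_abs_cont (f := fun t => rho_mass (mu i t) e)).
exact: abs_cont_rho.
Qed.

Lemma measurable_gdens i v : measurable_fun `[0, T] (fun t => gdens D (mu i t) v).
Proof.
apply: measurableT_comp; first exact: measurable_sqrt.
apply: measurable_funM => //; apply: (measurable_abs_cont (f := fun t => gam (mu i t) v)).
exact: abs_cont_gam.
Qed.

Lemma measurable_zdens i e : measurable_fun `[0, T] (fun t => zdens D (eps i)%:num (mu i t) e).
Proof.
apply: measurableT_comp; first exact: measurable_sqrt.
apply: measurable_funM => //; exact: measurable_rho.
Qed.

Definition edge_halfcost i e v t : \bar R :=
  halfcost (alpha D e v) (j i t e v) (gdens D (mu i t) v) (zdens D (eps i)%:num (mu i t) e).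

Lemma edge_halfcost_ge0 i e v t : incident e v -> (0 <= edge_halfcost i e v t)%E.
Proof. by move=> ev; apply: halfcost_ge0; [exact/ltW/alpha_gt0|exact: sqrtr_ge0|exact: sqrtr_ge0]. Qed.

Lemma measurable_edge_halfcost i e v : incident e v -> measurable_fun `[0, T] (edge_halfcost i e v).
Proof.
move=> ev; apply: measurable_halfcost => //; first exact: measurable_flux.
- exact: measurable_gdens.
- exact: measurable_zdens.
Qed.

Lemma dissipation_edges i : dissipation_eps D T (eps i) (mu i) (j i) =
  (\sum_e \int[leb]_(t in `[0%R, T])
     (edge_halfcost i e (etail e) t + edge_halfcost i e (ehead e) t))%E.
Proof.
rewrite dissipation_epsE// (big_vertex_edge _ (fun e v => \int[leb]_(t in `[0%R, T]) edge_halfcost i e v t)%E).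
apply: eq_bigr => e _; rewrite [RHS]ge0_integralD//.
- by move=> t _; exact/edge_halfcost_ge0/incident_etail.
- by apply: measurable_edge_halfcost; exact: incident_etail.
- by move=> t _; exact/edge_halfcost_ge0/incident_ehead.
- by apply: measurable_edge_halfcost; exact: incident_ehead.
Qed.

Lemma dissipation_ge0 i : (0 <= dissipation_eps D T (eps i) (mu i) (j i))%E.
Proof.
rewrite dissipation_edges; apply: sume_ge0 => e _; apply: integral_ge0 => t _.
by rewrite adde_ge0// edge_halfcost_ge0// ?incident_etail ?incident_ehead.
Qed.

Lemma edge_halfcost_bound i e v : incident e v ->
  (\int[leb]_(t in `[0%R, T]) edge_halfcost i e v t <= K%:E)%E.
Proof.
move=> ev; apply: le_trans (hK i); rewrite dissipation_epsE//.
have F0 w f : incident f w -> (0 <= \int[leb]_(t in `[0%R, T]) edge_halfcost i f w t)%E.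
  by move=> fw; apply: integral_ge0 => t _; exact: edge_halfcost_ge0.
rewrite (bigD1 v)//= (bigD1 e)//= -addeA leeDl// adde_ge0//.
  by apply: sume_ge0 => f /andP[fv _]; exact: F0.
by apply: sume_ge0 => w _; apply: sume_ge0 => f fw; exact: F0.
Qed.

(** The node densities are bounded because the masses are, which makes the equi-integrability
    uniform in the parameter. *)
Lemma equiintegrable_flux e v : incident e v ->
  equiintegrable leb `[0, T]%classic (fun i t => j i t e v).
Proof.
move=> ev; have [G gG] := gdens_bound D.
apply: (@equiintegrable_halfcost R `[0, T]%classic _ _ I (alpha D e v) G K _
   (fun i t => gdens D (mu i t) v) (fun i t => zdens D (eps i)%:num (mu i t) e)) => //.
- exact: leb_itv_lty.
- exact: alpha_gt0.
- by move=> i; exact: measurable_flux.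
- by move=> i; exact: measurable_gdens.
- by move=> i; exact: measurable_zdens.
- by move=> i t _; exact: sqrtr_ge0.
- by move=> i; exact: edge_halfcost_bound.
Qed.

Lemma equiintegrable_vertex_flux v :
  equiintegrable leb `[0, T]%classic (fun i t => \sum_(e : edge M | incident e v) j i t e v).
Proof.
apply: (equiintegrable_sum _ _ (f := fun e i t => j i t e v)) => // e ev.
exact: equiintegrable_flux.
Qed.

Lemma equiintegrable_edge_flux e :
  equiintegrable leb `[0, T]%classic (fun i t => j i t e (etail e) + j i t e (ehead e)).
Proof.
apply: equiintegrableD => //; apply: equiintegrable_flux.
- exact: incident_etail.
- exact: incident_ehead.
Qed.

Lemma gam_FTC i v t : 0 <= t <= T -> gam (mu i t) v - gam (mu i 0) v =
  prim 0 (fun s => \sum_(e : edge M | incident e v) j i s e v) t.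
Proof.
move=> tT; apply: (abs_cont_FTC (f := fun s => gam (mu i s) v) T0') => //.
- exact: abs_cont_gam.
- exact: (equiintegrable_vertex_flux v).1.
- by apply: CE_bar_gam; exact: hCE.
Qed.

Lemma rho_FTC i e t : 0 <= t <= T -> rho_mass (mu i t) e - rho_mass (mu i 0) e =
  - prim 0 (fun s => j i s e (etail e) + j i s e (ehead e)) t.
Proof.
move=> tT; have ij := (equiintegrable_edge_flux e).1 i.
have ijN : leb.-integrable `[0, T] (EFin \o (fun s => - (j i s e (etail e) + j i s e (ehead e)))).
  by have := integrableN ij; apply: eq_integrable.
rewrite (abs_cont_FTC (f := fun s => rho_mass (mu i s) e)
  (g := fun s => - (j i s e (etail e) + j i s e (ehead e))) T0' (abs_cont_rho i e) ijN _ tT); last first.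
  exact: CE_bar_rho (hCE i).
case/andP: tT => t0 tT.
have sub : `[0, t] `<=` `[0, T] by apply: subset_itvl; rewrite bnd_simp.
have ijt : leb.-integrable `[0, t] (EFin \o (fun s => j i s e (etail e) + j i s e (ehead e))).
  exact: integrableS ij.
rewrite /prim -mulN1r -RintegralZl//; apply: eq_Rintegral => s _; by rewrite mulN1r.
Qed.

Lemma gam_equicontinuous v (d : R) : 0 < d -> exists2 h : R, 0 < h &
  forall i u w, 0 <= u <= T -> 0 <= w <= T -> `|u - w| < h ->
    `|gam (mu i u) v - gam (mu i w) v| < d.
Proof.
move=> d0; have [h h0 H] := equiintegrable_prim T0' (equiintegrable_vertex_flux v) d0.
exists h => // i u w uT wT uw.
by have := H i u w uT wT uw; rewrite -!gam_FTC// opprB addrA subrK.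
Qed.

Lemma rho_equicontinuous e (d : R) : 0 < d -> exists2 h : R, 0 < h &
  forall i u w, 0 <= u <= T -> 0 <= w <= T -> `|u - w| < h ->
    `|rho_mass (mu i u) e - rho_mass (mu i w) e| < d.
Proof.
move=> d0; have [h h0 H] := equiintegrable_prim T0' (equiintegrable_edge_flux e) d0.
exists h => // i u w uT wT uw.
have := H i u w uT wT uw; rewrite -normrN opprD.
by rewrite -!rho_FTC// opprB addrA subrK.
Qed.

Lemma integrable_rho i e : leb.-integrable `[0, T] (EFin \o (fun t => rho_mass (mu i t) e)).
Proof.
apply: measurable_bounded_integrable => //.
- exact: leb_itv_lty.
- exact: measurable_rho.
- exists 1; split; first exact: num_real.
  move=> x x1 t _; rewrite /= ger0_norm ?rho_mass_ge0//; apply: le_trans (ltW x1).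
  rewrite -(sum_masses (mu i t)) (bigD1 e)//= addrCA lerDl addr_ge0//.
    by apply: sumr_ge0 => ? _; exact: gam_ge0.
  by apply: sumr_ge0 => ? _; exact: rho_mass_ge0.
Qed.

(** The dissipation controls the density of the mass on an edge with respect to
    [pi^eps] in [L^1], and the mass is [eps] times a bounded multiple of it. *)
Lemma rho_integral_bound e : exists C : R, forall i,
  \int[leb]_(t in `[0, T]) rho_mass (mu i t) e <= (eps i)%:num * C.
Proof.
have [G gG] := gdens_bound D; pose a := alpha D e (etail e).
have a0 : 0 < a by exact/alpha_gt0/incident_etail.
have Pi0 := Pi_gt0 D e.
exists (rho_mass (refm D) e * (a^-1 * K + 2 * G ^+ 2 * T)) => i.
have ev := incident_etail e.
have eps0 : 0 < (eps i)%:num by [].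
pose c := (eps i)%:num * rho_mass (refm D) e.
have c0 : 0 < c by rewrite mulr_gt0.
rewrite mulrA -/c -lee_fin EFin_Rintegral//; last exact: integrable_rho.
have rE t : rho_mass (mu i t) e = c * zdens D (eps i)%:num (mu i t) e ^+ 2.
  rewrite /zdens sqr_sqrtr; first by rewrite -/c mulrC divfK// gt_eqF.
  by rewrite divr_ge0 ?rho_mass_ge0// ltW.
have mh := measurable_edge_halfcost i ev.
have h0 t : (0 <= edge_halfcost i e (etail e) t)%E by exact: edge_halfcost_ge0.
have ca0 : 0 <= c * a^-1 by rewrite mulr_ge0 ?invr_ge0 ?(ltW c0) ?(ltW a0).
apply: (@le_trans _ _ (\int[leb]_(t in `[0%R, T])
   ((c * a^-1)%:E * edge_halfcost i e (etail e) t + (c * (2 * G ^+ 2))%:E))%E).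
  apply: ge0_le_integral => //.
  - by move=> t _; rewrite lee_fin rho_mass_ge0.
  - by apply/measurable_EFinP; exact: measurable_rho.
  - by apply: emeasurable_funD => //; apply: emeasurable_funM => //; exact: measurable_cst.
  - move=> t _; rewrite rE.
    rewrite /edge_halfcost /halfcost -/a; set z := zdens _ _ _ _; set g := gdens _ _ _.
    have /andP[g0 gG'] : 0 <= g <= G by exact: gG.
    have z0 : 0 <= z by exact: sqrtr_ge0.
    have C0 : (0 <= Cpersp (j i t e (etail e)) (a * g * z))%E.
      by apply: Cpersp_ge0; apply: mulr_ge0 => //; apply: mulr_ge0 => //; exact: ltW.
    apply: (@le_trans _ _ ((c * a^-1)%:E * (2 * a * (z - g) ^+ 2)%:E + (c * (2 * G ^+ 2))%:E)%E).
      rewrite -EFinM -EFinD lee_fin.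
      have -> : c * a^-1 * (2 * a * (z - g) ^+ 2) = c * (2 * (z - g) ^+ 2).
        by field; rewrite gt_eqF.
      rewrite -mulrDr ler_pM2l//.
      have : g ^+ 2 <= G ^+ 2 by rewrite lerXn2r ?nnegrE// (le_trans g0).
      have := sqr_ge0 (z - 2 * g).
      by rewrite !expr2; nra.
    apply: leeD2r; apply: lee_wpmul2l; first by rewrite lee_fin.
    by rewrite leeDr.
rewrite ge0_integralD//; last 3 first.
- by move=> t _; rewrite mule_ge0// lee_fin.
- by apply: emeasurable_funM => //; exact: measurable_cst.
- by move=> t _; rewrite lee_fin mulr_ge0 ?(ltW c0)// mulr_ge0// sqr_ge0.
rewrite ge0_integralZl// ?lee_fin//.
rewrite integral_cst// [X in (_ + _ * X)%E](_ : _ = T%:E); last first.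
  have lenE : leb `[0, T] = T%:E by rewrite lebesgue_measure_itv/= lte_fin T0 sube0.
  exact: lenE.
apply: (@le_trans _ _ ((c * a^-1)%:E * K%:E + (c * (2 * G ^+ 2))%:E * T%:E)%E).
  by apply: leeD2r; apply: lee_wpmul2l; [rewrite lee_fin|exact: edge_halfcost_bound].
by rewrite -!EFinM -EFinD lee_fin le_eqVlt; apply/orP; left; apply/eqP; ring.
Qed.

End Families.

Section Vanishing.
Context {R : realType} {M : metric_graph R} (D : graph_data M) (T : R).
Hypothesis T0 : 0 < T.
Notation leb := (@lebesgue_measure R).
Variables (eps : nat -> {posnum R}) (mu : nat -> R -> probM M) (j : nat -> flux M) (K : R).
Hypotheses (hCE : forall i, CE_bar T (mu i) (j i))
  (hz : forall i, exists zeta, has_density D T (eps i) (mu i) zeta)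
  (hK : forall i, (dissipation_eps D T (eps i) (mu i) (j i) <= K%:E)%E)
  (eps0 : (eps n)%:num @[n --> \oo] --> (0 : R)).

(** Time averages of the mass of an edge are of order [eps], and the mass is
    equicontinuous in time. *)
Lemma rho_mass_cvg0 e t : 0 <= t <= T -> rho_mass (mu n t) e @[n --> \oo] --> (0 : R).
Proof.
move=> tT; apply: (equicontinuous_integral_cvg0 (r := fun n t => rho_mass (mu n t) e) T0) => //.
- by move=> n; apply: integrable_rho => //; exact: hCE.
- by move=> n s _; exact: rho_mass_ge0.
- by move=> d d0; exact: (rho_equicontinuous T0 hCE hz hK e d0).
have [C HC] := rho_integral_bound T0 hCE hz hK e.
apply: (squeeze_cvgr (f := fun=> 0) (h := fun n => (eps n)%:num * C)).
- apply: nearW => n; rewrite HC andbT; apply: Rintegral_ge0 => s _; exact: rho_mass_ge0.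
- exact: cvg_cst.
- by rewrite -[X in _ --> X](mul0r C); apply: cvgM => //; exact: cvg_cst.
Qed.

End Vanishing.

(** * Convergent subsequences and the limit flux *)

Section PrimitiveLinearity.
Context {R : realType} (T : R).
Notation leb := (@lebesgue_measure R).

Let integrable_sub (f : R -> R) t : 0 <= t <= T ->
  leb.-integrable `[0, T] (EFin \o f) -> leb.-integrable `[0, t] (EFin \o f).
Proof.
move=> /andP[_ tT] jf; apply: integrableS jf => //.
by apply: subset_itvl; rewrite bnd_simp.
Qed.

Lemma primD (f h : R -> R) t : 0 <= t <= T ->
  leb.-integrable `[0, T] (EFin \o f) -> leb.-integrable `[0, T] (EFin \o h) ->
  prim 0 (fun s => f s + h s) t = prim 0 f t + prim 0 h t.
Proof. by move=> tT jf jh; rewrite /prim RintegralD//; exact: integrable_sub. Qed.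

Lemma prim_fB (f h : R -> R) t : 0 <= t <= T ->
  leb.-integrable `[0, T] (EFin \o f) -> leb.-integrable `[0, T] (EFin \o h) ->
  prim 0 (fun s => f s - h s) t = prim 0 f t - prim 0 h t.
Proof. by move=> tT jf jh; rewrite /prim RintegralB//; exact: integrable_sub. Qed.

Lemma primZ (c : R) (f : R -> R) t : 0 <= t <= T ->
  leb.-integrable `[0, T] (EFin \o f) -> prim 0 (fun s => c * f s) t = c * prim 0 f t.
Proof. by move=> tT jf; rewrite /prim RintegralZl//; exact: integrable_sub. Qed.

Lemma integrable_sumr (J : Type) (s : seq J) (P : pred J) (f : J -> R -> R) :
  (forall k, P k -> leb.-integrable `[0, T] (EFin \o f k)) ->
  leb.-integrable `[0, T] (EFin \o (fun t => \sum_(k <- s | P k) f k t)).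
Proof.
move=> jf; elim: s => [|k s IH].
  rewrite (_ : EFin \o _ = cst 0%E); first exact: integrable0.
  by apply/funext => t /=; rewrite big_nil.
rewrite (_ : (fun t => \sum_(k <- k :: s | P k) f k t) =
  (fun t => (if P k then f k t else 0) + \sum_(k <- s | P k) f k t)); last first.
  by apply/funext => t; rewrite big_cons; case: ifP => _ //; rewrite add0r.
apply: integrableD_EFin => //; have [Pk|_] := boolP (P k); first exact: jf.
exact: integrable0.
Qed.

Lemma prim_sum (J : Type) (s : seq J) (P : pred J) (f : J -> R -> R) t : 0 <= t <= T ->
  (forall k, P k -> leb.-integrable `[0, T] (EFin \o f k)) ->
  prim 0 (fun x => \sum_(k <- s | P k) f k x) t = \sum_(k <- s | P k) prim 0 (f k) t.
Proof.
move=> tT jf; elim: s => [|k s IH].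
  rewrite big_nil /prim; under eq_Rintegral do rewrite big_nil.
  by rewrite Rintegral_cst// mul0r.
rewrite big_cons (_ : (fun x => \sum_(k <- k :: s | P k) f k x) =
  (fun x => (if P k then f k x else 0) + \sum_(k <- s | P k) f k x)); last first.
  by apply/funext => x; rewrite big_cons; case: ifP => _ //; rewrite add0r.
case: ifPn => Pk.
  by rewrite primD// ?IH//; [exact: jf|exact: integrable_sumr].
by rewrite -IH /prim; apply: eq_Rintegral => x _; rewrite add0r.
Qed.

(** The derivative of the primitive is the function itself almost everywhere. *)
Lemma prim_eq0_ae (g : R -> R) : leb.-integrable `[0, T] (EFin \o g) ->
  (forall t, 0 <= t <= T -> prim 0 g t = 0) ->
  {ae leb, forall t, t \in `[0, T] -> g t = 0}.
Proof.
move=> ig g0.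
have ae_neq (c : R) : {ae leb, forall t, t != c}.
  exists [set c]; split => //; first by rewrite lebesgue_measure_set1.
  by move=> t /= /negP; rewrite negbK => /eqP.
have F := ae_filter_ringOfSetsType leb.
apply: filterS3 (prim_ae_derive ig) (ae_neq 0) (ae_neq T) => t + t0 tT.
rewrite !in_itv/= => H /andP[t0' tT'].
have {}t0 : 0 < t by rewrite lt_neqAle eq_sym t0.
have {}tT : t < T by rewrite lt_neqAle tT.
have Hd : is_derive t 1 (prim 0 g) (g t) by apply: H; rewrite t0 tT.
have nE : \forall s \near t, prim 0 g s = cst 0 s.
  near=> s; apply: g0; apply/andP; split; apply/ltW; near: s.
    exact: lt_nbhsr.
  exact: lt_nbhsl.
have Hd0 : is_derive t 1 (cst (0 : R)) (g t) := @near_eq_is_derive R R R _ _ _ _ _ nE Hd.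
by rewrite -(@derive_val _ _ _ _ _ _ _ Hd0) derive_cst.
Unshelve. all: by end_near. Qed.

End PrimitiveLinearity.

Section Subsequence.
Context {R : realType} {M : metric_graph R} (D : graph_data M) (T : R).
Hypothesis T0 : 0 < T.
Notation leb := (@lebesgue_measure R).
Variables (eps : nat -> {posnum R}) (mu : nat -> R -> probM M) (j : nat -> flux M) (K : R).
Hypotheses (hCE : forall i, CE_bar T (mu i) (j i))
  (hz : forall i, exists zeta, has_density D T (eps i) (mu i) zeta)
  (hK : forall i, (dissipation_eps D T (eps i) (mu i) (j i) <= K%:E)%E).
Implicit Types (e : edge M) (v : vertex M).

Let T0' : 0 <= T := ltW T0.

Let clamp_equicvg (f : nat -> R -> R) (phi : nat -> nat) :
  (forall d, 0 < d -> exists2 h : R, 0 < h & forall n u w, 0 <= u <= T -> 0 <= w <= T ->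
     `|u - w| < h -> `|f n u - f n w| < d) ->
  (forall q : rat, cvgn (fun m => f (phi m) (clamp T (ratr q)))) ->
  forall t, 0 <= t <= T -> cvgn (fun m => f (phi m) t).
Proof.
move=> feq fq t tT.
rewrite -(clamp_id tT).
apply: (@equicontinuous_cvg _ (fun m s => f (phi m) (clamp T s))) => // d d0.
have [h h0 H] := feq d d0; exists h => // n u w uw.
apply: H; try exact: clamp_itv.
exact: le_lt_trans (clamp_lipschitz T0' u w) uw.
Qed.

(** The countably many quantities are the node masses and the primitives of the fluxes
    at rational times together with the dissipation; equicontinuity extends the
    convergence to all times. *)
Lemma convergent_subsequence : exists phi : nat -> nat, [/\
  forall m, (m <= phi m)%N,
  forall v t, 0 <= t <= T -> cvgn (fun m => gam (mu (phi m) t) v),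
  forall e v t, incident e v -> 0 <= t <= T ->
    cvgn (fun m => prim 0 (fun s => j (phi m) s e v) t) &
  cvgn (fun m => fine (dissipation_eps D T (eps (phi m)) (mu (phi m)) (j (phi m))))].
Proof.
pose J : countType := (vertex M * rat + edge M * vertex M * rat + unit)%type.
have /choice[B HB] : forall x : edge M * vertex M, exists B : R, incident x.1 x.2 ->
    forall n t, 0 <= t <= T -> `|prim 0 (fun s => j n s x.1 x.2) t| <= B.
  move=> [e v] /=; have [ev|_] := boolP (incident e v); last by exists 0.
  have [ij jC] := equiintegrable_flux hCE hz hK ev.
  have [C C0 HC] := jC 1 ltr01.
  exists (1 + C * fine (leb `[0, T])) => _ n t /andP[t0 tT].
  have sub : `[0, t] `<=` `[0, T] by apply: subset_itvl; rewrite bnd_simp.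
  have ijt : leb.-integrable `[0, t] (EFin \o (fun s => j n s e v)).
    by apply: integrableS (ij n).
  apply: le_trans (le_normr_Rintegral _ ijt) _ => //.
  apply: le_trans (HC n _ _ sub) _ => //.
  rewrite lerD2l ler_wpM2l// fine_le//.
  - by rewrite ge0_fin_numE//; exact: leb_itv_lty.
  - by rewrite ge0_fin_numE//; exact: leb_itv_lty.
  - by apply: le_measure => //; rewrite inE.
pose u (n : nat) (x : J) : R := match x with
  | inl (inl (v, q)) => gam (mu n (clamp T (ratr q))) v
  | inl (inr (e, v, q)) =>
      if incident e v then prim 0 (fun s => j n s e v) (clamp T (ratr q)) else 0
  | inr _ => fine (dissipation_eps D T (eps n) (mu n) (j n)) end.
pose b (x : J) : R := match x with
  | inl (inl _) => 1
  | inl (inr (e, v, q)) => `|B (e, v)|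
  | inr _ => K end.
have ub n x : `|u n x| <= b x.
  case: x => [[[v q]|[[e v] q]]|[]] /=.
  - by rewrite ger0_norm ?gam_ge0// gam_le1.
  - case: ifPn => ev; last by rewrite normr0.
    by apply: le_trans (HB (e, v) ev n _ (clamp_itv T0' _)) (ler_norm _).
  - have D0 := dissipation_ge0 hCE hz n; have DK := hK n.
    rewrite ger0_norm ?fine_ge0// -lee_fin fineK//.
    by rewrite ge0_fin_numE// (le_lt_trans DK)// ltry.
have [phi [phin cv]] := diagonal_subsequence ub.
exists phi; split => //.
- move=> v; apply: (clamp_equicvg (f := fun n t => gam (mu n t) v)).
    by move=> d d0; exact: (gam_equicontinuous T0 hCE hz hK v d0).
  by move=> q; exact: (cv (inl (inl (v, q)))).
- move=> e v t ev; move: t.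
  apply: (clamp_equicvg (f := fun n t => prim 0 (fun s => j n s e v) t)).
    by move=> d d0; exact: (equiintegrable_prim T0' (equiintegrable_flux hCE hz hK ev) d0).
  by move=> q; have := cv (inl (inr (e, v, q))); rewrite /u ev.
- exact: (cv (inr tt)).
Qed.

End Subsequence.

Section LimitFlux.
Context {R : realType} {M : metric_graph R} (D : graph_data M) (T : R).
Hypothesis T0 : 0 < T.
Notation leb := (@lebesgue_measure R).
Variables (eps : nat -> {posnum R}) (mu : nat -> R -> probM M) (j : nat -> flux M) (K : R).
Hypotheses (hCE : forall i, CE_bar T (mu i) (j i))
  (hz : forall i, exists zeta, has_density D T (eps i) (mu i) zeta)
  (hK : forall i, (dissipation_eps D T (eps i) (mu i) (j i) <= K%:E)%E)
  (eps0 : (eps n)%:num @[n --> \oo] --> (0 : R)).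
Hypotheses
  (jcv : forall e v t, incident e v -> 0 <= t <= T ->
    cvgn (fun m => prim 0 (fun s => j m s e v) t)).
Variables (U : set_system nat) (UU : UltraFilter U) (sU : \oo `<=` U).
Implicit Types (e : edge M) (v : vertex M).

Let T0' : 0 <= T := ltW T0.
Let mT : measurable (`[0, T]%classic : set R) := measurable_itv _.

(** The weak limits along an ultrafilter exist by equi-integrability, and their primitives
    are the limits along the whole sequence. Since the mass of the edges vanishes, the
    primitives of the two fluxes at an edge cancel in the limit, hence the limit
    fluxes are opposite almost everywhere. *)
Lemma limit_flux : exists jl : flux M, [/\
  forall e v, incident e v -> leb.-integrable `[0, T] (EFin \o (fun t => jl t e v)),
  forall e t, jl t e (ehead e) = - jl t e (etail e),
  forall e v A, incident e v -> measurable A -> A `<=` `[0, T]%classic ->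
    \int[leb]_(t in A) j n t e v @[n --> U] --> \int[leb]_(t in A) jl t e v &
  forall e v t, incident e v -> 0 <= t <= T ->
    prim 0 (fun s => j n s e v) t @[n --> \oo] --> prim 0 (fun s => jl s e v) t].
Proof.
have /choice[h Hh] : forall x : edge M * vertex M, exists g : R -> R, incident x.1 x.2 ->
    leb.-integrable `[0, T] (EFin \o g) /\
    forall A, measurable A -> A `<=` `[0, T]%classic ->
      \int[leb]_(t in A) j n t x.1 x.2 @[n --> U] --> \int[leb]_(t in A) g t.
  move=> [e v] /=; have [ev|_] := boolP (incident e v); last by exists (fun=> 0).
  have [g Hg] := @equiintegrable_ultra_density _ _ R leb _ mT (leb_itv_lty 0 T) nat U UU _
    (equiintegrable_flux hCE hz hK ev).
  by exists g.
have hint e v (ev : incident e v) := (Hh (e, v) ev).1.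
have hU e v (ev : incident e v) := (Hh (e, v) ev).2.
have hprim e v t : incident e v -> 0 <= t <= T ->
    prim 0 (fun s => j n s e v) t @[n --> \oo] --> prim 0 (h (e, v)) t.
  move=> ev tT; have cv := jcv ev tT.
  have cvU : prim 0 (fun s => j n s e v) t @[n --> U] --> limn (fun m => prim 0 (fun s => j m s e v) t).
    by apply: cvg_trans cv; exact: cvg_app.
  have sub : `[0, t] `<=` `[0, T].
    by apply: subset_itvl; rewrite bnd_simp; case/andP: tT.
  have <- : limn (fun m => prim 0 (fun s => j m s e v) t) = prim 0 (h (e, v)) t.
    have cvU' := hU e v ev `[0, t]%classic (measurable_itv _) sub.
    have l1 := cvg_lim (@Rhausdorff R) cvU; have l2 := cvg_lim (@Rhausdorff R) cvU'.
    by rewrite -l1 -[RHS]l2.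
  exact: cv.
have opp : forall e, {ae leb, forall t, t \in `[0, T] ->
    h (e, etail e) t + h (e, ehead e) t = 0}.
  move=> e; have et := incident_etail e; have eh := incident_ehead e.
  apply: prim_eq0_ae => [|t tT].
    by apply: integrableD_EFin => //; [exact: hint|exact: hint].
  rewrite (primD tT (hint _ _ et) (hint _ _ eh)).
  have ij v (ev : incident e v) n := (equiintegrable_flux hCE hz hK ev).1 n.
  have l1 : prim 0 (fun s => j n s e (etail e)) t + prim 0 (fun s => j n s e (ehead e)) t
      @[n --> \oo] --> prim 0 (h (e, etail e)) t + prim 0 (h (e, ehead e)) t.
    by apply: cvgD; exact: hprim.
  have l2 : prim 0 (fun s => j n s e (etail e)) t + prim 0 (fun s => j n s e (ehead e)) t
      @[n --> \oo] --> (0 : R).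
    rewrite (_ : (fun n => _) = (fun n => rho_mass (mu n 0) e - rho_mass (mu n t) e)); last first.
      apply/funext => n; rewrite -(primD tT (ij _ et n) (ij _ eh n)).
      by rewrite -[LHS]opprK -(rho_FTC T0 hCE hz hK n e tT) opprB.
    rewrite -[X in _ --> X](subrr (0 : R)); apply: cvgB.
      by apply: (rho_mass_cvg0 T0 hCE hz hK eps0); rewrite lexx.
    exact: (rho_mass_cvg0 T0 hCE hz hK eps0).
  exact: cvg_unique l1 l2.
(* Redefining the flux at the head on a null set makes the antisymmetry hold
   everywhere. *)
pose jl : flux M := fun t e v => if v == ehead e then - h (e, etail e) t else h (e, etail e) t.
have jlt e : (fun t => jl t e (etail e)) = h (e, etail e).
  by apply/funext => t; rewrite /jl (negbTE (etail_neq_ehead e)).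
have jlh e : (fun t => jl t e (ehead e)) = fun t => - h (e, etail e) t.
  by apply/funext => t; rewrite /jl eqxx.
have iN e : leb.-integrable `[0, T] (EFin \o (fun t => - h (e, etail e) t)).
  by have := integrableN (hint _ _ (incident_etail e)); apply: eq_integrable.
have jlint e v : incident e v -> leb.-integrable `[0, T] (EFin \o (fun t => jl t e v)).
  move=> ev; have [->|vt] := eqVneq v (etail e); first by rewrite jlt; exact/hint/incident_etail.
  have -> : v = ehead e by case/orP: ev => /eqP // vE; rewrite vE eqxx in vt.
  by rewrite jlh; exact: iN.
have jlE e v A : incident e v -> measurable A -> A `<=` `[0, T]%classic ->
    \int[leb]_(t in A) jl t e v = \int[leb]_(t in A) h (e, v) t.
  move=> ev mA AT; have [->|vt] := eqVneq v (etail e).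
    by apply: eq_Rintegral => t _; rewrite /jl (negbTE (etail_neq_ehead e)).
  have vE : v = ehead e by case/orP: ev => /eqP // vE; rewrite vE eqxx in vt.
  have mS (f : R -> R) : leb.-integrable `[0, T] (EFin \o f) -> measurable_fun A (EFin \o f).
    by move=> jf; apply: (@measurable_int _ _ _ leb); exact: integrableS jf.
  subst v; rewrite /Rintegral; congr fine; apply: ae_eq_integral => //.
  - exact: mS (jlint _ _ (incident_ehead e)).
  - exact: mS (hint _ _ (incident_ehead e)).
  - have F := ae_filter_ringOfSetsType leb.
    apply: filterS (opp e) => t Ht At; congr EFin.
    rewrite /jl eqxx; apply/eqP; rewrite eq_sym -addr_eq0 addrC; apply/eqP; apply: Ht.
    exact: AT.
exists jl; split => //.
- by move=> e t; rewrite /jl eqxx (negbTE (etail_neq_ehead e)).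
- by move=> e v A ev mA AT; rewrite jlE//; exact: hU.
- move=> e v t ev tT; rewrite [X in _ --> X](_ : _ = prim 0 (h (e, v)) t); first exact: hprim.
  by apply: jlE => //; apply: subset_itvl; rewrite bnd_simp; case/andP: tT.
Qed.

End LimitFlux.

(** * The limit curve *)

Section LimitCurve.
Context {R : realType} {M : metric_graph R} (D : graph_data M) (T : R).
Hypothesis T0 : 0 < T.
Notation leb := (@lebesgue_measure R).
Variables (eps : nat -> {posnum R}) (mu : nat -> R -> probM M) (j : nat -> flux M) (K : R).
Hypotheses (hCE : forall i, CE_bar T (mu i) (j i))
  (hz : forall i, exists zeta, has_density D T (eps i) (mu i) zeta)
  (hK : forall i, (dissipation_eps D T (eps i) (mu i) (j i) <= K%:E)%E)
  (eps0 : (eps n)%:num @[n --> \oo] --> (0 : R)).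
Implicit Types (e : edge M) (v : vertex M).

Let T0' : 0 <= T := ltW T0.
Let mT : measurable (`[0, T]%classic : set R) := measurable_itv _.

(** The edges lose their mass, so that the limits of the node masses sum up to 1. *)
Lemma limit_curve :
  (forall v t, 0 <= t <= T -> cvgn (fun n => gam (mu n t) v)) ->
  exists gamma : R -> probV M,
    forall v t, 0 <= t <= T -> gam (mu n t) v @[n --> \oo] --> (gamma t v : R).
Proof.
move=> gcv.
suff /choice[gamma Hg] : forall t, exists g : probV M,
    forall v, gam (mu n (clamp T t)) v @[n --> \oo] --> (g v : R).
  by exists gamma => v t tT; have := Hg t v; rewrite (clamp_id tT).
move=> t; have tT := clamp_itv T0' t; set s := clamp T t in tT *.
pose w v := limn (fun n => gam (mu n s) v).
have wl v : gam (mu n s) v @[n --> \oo] --> w v by exact: gcv.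
have w0 v : 0 <= w v by apply: limr_ge; [exact: gcv|apply: nearW => n; exact: gam_ge0].
have w1 : \sum_v w v = 1.
  have l1 : \sum_v gam (mu n s) v @[n --> \oo] --> \sum_v w v.
    by apply: cvg_sumr => v _; exact: wl.
  have l2 : \sum_v gam (mu n s) v @[n --> \oo] --> (1 - \sum_(e : edge M) 0 : R).
    rewrite (_ : (fun n => _) = (fun n => 1 - \sum_e rho_mass (mu n s) e)); last first.
      by apply/funext => n; rewrite -(sum_masses (mu n s)) addrK.
    apply: cvgB; first exact: cvg_cst.
    by apply: cvg_sumr => e _; exact: (rho_mass_cvg0 T0 hCE hz hK eps0).
  by rewrite -(cvg_lim (@Rhausdorff R) l1) (cvg_lim (@Rhausdorff R) l2) big1 ?subr0.
by exists (ProbV w0 w1).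
Qed.

Variables (gamma : R -> probV M) (jl : flux M).
Hypotheses
  (gl : forall v t, 0 <= t <= T -> gam (mu n t) v @[n --> \oo] --> (gamma t v : R))
  (ijl : forall e v, incident e v -> leb.-integrable `[0, T] (EFin \o (fun t => jl t e v)))
  (jlcv : forall e v t, incident e v -> 0 <= t <= T ->
     prim 0 (fun s => j n s e v) t @[n --> \oo] --> prim 0 (fun s => jl s e v) t).

(** The integrated continuity equation passes to the limit; it yields the absolute
    continuity of the limit curve and its derivative. *)
Lemma limit_gam_FTC v t : 0 <= t <= T ->
  gamma t v = gamma 0 v + prim 0 (fun s => \sum_(e : edge M | incident e v) jl s e v) t.
Proof.
move=> tT; apply/eqP; rewrite addrC -subr_eq; apply/eqP.
have t00 : 0 <= (0 : R) <= T by rewrite lexx.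
have l1 : gam (mu n t) v - gam (mu n 0) v @[n --> \oo] --> gamma t v - gamma 0 v.
  by apply: cvgB; exact: gl.
rewrite (prim_sum _ tT)//; last by move=> e ev; exact: ijl.
have l2 : gam (mu n t) v - gam (mu n 0) v @[n --> \oo] -->
    \sum_(e : edge M | incident e v) prim 0 (fun s => jl s e v) t.
  rewrite (_ : (fun n => _) = (fun n => \sum_(e : edge M | incident e v) prim 0 (fun s => j n s e v) t)).
    by apply: cvg_sumr => e ev; exact: jlcv.
  apply/funext => n; rewrite (gam_FTC T0 hCE hz hK)// (prim_sum _ tT)// => e ev.
  exact: (equiintegrable_flux hCE hz hK ev).1.
by rewrite -(cvg_lim (@Rhausdorff R) l1) (cvg_lim (@Rhausdorff R) l2).
Qed.

Lemma CE_hat_limit : CE_hat T gamma jl.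
Proof.
split.
- by move=> e v ev; apply/measurable_EFinP; exact: measurable_int (ijl ev).
- move=> v; pose G := fun s => \sum_(e : edge M | incident e v) jl s e v.
  have iG : leb.-integrable `[0, T] (EFin \o G) by apply: integrable_sumr => e ev; exact: ijl.
  apply: (abs_cont_eq (f := fun t => gamma 0 v + prim 0 G t)).
    by move=> t; rewrite in_itv/= => tT; rewrite (limit_gam_FTC v tT).
  move=> d d0; have [h h0 H] := abs_cont_prim iG d0.
  exists h => // n u w uw tuw uwh; apply: le_lt_trans (H n u w uw tuw uwh).
  by apply: ler_sum => i _; rewrite opprD addrACA subrr add0r.
move=> phi; pose G := fun s => \sum_v \sum_(e : edge M | incident e v) phi v * jl s e v.
have iGv v : leb.-integrable `[0, T]
    (EFin \o (fun s => \sum_(e : edge M | incident e v) phi v * jl s e v)).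
  by apply: integrable_sumr => e ev; apply: integrableZl_EFin => //; exact: ijl.
have iG : leb.-integrable `[0, T] (EFin \o G) by apply: integrable_sumr => v _; exact: iGv.
have FE t : 0 <= t <= T ->
    (cst (\sum_v phi v * gamma 0 v) + prim 0 G) t = \sum_v phi v * gamma t v.
  move=> tT; have -> : (cst (\sum_v phi v * gamma 0 v) + prim 0 G) t =
      \sum_v phi v * gamma 0 v + prim 0 G t by [].
  rewrite (prim_sum _ tT)//.
  rewrite -big_split/=; apply: eq_bigr => v _; rewrite (limit_gam_FTC v tT) mulrDr; congr (_ + _).
  rewrite !(prim_sum _ tT)//; [|by move=> e ev; exact: ijl|].
    by rewrite mulr_sumr; apply: eq_bigr => e ev; rewrite (primZ _ tT)//; exact: ijl.
  by move=> e ev; apply: integrableZl_EFin => //; exact: ijl.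
have F := ae_filter_ringOfSetsType leb.
apply: filterS (prim_ae_derive iG) => t H tT.
have Hd : is_derive t 1 (cst (\sum_v phi v * gamma 0 v) + prim 0 G) (0 + G t).
  by apply: is_deriveD; exact: H.
rewrite add0r in Hd.
have nE : \forall s \near t, (cst (\sum_v phi v * gamma 0 v) + prim 0 G) s =
    \sum_v phi v * gamma s v.
  move: tT; rewrite in_itv/= => /andP[t0 tT].
  near=> s; apply: FE; apply/andP; split; apply/ltW; near: s.
    exact: lt_nbhsr.
  exact: lt_nbhsl.
exact: (@near_eq_is_derive R R R _ _ _ _ _ nE Hd).
Unshelve. all: by end_near. Qed.

Lemma norm_integral_rho_le (m : probM M) e (f : R -> R) (B : R) :
  {within segment e, continuous f} -> (forall x, segment e x -> `|f x| <= B) ->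
  `|\int[rho m e]_(x in segment e) f x| <= B * rho_mass m e.
Proof.
move=> cf fB.
have mS : measurable (segment e : set (measurableTypeR R)) := measurable_segment e.
have mf : measurable_fun (segment e : set (measurableTypeR R)) f.
  by apply: subspace_continuous_measurable_fun => //; exact: measurable_itv.
have fin : (rho m e (segment e) < +oo)%E by rewrite -rho_massE ltry.
have jf : (rho m e).-integrable (segment e) (EFin \o f).
  apply: measurable_bounded_integrable => //.
  exists B; split; first exact: num_real.
  by move=> x Bx t et; apply: le_trans (fB t et) (ltW Bx).
apply: le_trans (le_normr_Rintegral mS jf) _.
rewrite /rho_mass -Rintegral_cst//; apply: le_Rintegral => //.
- exact: integrable_norm.
- apply: measurable_bounded_integrable => //.
  exists `|B|; split; first exact: num_real.
  by move=> x Bx t _; exact: ltW.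
Qed.

Lemma narrow_limit t : 0 <= t <= T -> narrow_cvg (fun n => mu n t) (probV_probM (gamma t)).
Proof.
move=> tT phi f cf; apply: cvgD.
  apply: cvg_sumr => v _; apply: cvgM; first exact: cvg_cst.
  exact: gl.
apply: cvg_sumr => e _.
rewrite [X in _ --> X](_ : _ = 0); last by rewrite /Rintegral integral_measure_zero.
have [B B0 fB] := within_continuous_bounded (ltW (len_gt0 e)) (cf e).
apply: norm_cvg0; apply: (squeeze_cvgr (f := fun=> 0) (h := fun n => B * rho_mass (mu n t) e)).
- by apply: nearW => n; rewrite normr_ge0/=; exact: norm_integral_rho_le.
- exact: cvg_cst.
- rewrite -[X in _ --> X](mulr0 B); apply: cvgM; first exact: cvg_cst.
  exact: (rho_mass_cvg0 T0 hCE hz hK eps0).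
Qed.

Lemma weakstar_limit : flux_weakstar_cvg T j jl.
Proof.
have jI := fun e v (ev : incident e v) n => (equiintegrable_flux hCE hz hK ev).1 n.
split.
- by move=> n e v ev; exact: jI.
- by move=> e v ev; exact: ijl.
move=> f cf; apply: cvg_sumr => v _; apply: cvg_sumr => e ev.
have [_ jC] := equiintegrable_flux hCE hz hK ev.
have [C C0 HC] := jC 1 ltr01.
have idiff n : leb.-integrable `[0, T] (EFin \o (fun t => j n t e v - jl t e v)).
  by apply: integrableB_EFin => //; [exact: jI|exact: ijl].
have [B B0 fB] := within_continuous_bounded T0' (cf e v ev).
have mf : measurable_fun `[0, T] (f e v).
  by apply: subspace_continuous_measurable_fun => //; exact: cf.
have ifm (h : R -> R) : leb.-integrable `[0, T] (EFin \o h) ->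
    leb.-integrable `[0, T] (EFin \o (fun t => f e v t * h t)).
  by move=> ih; apply: (@integrable_bounded_mul _ _ R leb _ mT (f e v) h B).
rewrite (_ : (fun n => _) = (fun n => \int[leb]_(t in `[0, T]) (f e v t * (j n t e v - jl t e v)) +
    \int[leb]_(t in `[0, T]) (f e v t * jl t e v))); last first.
  apply/funext => n; rewrite -RintegralD//; [|exact: ifm|exact/ifm/ijl].
  by apply: eq_Rintegral => t _; rewrite -mulrDr subrK.
rewrite -[X in _ --> X]add0r; apply: cvgD; last exact: cvg_cst.
apply: (weakstar_cvg0 (K := 1 + C * fine (leb `[0, T]) + \int[leb]_(t in `[0, T]) `|jl t e v|)
  T0' idiff); [| |exact: cf].
- move=> n; apply: (@le_trans _ _ (\int[leb]_(t in `[0, T]) (`|j n t e v| + `|jl t e v|))).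
    apply: le_Rintegral => //.
    + exact: integrable_norm (idiff n).
    + by apply: integrableD_EFin => //; [exact: integrable_norm (jI _ _ ev n)|exact: integrable_norm (ijl ev)].
    + by move=> t _; exact: ler_normB.
  rewrite RintegralD//; [|exact: integrable_norm (jI _ _ ev n)|exact: integrable_norm (ijl ev)].
  by rewrite lerD2r; exact: HC.
- move=> t tT; rewrite (_ : (fun n => _) =
    (fun n => prim 0 (fun s => j n s e v) t - prim 0 (fun s => jl s e v) t)).
    rewrite -[X in _ --> X](subrr (prim 0 (fun s => jl s e v) t)).
    by apply: cvgB; [exact: jlcv|exact: cvg_cst].
  by apply/funext => n; rewrite (prim_fB tT)//; [exact: jI|exact: ijl].
Qed.

Lemma omega_eps_cvg v : omega_eps D (eps n)%:num v @[n --> \oo] --> omega_eps D 0 v.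
Proof.
have Z0 : Zeps D 0 != 0 by rewrite gt_eqF// (Zeps_gt0 D v).
apply: cvgM; first exact: cvg_cst.
apply: cvgV => //; apply: cvgD; first exact: cvg_cst.
by apply: cvgM; [exact: eps0|exact: cvg_cst].
Qed.

(** The entropies on the edges are nonnegative and the reference weights of the nodes
    converge, hence the entropies of the node masses suffice. *)
Lemma energy_liminf t (c : R) : 0 <= t <= T -> (c%:E < energy_0 D (gamma t))%E ->
  \forall n \near \oo, (c%:E <= energy_eps D (eps n) (mu n t))%E.
Proof.
move=> tT cE.
have om0 v (x : R) : 0 <= x -> 0 < omega_eps D x v.
  by move=> x0; rewrite divr_gt0 ?omegaP_gt0 ?(Zeps_gt0 D v).
have := @sum_entropy_pt_liminf R (vertex M) (fun n v => gam (mu n t) v)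
  (fun n v => omega_eps D (eps n)%:num v) (gamma t) (omega_eps D 0) c.
move=> /(_ _ _ _ _ _ cE) H.
apply: filterS (H _ _ _ _ _) => [n /le_trans -> //|n v|n v|v|v|v].
- by rewrite leeDr// sume_ge0// => e _; exact: entropy_ge0.
- exact: gam_ge0.
- exact: om0.
- exact: om0.
- exact: gl.
- exact: omega_eps_cvg.
Qed.

End LimitCurve.

(** * The limiting dissipation *)

Section LimitDissipation.
Context {R : realType} {M : metric_graph R} (D : graph_data M) (T : R).
Notation leb := (@lebesgue_measure R).
Implicit Types (e : edge M) (v : vertex M).

Definition limit_edgecost (gamma : R -> probV M) (jl : flux M) e t : \bar R :=
  edgecost (alpha D e (etail e)) (alpha D e (ehead e)) (jl t e (etail e))
    (gdens D (probV_probM (gamma t)) (etail e)) (gdens D (probV_probM (gamma t)) (ehead e)).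

Lemma limit_edgecost_ge0 gamma jl e t : (0 <= limit_edgecost gamma jl e t)%E.
Proof.
have a0 := ltW (alpha_gt0 D (incident_etail e)); have b0 := ltW (alpha_gt0 D (incident_ehead e)).
have h0 : 0 <= alpha D e (etail e) * alpha D e (ehead e) / (alpha D e (etail e) + alpha D e (ehead e)).
  by apply: divr_ge0; [exact: mulr_ge0|exact: addr_ge0].
apply: adde_ge0.
  by apply: Cpersp_ge0; rewrite mulr_ge0// mulr_ge0// sqrtr_ge0.
by rewrite lee_fin mulr_ge0 ?sqr_ge0// mulr_ge0.
Qed.

(** The harmonic mean in [kappa_bar] is [2 * a * b / (a + b)] with [a] and [b] the values
    of [alpha] at the two ends of the edge. *)
Lemma limit_integrandE (g : probV M) (x : R) e :
  let v := etail e in let w := ehead e in let om := omega_eps D 0 in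
  (Cpersp x (sigma_bar D e (g v) (g w))
   + (2 * sigma_bar D e (om v) (om w)
      * `|Num.sqrt (g v / om v) - Num.sqrt (g w / om w)| ^+ 2)%:E)%E =
  edgecost (alpha D e v) (alpha D e w) x (gdens D (probV_probM g) v) (gdens D (probV_probM g) w).
Proof.
move=> v w om.
have ov := omegaP_gt0 D v; have ow := omegaP_gt0 D w.
have Z0 : 0 < Zeps D 0 := Zeps_gt0 D v (lexx 0).
have a0 := alpha_gt0 D (incident_etail e); have b0 := alpha_gt0 D (incident_ehead e).
have gv0 : 0 <= g v := weight_ge0 g v; have gw0 : 0 <= g w := weight_ge0 g w.
have sv : 0 < Num.sqrt (omega D v) by rewrite sqrtr_gt0.
have sw : 0 < Num.sqrt (omega D w) by rewrite sqrtr_gt0.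
have sZ : 0 < Num.sqrt (Zeps D 0) by rewrite sqrtr_gt0.
have ZE : Zeps D 0 = Num.sqrt (Zeps D 0) ^+ 2 by rewrite sqr_sqrtr// ltW.
have ab : alpha D e v + alpha D e w != 0 by rewrite gt_eqF// addr_gt0.
have kE : kappa_bar D e = alpha D e v * alpha D e w / (alpha D e v + alpha D e w)
    / (Num.sqrt (omega D v) * Num.sqrt (omega D w)).
  rewrite /kappa_bar /Harm ![pi_end _ _ _ * _]mulrC -/(alpha D e v) -/(alpha D e w).
  rewrite sqrtrM ?(ltW ov)//; field.
  by rewrite ab !gt_eqF.
rewrite /edgecost; congr (Cpersp _ _ + _%:E)%E.
  rewrite /sigma_bar kE /gdens /= !sqrtrM// !sqrtrV ?(ltW ov) ?(ltW ow)//; field.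
  by rewrite ab !gt_eqF.
rewrite real_normK ?num_real// /sigma_bar kE /gdens /= /om /omega_eps.
rewrite (sqrtrM _ (divr_ge0 (ltW ov) (ltW Z0))).
rewrite !(sqrtrM _ (ltW ov)) !(sqrtrM _ (ltW ow)) !(sqrtrM _ gv0) !(sqrtrM _ gw0).
rewrite !sqrtrV ?divr_ge0 ?(ltW ov) ?(ltW ow) ?(ltW Z0)//.
rewrite !(sqrtrM _ (ltW ov)) !(sqrtrM _ (ltW ow)) sqrtrV ?(ltW Z0)//; field.
by rewrite ab !gt_eqF.
Qed.

Lemma dissipation_0E (gamma : R -> probV M) (jl : flux M) :
  CE_hat T gamma jl -> flux_antisym T jl ->
  dissipation_0 D T gamma jl =
    (\sum_e \int[leb]_(t in `[0%R, T]) limit_edgecost gamma jl e t)%E.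
Proof.
move=> ce an; rewrite /dissipation_0 asboolT//.
by apply: eq_bigr => e _; apply: eq_integral => t _; exact: limit_integrandE.
Qed.

Hypothesis T0 : 0 < T.
Variables (eps : nat -> {posnum R}) (mu : nat -> R -> probM M) (j : nat -> flux M) (K : R).
Hypotheses (hCE : forall i, CE_bar T (mu i) (j i))
  (hz : forall i, exists zeta, has_density D T (eps i) (mu i) zeta)
  (hK : forall i, (dissipation_eps D T (eps i) (mu i) (j i) <= K%:E)%E).
Variables (U : set_system nat) (UU : UltraFilter U) (sU : \oo `<=` U).
Variables (gamma : R -> probV M) (jl : flux M).
Hypotheses
  (gl : forall v t, 0 <= t <= T -> gam (mu n t) v @[n --> \oo] --> (gamma t v : R))
  (ijl : forall e v, incident e v -> leb.-integrable `[0, T] (EFin \o (fun t => jl t e v)))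
  (jlN : forall e t, jl t e (ehead e) = - jl t e (etail e))
  (jlU : forall e v A, incident e v -> measurable A -> A `<=` `[0, T]%classic ->
      \int[leb]_(t in A) j n t e v @[n --> U] --> \int[leb]_(t in A) jl t e v).

Let mT : measurable (`[0, T]%classic : set R) := measurable_itv _.

Lemma edge_dissipation_liminf e (c : R) :
  (c%:E < \int[leb]_(t in `[0%R, T]) limit_edgecost gamma jl e t)%E ->
  U [set n | (c%:E <= \int[leb]_(t in `[0%R, T])
     (edge_halfcost D eps mu j n e (etail e) t + edge_halfcost D eps mu j n e (ehead e) t))%E].
Proof.
have et := incident_etail e; have eh := incident_ehead e.
have [G gG] := gdens_bound D.
have gcv v t : t \in `[0, T] ->
    gdens D (mu n t) v @[n --> \oo] --> gdens D (probV_probM (gamma t)) v.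
  rewrite in_itv/= => tT; apply: cvg_comp; last exact: sqrt_continuous.
  by apply: cvgM; [exact: gl|exact: cvg_cst].
apply: (@edge_liminf R `[0, T]%classic mT (leb_itv_lty 0 T) _ _ G
  (alpha_gt0 D et) (alpha_gt0 D eh) U UU sU).
- by move=> n; exact: (equiintegrable_flux hCE hz hK et).1.
- by move=> n; exact: (equiintegrable_flux hCE hz hK eh).1.
- exact: ijl.
- by move=> A mA AT; exact: jlU.
- move=> A mA AT; rewrite (_ : (fun t => - jl t e (etail e)) = (fun t => jl t e (ehead e))).
    exact: jlU.
  by apply/funext => t; rewrite jlN.
- by move=> n; exact: (measurable_gdens D hCE n (etail e)).
- by move=> n; exact: (measurable_gdens D hCE n (ehead e)).
- by move=> n; exact: (measurable_zdens D eps hCE n e).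
- by move=> n t _; exact: gG.
- by move=> n t _; exact: gG.
- by move=> n t _; exact: sqrtr_ge0.
- by move=> t tT; exact: gcv.
- by move=> t tT; exact: gcv.
- move=> n; have Kn := hK n; rewrite dissipation_edges// in Kn.
  have := le_lt_trans Kn (ltry K); apply: le_lt_trans.
  rewrite (bigD1 e)//= leeDl// sume_ge0// => f _; apply: integral_ge0 => t _.
  by rewrite adde_ge0// edge_halfcost_ge0// ?incident_etail ?incident_ehead.
Qed.

(** The lower bounds of the single edges hold on a set of the ultrafilter. There are
    finitely many edges, and the total dissipations converge along the sequence. *)
Lemma dissipation_liminf (d : R) : CE_hat T gamma jl -> flux_antisym T jl ->
  fine (dissipation_eps D T (eps n) (mu n) (j n)) @[n --> \oo] --> d ->
  (dissipation_0 D T gamma jl <= d%:E)%E.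
Proof.
move=> ce an dl; rewrite dissipation_0E//; apply: sum_real_lt => [e|c Hc].
  by apply: integral_ge0 => t _; exact: limit_edgecost_ge0.
have dU : fine (dissipation_eps D T (eps n) (mu n) (j n)) @[n --> U] --> d.
  by apply: cvg_trans dl; exact: cvg_app.
rewrite -(cvg_lim (@Rhausdorff R) dU); apply: limr_ge; first by apply/cvg_ex; exists d.
have UF : ProperFilter U by exact: ultra_proper.
have H : U [set n | forall e, ((c e)%:E <= \int[leb]_(t in `[0%R, T])
     (edge_halfcost D eps mu j n e (etail e) t + edge_halfcost D eps mu j n e (ehead e) t))%E].
  by apply: filter_forall => e; exact: edge_dissipation_liminf (Hc e).
apply: filterS H => n Hn.
rewrite -lee_fin fineK; last first.
  rewrite ge0_fin_numE; last exact: (dissipation_ge0 hCE hz n).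
  exact: le_lt_trans (hK n) (ltry K).
rewrite dissipation_edges// -sumEFin; apply: lee_sum => e _; exact: Hn.
Qed.

End LimitDissipation.

(** * The liminf inequality for the total functional *)

(** The liminf is superadditive, and the subtracted sequence converges to a real number. *)
Lemma liminf_diff {R : realType} (a b c : R) (u v w : nat -> \bar R) :
  (forall r, r < a -> \forall n \near \oo, (r%:E <= u n)%E) ->
  v n @[n --> \oo] --> b%:E ->
  (c%:E <= limn_einf w)%E ->
  ((a - b + c)%:E <= limn_einf (fun n => (u n - v n) + w n))%E.
Proof.
move=> ua vb wc; apply: le_limn_einf => r; rewrite lte_fin => rabc.
pose d := (a - b + c - r) / 3.
have d0 : 0 < d by rewrite divr_gt0// subr_gt0.
have ud : \forall n \near \oo, ((a - d)%:E <= u n)%E by apply: ua; rewrite ltrBlDr ltrDl.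
have vd : \forall n \near \oo, (v n <= (b + d)%:E)%E.
  have [vfin fv] := (fine_cvgP v b).1 vb.
  have bd : b < b + d by rewrite ltrDl.
  by apply: filterS2 vfin (cvgr_le _ fv _ bd) => n vn; rewrite /= -lee_fin fineK.
have wd : \forall n \near \oo, ((c - d)%:E <= w n)%E.
  by apply: limn_einf_gt; apply: lt_le_trans wc; rewrite lte_fin ltrBlDr ltrDl.
apply: filterS3 ud vd wd => n un vn wn.
apply: (@le_trans _ _ (((a - d)%:E - (b + d)%:E) + (c - d)%:E)%E).
  by rewrite -EFinB -EFinD lee_fin /d; lra.
by apply: leeD => //; exact: leeB.
Qed.

Lemma energy_0_fin {R : realType} {M : metric_graph R} (D : graph_data M) (g : probV M) :
  energy_0 D g \is a fin_num.
Proof.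
rewrite /energy_0 sum_fin_num; apply/allP => x /mapP[v _ ->].
by rewrite entropy_ptE// divr_gt0 ?omegaP_gt0 ?(Zeps_gt0 D v).
Qed.

Theorem theorem5p16 (R : realType) (M : metric_graph R) (D : graph_data M)
  (T : R) (hT : 0 < T)
  (mu : {posnum R} -> R -> probM M) (j : {posnum R} -> flux M)
  (zeta : {posnum R} -> R -> edge M -> R)
  (hCE : forall eps, CE_bar T (mu eps) (j eps))
  (hzeta : forall eps, has_density D T eps (mu eps) (zeta eps))
  (hE : (ereal_sup [set energy_eps D eps (mu eps t)
                   | eps in setT & t in `[0%R, T]%classic] < +oo)%E)
  (hD : (ereal_sup [set dissipation_eps D T eps (mu eps) (j eps)
                   | eps in setT] < +oo)%E) :
  exists (gamma : R -> probV M) (jl : flux M) (s : nat -> {posnum R}),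
    CE_hat T gamma jl /\ flux_antisym T jl /\
    ((s n)%:num @[n --> \oo] --> (0 : R)) /\
    (forall t, t \in `[0, T] ->
       narrow_cvg (fun n => mu (s n) t) (probV_probM (gamma t))) /\
    flux_weakstar_cvg T (fun n => j (s n)) jl /\
    (forall t, t \in `[0, T] ->
       (energy_0 D (gamma t) <=
        limn_einf (fun n => energy_eps D (s n) (mu (s n) t)))%E) /\
    (dissipation_0 D T gamma jl <=
     limn_einf (fun n => dissipation_eps D T (s n) (mu (s n)) (j (s n))))%E /\
    ((energy_eps D (s n) (mu (s n) 0) @[n --> \oo] --> energy_0 D (gamma 0)) ->
     (L_0 D T gamma jl <=
      limn_einf (fun n => L_eps D T (s n) (mu (s n)) (j (s n))))%E).
Proof.
have hz eps : exists zeta, has_density D T eps (mu eps) zeta by exists (zeta eps).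
have [K hK] : exists K : R, forall eps, (dissipation_eps D T eps (mu eps) (j eps) <= K%:E)%E.
  set S := ereal_sup _ in hD.
  have leS eps : (dissipation_eps D T eps (mu eps) (j eps) <= S)%E.
    by apply: ereal_sup_ubound; exists eps.
  exists (fine S) => eps; rewrite fineK// ge0_fin_numE//.
  exact: le_trans (dissipation_ge0 hCE hz eps) (leS eps).
pose ep (n : nat) : {posnum R} := PosNum (divr_gt0 ltr01 (ltr0Sn R n)).
have [phi [phin gcv jcv dcv]] := convergent_subsequence hT (eps := ep) (fun n => hCE (ep n))
  (fun n => hz (ep n)) (fun n => hK (ep n)).
pose s n := ep (phi n).
have s0 : (s n)%:num @[n --> \oo] --> (0 : R).
  apply: (squeeze_cvgr (f := fun=> 0) (h := fun n => n.+1%:R^-1)).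
  - apply: nearW => n; apply/andP; split; first exact: ge0.
    by rewrite /= div1r lef_pV2 ?posrE// ler_nat ltnS.
  - exact: cvg_cst.
  - exact: cvg_harmonic.
pose mus n := mu (s n); pose js n := j (s n).
have hCEs n : CE_bar T (mus n) (js n) := hCE (s n).
have hzs n : exists zeta, has_density D T (s n) (mus n) zeta := hz (s n).
have hKs n : (dissipation_eps D T (s n) (mus n) (js n) <= K%:E)%E := hK (s n).
have [U [UU sU]] := @ultraFilterLemma nat \oo _.
have [gamma gl] := limit_curve hT hCEs hzs hKs s0 gcv.
have [jl [ijl jlN jlU jlcv]] := limit_flux hT hCEs hzs hKs s0 jcv UU sU.
have ce : CE_hat T gamma jl := CE_hat_limit hT hCEs hzs hKs gl ijl jlcv.
have an : flux_antisym T jl.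
  move=> e; have F := ae_filter_ringOfSetsType (@lebesgue_measure R).
  by apply: nearW => t _; rewrite jlN opprK.
have d0 := dissipation_liminf hCEs hzs hKs UU sU gl ijl jlN jlU ce an dcv.
have dle : (dissipation_0 D T gamma jl <=
    limn_einf (fun n => dissipation_eps D T (s n) (mus n) (js n)))%E.
  apply: le_trans d0 _; apply: le_limn_einf => c; rewrite lte_fin => cd.
  apply: filterS (cvgr_ge _ dcv _ cd) => n cn.
  have D0 := dissipation_ge0 hCEs hzs n.
  rewrite -[leRHS]fineK ?lee_fin// ge0_fin_numE//.
  exact: le_lt_trans (hKs n) (ltry K).
have Elow t (tT : 0 <= t <= T) (c : R) : (c%:E < energy_0 D (gamma t))%E ->
    \forall n \near \oo, (c%:E <= energy_eps D (s n) (mus n t))%E.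
  exact: (energy_liminf s0 gl tT).
exists gamma, jl, s; split; [by []|split; [by []|split; [by []|split; [|split; [|split; [|split; [by []|]]]]]]].
- by move=> t tT; apply: (narrow_limit hT hCEs hzs hKs s0 gl).
- exact: (weakstar_limit hT hCEs hzs hKs ijl jlcv).
- by move=> t tT; apply: le_limn_einf => c; exact: Elow.
move=> E0; rewrite /L_0.
have dfin : dissipation_0 D T gamma jl \is a fin_num.
  rewrite ge0_fin_numE; first exact: le_lt_trans d0 (ltry _).
  rewrite dissipation_0E//; apply: sume_ge0 => e _; apply: integral_ge0 => t _.
  exact: limit_edgecost_ge0.
rewrite -(fineK (energy_0_fin D (gamma T))) -(fineK (energy_0_fin D (gamma 0))) -(fineK dfin).
rewrite -EFinB -EFinD; apply: liminf_diff.
- move=> r rT; apply: Elow; first by rewrite lexx ltW.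
  by rewrite -[ltRHS]fineK ?energy_0_fin// lte_fin.
- by rewrite fineK// energy_0_fin.
- by rewrite fineK.
Qed.
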